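(* Let $m\in\mathbb N$, let $B$ be a real skew-symmetric $m\times m$ matrix with trivial kernel, and let $\mathcal G$, $Q=m+2$, $X_1,\dots,X_m$ and $\nabla_{\mathcal G}$ be as in the context. Let $p\ge 2$, $\theta\in\mathbb R$, and let $d$ be a regular positive homogeneous function on $\mathcal G$. Define the horizontal vector field (written in the basis $X_1,\dots,X_m$) \[ Z_d=\frac{m+2}{m}\,\frac{z}{d}-\frac{4p\theta}{m}\,\frac{t}{d^2}\,B^{-1}\nabla_{\mathcal G}d . \] Then for every $u\in C_c^\infty(\mathcal G\setminus\{0\})$, \[ \int_{\mathcal G}\frac{|\langle \nabla_{\mathcal G}u, Z_d\rangle|^p}{d^{p(\theta-1)}}\,dz\,dt\;\ge\;\left|\frac{Q-p\theta}{p}\right|^p\int_{\mathcal G}\frac{|u|^p}{d^{p\theta}}\,dz\,dt . \] If, additionally, $\langle z, B^{-1}\nabla_z d\rangle=0$ on $\mathcal G\setminus\{0\}$ (where $\nabla_z$ is the Euclidean gradient in the $z$-variables), then this inequality is sharp (the constant $\left|\frac{Q-p\theta}{p}\right|^p$ cannot be replaced by a larger one), and equality is attained by $u(z,t)=\left(\frac{|t|}{|z|^2}\right)^{\frac{Q-2}{2p}}$.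
   Context: $\mathcal G$ is $\mathbb R^m\times\mathbb R$ with coordinates $(z,t)$ and group law $(z,t)\circ(\eta,\tau)=(z+\eta,\ t+\tau+\tfrac12\langle Bz,\eta\rangle)$, where $\langle\cdot,\cdot\rangle$ is the Euclidean inner product on $\mathbb R^m$; dilations are $\delta_\gamma(z,t)=(\gamma z,\gamma^2t)$, $\gamma>0$, and $Q=m+2$ is the homogeneous dimension. The horizontal vector fields are $X_i=\partial_{z_i}+\tfrac12(Bz)_i\partial_t$, $i=1,\dots,m$, and $\nabla_{\mathcal G}u=(X_1u,\dots,X_mu)\in\mathbb R^m$; horizontal vector fields are identified with $\mathbb R^m$-valued functions via this basis, and the horizontal inner product is the Euclidean one. Integration is with respect to Lebesgue measure $dz\,dt$. Let $L=\{(z,t):z=0\}$. A continuous function $d:\mathbb R^{m+1}\to[0,\infty)$ is positive homogeneous if $d(\delta_\lambda(z,t))=\lambda d(z,t)$ for all $\lambda>0$ and $d(z,t)>0$ for $(z,t)\ne(0,0)$. It is regular if moreover: (d.1) $d\in C^\infty(\mathcal G\setminus L)$; (d.2) $\nabla_{\mathcal G}d$ and $\partial_t d$ belong to $L^\infty_{\mathrm{loc}}(\mathcal G\setminus\{0\})$; (d.3) for a.e. $t\in\mathbb R$, $\lim_{|z|\to0}\langle z/|z|, B^{-1}\nabla_{\mathcal G}d\rangle=0$. *)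

(* Defs.v *)
From HB Require Import structures.
From mathcomp Require Import all_boot all_order all_algebra.
From mathcomp Require Import all_classical all_reals all_analysis.
Set Implicit Arguments. Unset Strict Implicit. Unset Printing Implicit Defensive.
Import Order.TTheory GRing.Theory Num.Theory.
Import numFieldNormedType.Exports.
Local Open Scope classical_set_scope.
Local Open Scope ring_scope.

Section Carnot.
Variable R : realType.

Definition pt (m : nat) := ('rV[R]_m * R)%type.

Definition dotr m (a b : 'rV[R]_m) : R := \sum_(i < m) a 0 i * b 0 i.

Definition ebase m (i : 'I_m) : 'rV[R]_m := \row_j (i == j)%:R.

Definition Bmul m (B : 'M[R]_m) (z : 'rV[R]_m) : 'rV[R]_m := z *m B^T.

Definition Binv m (B : 'M[R]_m) (w : 'rV[R]_m) : 'rV[R]_m := w *m (invmx B)^T.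

Definition dz m (f : pt m -> R) (i : 'I_m) (x : pt m) : R :=
  'D_(ebase i, 0) f x.
Definition dt m (f : pt m -> R) (x : pt m) : R := 'D_(0, 1) f x.

Definition Xf m (B : 'M[R]_m) (i : 'I_m) (f : pt m -> R) (x : pt m) : R :=
  dz f i x + 2^-1 * (Bmul B x.1) 0 i * dt f x.

Definition gradG m (B : 'M[R]_m) (f : pt m -> R) (x : pt m) : 'rV[R]_m :=
  \row_i Xf B i f x.

Definition gradz m (f : pt m -> R) (x : pt m) : 'rV[R]_m := \row_i dz f i x.

Definition dil m (g : R) (x : pt m) : pt m := (g *: x.1, g ^+ 2 * x.2).

Fixpoint Ck m (k : nat) (U : set (pt m)) (f : pt m -> R) : Prop :=
  match k with
  | 0%N => forall x, U x -> {for x, continuous f}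
  | k'.+1 => (forall x, U x -> {for x, continuous f}) /\
      forall v : pt m, (forall x, U x -> derivable f x v) /\ Ck k' U ('D_v f)
  end.

Definition smooth_on m (U : set (pt m)) (f : pt m -> R) := forall k, Ck k U f.

Definition Cc_inf_punct m (u : pt m -> R) : Prop :=
  smooth_on setT u /\
  exists K : set (pt m), [/\ compact K, ~ K 0 & forall x, ~ K x -> u x = 0].

Definition Lset m : set (pt m) := [set x | x.1 = 0].

Definition pos_homogeneous m (d : pt m -> R) : Prop :=
  continuous d /\
  (forall (l : R) x, 0 < l -> d (dil l x) = l * d x) /\
  (forall x, x != 0 -> 0 < d x).

Definition regular_hom m (B : 'M[R]_m) (d : pt m -> R) : Prop :=
  [/\ pos_homogeneous d,
   (* (d.1) *) smooth_on (~` @Lset m) d,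
   (* (d.2) horizontal gradient and d_t d in L^oo_loc(G \ {0}); these are
      defined a.e. (off the null set L), and are continuous there, so local
      essential boundedness = local boundedness off L *)
      (forall x0 : pt m, x0 != 0 -> exists r : R, 0 < r /\ exists C : R,
          forall x, ball x0 r x -> ~ @Lset m x ->
            (forall i, `|gradG B d x 0 i| <= C) /\ `|dt d x| <= C) &
      {ae lebesgue_measure, forall t : R,
         (fun z : 'rV[R]_m => dotr (`|z|^-1 *: z) (Binv B (gradG B d (z, t))))
            @ (0 : 'rV[R]_m)^' --> (0 : R)}].

(* Lebesgue integral over R^n of a nonnegative function, computed as the
   iterated integral over the coordinates (equal to the Lebesgue integral
   for nonnegative measurable functions by Tonelli) *)
Fixpoint iint (n : nat) : ('rV[R]_n -> \bar R) -> \bar R :=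
  match n return ('rV[R]_n -> \bar R) -> \bar R with
  | 0%N => fun f => f 0
  | n'.+1 => fun f =>
      (\int[lebesgue_measure]_(x in [set: R])
         iint (fun y : 'rV[R]_n' =>
           f (\row_(i < n'.+1) (if unlift ord0 i is Some j then y ord0 j else x))))%E
  end.

Definition Gint m (f : pt m -> \bar R) : \bar R :=
  (\int[lebesgue_measure]_(t in setT) iint (fun z => f (z, t)))%E.

Definition Zd m (B : 'M[R]_m) (p theta : R) (d : pt m -> R) (x : pt m)
  : 'rV[R]_m :=
  ((m%:R + 2) / m%:R / d x) *: x.1
  - (4 * p * theta / m%:R * x.2 / (d x ^+ 2)) *: Binv B (gradG B d x).

Definition lhs_int m B p theta (d : pt m -> R) (u : pt m -> R) : \bar R :=
  Gint (fun x => ((`|dotr (gradG B u x) (Zd B p theta d x)| `^ p)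
                   / (d x `^ (p * (theta - 1))))%:E).

Definition rhs_int m p theta (d : pt m -> R) (u : pt m -> R) : \bar R :=
  Gint (fun x => ((`|u x| `^ p) / (d x `^ (p * theta)))%:E).

End Carnot.

(* Main.v *)
Require Import Defs.
From HB Require Import structures.
From mathcomp Require Import all_boot all_order all_algebra.
From mathcomp Require Import all_classical all_reals all_analysis.
From mathcomp Require Import measurable_realfun ring lra.
Import Order.TTheory GRing.Theory Num.Theory.
Import numFieldNormedType.Exports.
Local Open Scope classical_set_scope.
Local Open Scope ring_scope.
Import HBNNSimple.
Set Implicit Arguments. Unset Strict Implicit. Unset Printing Implicit Defensive.

(** Write [f = d^(-p theta)] and [kappa = (Q - p theta) / p]. The tangent inequality for
    [|s|^p], applied at [b = - kappa u d^(-theta)] and [a = <grad u, Z_d> d^(1 - theta)], bounds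
    the left integrand below by [|kappa|^p] times the right one minus a multiple of
    [H = p |u|^(p-2) u <grad u, Z_d> d f + (Q - p theta) |u|^p f]. Off the axis [z = 0], the
    skew-symmetry of [B] and Euler's identity for [d] make [H] a Euclidean divergence
    [sum_j D_j psi_j + D_t psi_t] of a field with compact support away from the origin; each
    term integrates to zero along lines, and since [m >= 2] almost every such line misses the
    axis, where [d] need not be differentiable.

    If [<z, B^-1 grad_z d> = 0], then [<grad u, Z_d>] is explicit for [u = A(t) W(|z|^2)], and
    equals [- kappa u / d] for the extremal [u], so the two integrands are proportional.
    For sharpness, take [|z|^(-m/p)] times a bump in [t] around [1] and a logarithmic bump
    [eta (ln |z|^2 / N + 2)]. The integrands then agree up to an error of relative size [1 / N]
    on the support. Dilating [z] translates the argument of [eta] and preserves [|z|^(-m) dz],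
    so that finitely many translates of [|u|^p], all of the same mass, dominate the error
    uniformly in [N]. *)

(** The divergence field is the sum of two pieces. One is the Euler field [(z, 2 t)] times
    [f |u|^p], whose divergence gives [(Q - p theta) f |u|^p] plus a derivative of [u] along
    [(z, 2 t)]. That direction is not horizontal: it contains [2 t D_t u]. The other piece is the
    horizontal field with components [(4 / m) t f om(u) sum_i (B^-1)_ij X_i u]. In its divergence
    [sum_ij (B^-1)_ij X_j X_i u] reduces, by skew-symmetry, to commutators, hence to a trace times
    [D_t u]; the factor [4 / m] makes this cancel the unwanted term. Since [d] enters the field
    undifferentiated, only first derivatives of [d] occur in [H], and these are bounded near every
    point other than the origin. Integrals are iterated in a fixed order, so the integral of a
    derivative is not computed by integrating first in its own direction. Difference quotients have
    integral zero by translation invariance, and dominated convergence passes to the limit.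
    Compactly supported integrands are handled by real-valued integrals. The extremal function is
    not of that kind: its identity is proved between extended integrals, with no measurability or
    finiteness established. *)

Section Continuity.
Context {R : realType} {T : topologicalType}.
Implicit Types (f g : T -> R) (x : T).

Lemma continuous_fun_cst (c : R) x : {for x, continuous (fun _ : T => c)}.
Proof. exact: cvg_cst. Qed.

Lemma continuous_funD f g x : {for x, continuous f} -> {for x, continuous g} ->
  {for x, continuous (fun y => f y + g y)}.
Proof. by move=> cf cg; exact: cvgD cf cg. Qed.

Lemma continuous_funM f g x : {for x, continuous f} -> {for x, continuous g} ->
  {for x, continuous (fun y => f y * g y)}.
Proof. by move=> cf cg; exact: cvgM cf cg. Qed.

Lemma continuous_funZ (c : R) f x : {for x, continuous f} -> {for x, continuous (fun y => c * f y)}.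
Proof. by move=> cf; apply: continuous_funM => //; exact: continuous_fun_cst. Qed.

Lemma continuous_fun_comp (h : R -> R) f x : {for f x, continuous h} -> {for x, continuous f} ->
  {for x, continuous (fun y => h (f y))}.
Proof. by move=> ch cf; exact: (@continuous_comp _ _ _ f h). Qed.

Lemma continuous_fun_sum (J : finType) (F : J -> T -> R) x : (forall i, {for x, continuous (F i)}) ->
  {for x, continuous (fun y => \sum_i F i y)}.
Proof.
move=> cF; elim: (index_enum J) => [|a s IH].
  by rewrite (_ : (fun y => _) = fun=> 0); [exact: continuous_fun_cst|apply/funext => y; rewrite big_nil].
rewrite (_ : (fun y => _) = fun y => F a y + \sum_(i <- s) F i y).
  exact: continuous_funD.
by apply/funext => y; rewrite big_cons.
Qed.

End Continuity.

(** * Integration on the real line *)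

Section OneDim.
Context {R : realType}.
Local Notation mu := (@lebesgue_measure R).

(** No measurability is assumed: a simple function below [f], set to zero at [a], lies below [g] and
    keeps its integral. Inner integrals of the extremal function are only known to be
    nonnegative. *)
Lemma nnintegral_ae_le (f g : R -> \bar R) (a : R) :
  (forall x, 0 <= f x)%E -> (forall x, 0 <= g x)%E ->
  (forall x, x != a -> f x = g x) ->
  (\int[mu]_(x in [set: R]) f x <= \int[mu]_(x in [set: R]) g x)%E.
Proof.
move=> f0 g0 fg; rewrite !ge0_integralTE//.
apply: ge_ereal_sup => _ [h /= hf <-].
have mC : measurable (~` [set a]) by exact: measurableC.
pose h1 := mul_nnsfun h (@indic_nnsfun _ _ R _ (mC : measurable (~` [set (a : measurableTypeR R)]))).
apply: ereal_sup_ubound; exists h1 => /=.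
  move=> x /=; rewrite /mindic indicE.
  have [->|xa] := eqVneq x a.
    by rewrite memNset /= ?mulr0 //; apply.
  rewrite mem_set /=; last by apply/eqP.
  by rewrite mulr1 -fg// hf.
rewrite -!integralT_nnsfun; apply: ge0_ae_eq_integral => //.
- by apply/measurable_EFinP; exact: measurable_funP.
- by apply/measurable_EFinP; exact: measurable_funP.
- by move=> x _; rewrite lee_fin.
- by move=> x _; rewrite lee_fin.
exists [set a]; split => //; first exact: lebesgue_measure_set1.
move=> x /= H; apply: contrapT => xa; apply: H => _.
by rewrite /mindic indicE mem_set /= ?mulr1.
Qed.

Lemma nnintegral_ae (f g : R -> \bar R) (a : R) :
  (forall x, 0 <= f x)%E -> (forall x, 0 <= g x)%E ->
  (forall x, x != a -> f x = g x) ->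
  (\int[mu]_(x in [set: R]) f x = \int[mu]_(x in [set: R]) g x)%E.
Proof.
move=> f0 g0 fg; apply/eqP; rewrite eq_le.
rewrite (nnintegral_ae_le f0 g0 fg) (@nnintegral_ae_le g f a)// => x xa.
by rewrite fg.
Qed.

(** Again free of measurability: dividing by [c] maps simple functions below [c f] to simple
    functions below [f]. The reverse inequality is this one for [c^-1]. *)
Lemma nnintegralZ_le (f : R -> \bar R) (c : R) :
  (forall x, 0 <= f x)%E -> (0 < c) ->
  (\int[mu]_(x in [set: R]) (c%:E * f x) <= c%:E * \int[mu]_(x in [set: R]) f x)%E.
Proof.
move=> f0 c0; have ci0 : 0 <= c^-1 by rewrite invr_ge0 ltW.
rewrite !ge0_integralTE//; last by move=> x; apply: mule_ge0 => //; rewrite lee_fin ltW.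
apply: ge_ereal_sup => _ [h /= hf <-].
pose h1 := scale_nnsfun h ci0.
rewrite -lee_pdivrMl//.
apply: ereal_sup_ubound; exists h1 => /=.
  by move=> x /=; rewrite EFinM lee_pdivrMl// hf.
by rewrite sintegralrM.
Qed.

Lemma nnintegralZ (f : R -> \bar R) (c : R) :
  (forall x, 0 <= f x)%E -> (0 < c) ->
  (\int[mu]_(x in [set: R]) (c%:E * f x) = c%:E * \int[mu]_(x in [set: R]) f x)%E.
Proof.
move=> f0 c0; apply/eqP; rewrite eq_le nnintegralZ_le//=.
have := @nnintegralZ_le (fun x => c%:E * f x)%E c^-1.
have cf0 x : (0 <= c%:E * f x)%E by apply: mule_ge0 => //; rewrite lee_fin ltW.
rewrite invr_gt0 => /(_ cf0 c0).
under eq_integral => x _ do rewrite muleA -EFinM mulVf ?gt_eqF// mul1e.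
by rewrite lee_pdivlMl.
Qed.

Lemma integral_ae (f g : R -> \bar R) (a : R) :
  (forall x, x != a -> f x = g x) ->
  (\int[mu]_(x in [set: R]) f x = \int[mu]_(x in [set: R]) g x)%E.
Proof.
move=> fg; rewrite integralE [RHS]integralE.
by congr (_ - _)%E; apply: (@nnintegral_ae _ _ a) => //x xa; rewrite ?funeposE ?funenegE fg.
Qed.

Lemma mu_itvE (a b : R) : (a <= b) -> mu `[a, b]%classic = (b - a)%:E.
Proof.
move=> ab; rewrite (lebesgue_measure_itv `[a, b]) /= lte_fin.
by case: (ltgtP a b) ab => // -> _; rewrite subrr.
Qed.

Lemma mu_itv_lty (a b : R) : (mu `[a, b]%classic < +oo)%E.
Proof.
rewrite (lebesgue_measure_itv `[a, b]) /=; case: ifP => _; rewrite ?ltry//.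
Qed.

Lemma cst_integrable (a b c : R) : mu.-integrable `[a, b]%classic (EFin \o cst c).
Proof.
apply: measurable_bounded_integrable => //; first exact: mu_itv_lty.
by exists `|c|; split; [exact: num_real|move=> x cx y _; exact: ltW].
Qed.

(** The class to which the inner integrals belong, as functions of one outer variable; the point [0]
    is exempted because the slice there may meet the singular axis. *)
Definition tame (M K : R) (g : R -> R) :=
  [/\ forall x, `|g x| <= K, forall x, M < `|x| -> g x = 0 &
      forall x, x != 0 -> {for x, continuous g}].

Lemma tame_measurable M K g : tame M K g -> measurable_fun [set: R] g.
Proof.
move=> [_ _ cg].
have -> : [set: R] = [set 0] `|` (~` [set 0]) by rewrite setUCr.
have mC : measurable (~` [set (0:R)]) by exact: measurableC.
apply/measurable_funU => //; split; first exact: measurable_fun_set1.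
apply: subspace_continuous_measurable_fun => //.
apply: continuous_in_subspaceT => x; rewrite inE => /eqP; exact: cg.
Qed.

Lemma tame_integrable M K g : tame M K g -> mu.-integrable [set: R] (EFin \o g).
Proof.
move=> tg; have mg := tame_measurable tg; case: tg => gK gM cg.
have K0 : 0 <= K by exact: le_trans (gK 0).
have -> : g = g \_ `[-M, M]%classic.
  apply/funext => x; rewrite patchE; case: ifPn => //.
  by rewrite notin_setE /= in_itv /= -ler_norml => /negP; rewrite -ltNge => /gM.
rewrite -restrict_EFin -integrable_mkcond //.
apply: measurable_bounded_integrable => //.
- exact: mu_itv_lty.
- exact: measurable_funTS.
exists K; split; [exact: num_real|move=> x Kx y _]; exact: le_trans (gK y) (ltW Kx).
Qed.

Local Notation I g := (Rintegral mu [set: R] g).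

Lemma tame_norm_le (M K : R) g : 0 <= M -> tame M K g -> `|I g| <= K * (2 * M).
Proof.
move=> M0 tg; have ig := tame_integrable tg.
apply: le_trans (le_normr_Rintegral _ ig) _ => //.
have K0 : 0 <= K by case: tg => gK _ _; exact: le_trans (gK 0).
have -> : (fun x => `|g x|) = ((fun x => `|g x|) \_ `[-M, M]%classic).
  apply/funext => x; rewrite patchE; case: ifPn => //.
  rewrite notin_setE /= in_itv /= -ler_norml => /negP; rewrite -ltNge => Mx.
  by case: tg => _ /(_ _ Mx) ->; rewrite normr0.
rewrite -Rintegral_mkcond.
apply: (@le_trans _ _ (Rintegral mu `[-M, M]%classic (cst K))); last first.
  rewrite Rintegral_cst// (_ : fine _ = M - - M).
    by rewrite opprK mulr2n mulrDl mul1r.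
  by rewrite -[RHS]/(fine (M - - M)%:E); congr fine; apply: mu_itvE; lra.
apply: le_Rintegral => //.
- apply: integrableS (integrable_norm ig) => //.
- exact: cst_integrable.
- by move=> x _; case: tg.
Qed.

Lemma tame_cvg (M K : R) (f_ : nat -> R -> R) f : 0 <= M ->
  (forall n, tame M K (f_ n)) -> tame M K f ->
  (forall x, f_ ^~ x @ \oo --> f x) ->
  (fun n => I (f_ n)) @ \oo --> I f.
Proof.
move=> M0 tf_ tf cvf.
have K0 : 0 <= K by case: tf => gK _ _; exact: le_trans (gK 0).
have [ ] := @dominated_convergence _ _ R mu [set: R] measurableT
  (fun n => EFin \o f_ n) (EFin \o f) (EFin \o ((cst K) \_ `[-M, M]%classic)).
- by move=> n; apply/measurable_EFinP; exact: tame_measurable (tf_ n).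
- by apply/measurable_EFinP; exact: tame_measurable tf.
- by apply: aeW => x _; apply: cvg_EFin; [exact: nearW|exact: cvf].
- rewrite -restrict_EFin -integrable_mkcond //.
  exact: cst_integrable.
- apply: aeW => x n _ /=; rewrite lee_fin patchE; case: ifPn => xM.
    by case: (tf_ n).
  move: xM; rewrite notin_setE /= in_itv /= -ler_norml => /negP; rewrite -ltNge => Mx.
  by case: (tf_ n) => _ /(_ _ Mx) ->; rewrite normr0.
move=> _ _; rewrite /Rintegral.
move=> H; apply: fine_cvg.
by rewrite fineK //; exact: integrable_fin_num (tame_integrable tf).
Qed.

Lemma tame_comp_affine M K (h : R -> R) (a b : R) : 0 < a -> tame M K h ->
  continuous h -> tame ((M + `|b|)/ a) K (fun x => h (a * x + b)).
Proof.
move=> a0 [hK hM _] hc; split => //.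
  move=> x Mx; apply: hM; move: Mx; rewrite ltr_pdivrMr// => Mx.
  have : `|a * x| <= `|a * x + b| + `|b|.
    by rewrite -[X in `|X| <= _](addrK b) (le_trans (ler_normB _ _)).
  by rewrite normrM (gtr0_norm a0); lra.
move=> x _; apply: (@continuous_comp _ _ _ (fun x => a * x + b) h); last exact: hc.
by apply: cvgD; [apply: cvgM; [exact: cvg_cst|exact: cvg_id]|exact: cvg_cst].
Qed.

Lemma tame_affine M K (g : R -> R) (a b : R) : 0 < a -> tame M K g -> continuous g ->
  a * I (fun x => g (a * x + b)) = I g.
Proof.
move=> a0 tg cg.
have tc := fun M K h => @tame_comp_affine M K h a b a0.
(* Change of variables is applied to nonnegative integrands; the general case splits [g] into
   positive and negative parts, which stay continuous and tame. *)
wlog g0 : M K g tg cg / forall x, 0 <= g x.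
  move=> H.
  pose gp x := Num.max (g x) 0; pose gn x := Num.max (- g x) 0.
  have cp : continuous gp.
    by move=> x; apply: (@continuous_max R _ g (cst 0)); [exact: cg|exact: cvg_cst].
  have cn : continuous gn.
    by move=> x; apply: (@continuous_max R _ (- g) (cst 0)); [apply: cvgN; exact: cg|exact: cvg_cst].
  have [gK gM _] := tg.
  have tp : tame M K gp.
    split=> [x|x /gM|x _]; last exact: cp.
      have := gK x; rewrite !ler_norml => /andP[k1 k2].
      by rewrite /gp; case: (leP (g x) 0) => h; lra.
    by rewrite /gp => ->; rewrite maxxx.
  have tn : tame M K gn.
    split=> [x|x /gM|x _]; last exact: cn.
      have := gK x; rewrite !ler_norml => /andP[k1 k2].
      by rewrite /gn; case: (leP (- g x) 0) => h; lra.
    by rewrite /gn => ->; rewrite oppr0 maxxx.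
  have gE x : g x = gp x - gn x.
    by rewrite /gp /gn; case: (leP (g x) 0); case: (leP (- g x) 0); lra.
  rewrite (_ : g = fun x => gp x - gn x); last exact/funext.
  rewrite [RHS]RintegralB//; [|exact: tame_integrable tp|exact: tame_integrable tn].
  rewrite -(H _ _ _ tp cp); last by move=> x; rewrite le_max lexx orbT.
  rewrite -(H _ _ _ tn cn); last by move=> x; rewrite le_max lexx orbT.
  rewrite -mulrBr -RintegralB//.
    by apply: tame_integrable (tc _ _ _ tp cp).
  by apply: tame_integrable (tc _ _ _ tn cn).
pose F := fun x : R => a * x + b.
have dF (x : R) : is_derive x 1 F a.
  by apply: is_derive_eq; rewrite ?addr0 ?scaler0 ?add0r ?addr0; rewrite [_ *: _]mulr1.
have dFE : (F^`())%classic = cst a.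
  by apply/funext => x; rewrite derive1E; exact: derive_val.
have H := @increasing_ge0_integration_by_substitutionT R F g.
rewrite /Rintegral [in RHS]H//.
- rewrite -[a in LHS]/(fine a%:E) -fineM//; last first.
    exact: integrable_fin_num (tame_integrable (tc _ _ _ tg cg)).
  congr fine; rewrite -nnintegralZ => //.
    by apply: eq_integral => x _ /=; rewrite dFE /= -EFinM mulrC.
  by move=> x; rewrite lee_fin.
- by move=> x y xy; rewrite /F ltrD2r ltr_pM2l.
- by rewrite dFE; exact: cst_continuous.
- by rewrite dFE; exact: is_cvg_cst.
- by rewrite dFE; exact: is_cvg_cst.
- apply: (@cvg_comp _ _ _ (fun x => a * x) (fun x => x + b) _ _ _ _ (cvg_addrr_Ny b)).
  by apply: gt0_cvgMrNy => //; exact: cvg_id.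
- apply: (@cvg_comp _ _ _ (fun x => a * x) (fun x => x + b) _ _ _ _ (cvg_addrr b)).
  by apply: gt0_cvgMry => //; exact: cvg_id.
Qed.

Lemma tame_gt0 M K (g : R -> R) a : tame M K g -> continuous g ->
  (forall x, 0 <= g x) -> 0 < g a -> 0 < I g.
Proof.
move=> tg cg g0 ga; have ig := tame_integrable tg.
have e0 : 0 < g a / 2 by lra.
have /cvgrPdist_lt /(_ _ e0) /nbhs_ballP [r /= r0 Hr] := cg a.
have mb : measurable (ball a r) by exact: measurable_ball.
apply: (@lt_le_trans _ _ (Rintegral mu [set: R] ((cst (g a / 2)) \_ (ball a r)))).
  rewrite -Rintegral_mkcond Rintegral_cst// (_ : fine _ = r *+ 2).
    by rewrite mulr_gt0// mulrn_wgt0.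
  by rewrite -[RHS]/(fine (r *+ 2)%:E); congr fine; apply: lebesgue_measure_ball; exact: ltW.
apply: le_Rintegral => //.
  rewrite -restrict_EFin -integrable_mkcond //.
  apply: measurable_bounded_integrable => //.
    by rewrite [X in (X < _)%E](lebesgue_measure_ball a (ltW r0)) ltry.
  by exists `|g a / 2|; split; [exact: num_real|move=> x cx y _; exact: ltW].
move=> x _; rewrite /patch; case: ifPn => [/set_mem /Hr /=|_]; last exact: g0.
by rewrite ltr_norml => /andP[h1 h2]; lra.
Qed.

End OneDim.

(** * Iterated integrals over row vectors *)

Section IteratedIntegral.
Context {R : realType}.
Local Notation mu := (@lebesgue_measure R).
Local Notation I g := (Rintegral mu [set: R] g).

(** Lets dominated convergence, a statement on sequences, prove that an integral depends
    continuously on a parameter. *)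
Lemma seq_continuous (g : R -> R) (x : R) :
  (forall u : nat -> R, u k @[k --> \oo] --> x -> g (u k) @[k --> \oo] --> g x) ->
  {for x, continuous g}.
Proof.
by move=> H; apply/continuous_withinNx; apply/cvgr_dnbhsP => u [_ ux]; exact: H.
Qed.

Definition vcons n (x : R) (y : 'rV[R]_n) : 'rV[R]_n.+1 :=
  \row_(i < n.+1) (if unlift ord0 i is Some j then y ord0 j else x).

Lemma vcons0 n x (y : 'rV[R]_n) : vcons x y 0 ord0 = x.
Proof. by rewrite mxE unlift_none. Qed.

Lemma vconsS n x (y : 'rV[R]_n) i : vcons x y 0 (lift ord0 i) = y 0 i.
Proof. by rewrite mxE liftK. Qed.

Lemma vcons_eta n (z : 'rV[R]_n.+1) :
  z = vcons (z 0 ord0) (\row_i z 0 (lift ord0 i)).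
Proof.
apply/rowP => i; rewrite mxE; case: unliftP => [j ->|->//].
by rewrite mxE.
Qed.

Lemma vcons_neq0 n x (y : 'rV[R]_n) : x != 0 -> vcons x y != 0.
Proof.
by apply: contra_neq => /rowP /(_ ord0); rewrite vcons0 mxE.
Qed.

Lemma cvg_rV (T : Type) (F : set_system T) (FF : Filter F) n (g : T -> 'rV[R]_n) (l : 'rV[R]_n) :
  (forall i, g x 0 i @[x --> F] --> l 0 i) -> g x @[x --> F] --> l.
Proof.
move=> H A [P HP PA]; rewrite /nbhs /= /fmap /=.
have : \forall x \near F, forall i : 'I_n, P 0 i (g x 0 i).
  by apply: filter_forall => i; exact: (H i _ (HP 0 i)).
by apply: filterS => x Hx; apply: PA => i j; rewrite [i]ord1.
Qed.

Lemma vcons_cvg (T : Type) (F : set_system T) (FF : Filter F) n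
    (u : T -> R) (v : T -> 'rV[R]_n) (x : R) (y : 'rV[R]_n) :
  u t @[t --> F] --> x -> v t @[t --> F] --> y ->
  vcons (u t) (v t) @[t --> F] --> vcons x y.
Proof.
move=> ux vy; apply: cvg_rV => i; case: (unliftP ord0 i) => [j ->|->].
  under eq_fun do rewrite vconsS.
  by rewrite vconsS; apply: (@cvg_comp _ _ _ v (fun z : 'rV_n => z 0 j) _ _ _ vy); exact: coord_continuous.
by under eq_fun do rewrite vcons0; rewrite vcons0.
Qed.

Lemma vcons_continuous n x : continuous (@vcons n x).
Proof.
move=> y; apply: (@vcons_cvg _ (nbhs y) _ n (fun=> x) id); first exact: cvg_cst.
exact: cvg_id.
Qed.

Lemma affine_continuous n (a : R) (v : 'rV[R]_n) : continuous (fun z : 'rV[R]_n => a *: z + v).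
Proof.
move=> z; apply: (@cvg_rV _ (nbhs z) _) => i; under eq_fun do rewrite !mxE; rewrite !mxE.
apply: (@continuous_funD R 'rV[R]_n (fun z => a * z 0 i) (fun=> v 0 i)); last exact: continuous_fun_cst.
by apply: continuous_funZ; exact: coord_continuous.
Qed.

(* The integrand is set to [0] on the hyperplane [x = 0], which carries the possible singularities. *)
Fixpoint rint n : ('rV[R]_n -> R) -> R :=
  match n return ('rV[R]_n -> R) -> R with
  | 0%N => fun f => f 0
  | n'.+1 => fun f =>
      I (fun x => if x == 0 then 0 else rint (fun y => f (vcons x y)))
  end.

(* The origin is exempted, except in dimension [0], where it is the whole space. *)
Definition good n (M K : R) (f : 'rV[R]_n -> R) :=
  forall z : 'rV[R]_n, (n = 0%N \/ z != 0) ->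
  [/\ `|f z| <= K, forall i, M < `|z 0 i| -> f z = 0 & {for z, continuous f}].

Definition fgood n (M K : R) (f : 'rV[R]_n -> R) :=
  [/\ forall z, `|f z| <= K, forall (z : 'rV[R]_n) i, M < `|z 0 i| -> f z = 0 & continuous f].

Lemma fgood_good n M K (f : 'rV[R]_n -> R) : fgood M K f -> good M K f.
Proof. by move=> [a b c] z _; split => //; [exact: b|exact: c]. Qed.

(** A slice at a nonzero first coordinate avoids the origin, so the exceptional point disappears
    after one step of the iteration. *)
Lemma good_slice n M K (f : 'rV[R]_n.+1 -> R) x : x != 0 ->
  good M K f -> fgood M K (fun y => f (vcons x y)).
Proof.
move=> x0 gf; split.
- by move=> y; case: (gf (vcons x y)) => //; right; exact: vcons_neq0.
- move=> y i Mi; have [|_ + _] := gf (vcons x y); first by right; exact: vcons_neq0.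
  by move=> H; apply: (H (lift ord0 i)); rewrite vconsS; exact: Mi.
- move=> y; have [|_ _ c] := gf (vcons x y); first by right; exact: vcons_neq0.
  apply: (@continuous_comp _ _ _ (vcons x) f); last exact: c.
  exact: vcons_continuous.
Qed.

(** One simultaneous induction: in dimension [n + 1] the inner integral is tame thanks to the bound
    and the limit theorem in dimension [n], and tameness then yields the bound and the limit theorem
    in dimension [n + 1]. The equation [n = n'.+1] allows the third claim to be stated for every
    [n]. *)
Lemma rint_props n : forall M K : R, 0 <= M -> 0 <= K ->
  (forall (f : 'rV[R]_n -> R), good M K f -> `|rint f| <= K * (2 * M) ^+ n) /\
  (forall (f_ : nat -> 'rV[R]_n -> R) f, (forall k, good M K (f_ k)) -> good M K f ->
    (forall z, (n = 0%N \/ z != 0) -> f_ ^~ z @ \oo --> f z) ->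
    (fun k => rint (f_ k)) @ \oo --> rint f) /\
  (forall n' (e : n = n'.+1) (f : 'rV[R]_n'.+1 -> R), good M K f ->
     tame M (K * (2 * M) ^+ n') (fun x => if x == 0 then 0 else rint (fun y => f (vcons x y)))).
Proof.
elim: n => [|n IH] M K M0 K0.
  split; [|split] => //.
  - by move=> f /(_ 0 (or_introl erefl)) [fK _ _] /=; rewrite expr0 mulr1.
  - by move=> f_ f gf_ gf; apply; left.
have [IH1 [IH2 _]] := IH M K M0 K0.
have T f : good M K f -> tame M (K * (2 * M) ^+ n)
    (fun x => if x == 0 then 0 else @rint n (fun y => f (vcons x y))).
  move=> gf; split.
  - move=> x; case: ifPn => x0; first by rewrite normr0 !mulr_ge0// exprn_ge0// mulr_ge0.
    by apply: IH1; apply: fgood_good; exact: good_slice.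
  - move=> x Mx; case: ifPn => // x0.
    have -> : (fun y => f (vcons x y)) = (fun=> 0).
      apply/funext => y; have [|_ + _] := gf (vcons x y); first by right; exact: vcons_neq0.
      by move=> H; apply: (H ord0); rewrite vcons0.
    (* The bound taken with constant [0] shows that the zero function has integral zero. *)
    have : `|@rint n (fun=> 0)| <= 0 * (2 * M) ^+ n.
      apply: (IH M 0 M0 (lexx _)).1 => z _; split => //; first by rewrite normr0.
      exact: continuous_fun_cst.
    by rewrite mul0r normr_le0 => /eqP.
  - move=> x x0; apply: seq_continuous => u ux; rewrite (negbTE x0).
    have un0 : \forall k \near \oo, u k != 0 by exact: cvgr_neq0 ux x0.
    (* Terms of the sequence equal to [0], where the slice may be bad, are replaced by [x]; from
       some index on nothing changes. *)
    pose v k := if u k == 0 then x else u k.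
    have v0 k : v k != 0 by rewrite /v; case: ifPn.
    have vu : \forall k \near \oo, v k = u k.
      by apply: filterS un0 => k uk; rewrite /v (negbTE uk).
    have vx : v k @[k --> \oo] --> x.
      by apply: cvg_trans ux; apply: near_eq_cvg; apply: filterS vu => k ->.
    have := IH2 (fun k y => f (vcons (v k) y)) (fun y => f (vcons x y)).
    move=> H; apply: cvg_trans (H _ _ _).
    + apply: near_eq_cvg; apply: filterS2 un0 vu => k uk vk /=.
      by rewrite (negbTE uk) vk.
    + by move=> k; apply: fgood_good; exact: good_slice.
    + by apply: fgood_good; exact: good_slice.
    + move=> y _; have [|_ _ c] := gf (vcons x y); first by right; exact: vcons_neq0.
      apply: (@cvg_comp _ _ _ (fun k => vcons (v k) y) f _ _ _ _ c).
      by apply: vcons_cvg => //; exact: cvg_cst.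
split; [|split].
- move=> f gf; rewrite exprSr mulrA /=.
  exact: tame_norm_le (T _ gf).
- move=> f_ f gf_ gf cf /=.
  apply: (@tame_cvg _ M (K * (2 * M) ^+ n)) => //.
  - by move=> k; exact: T.
  - exact: T.
  move=> x; case: ifPn => x0; first exact: cvg_cst.
  apply: IH2.
  - by move=> k; apply: fgood_good; exact: good_slice.
  - by apply: fgood_good; exact: good_slice.
  - by move=> y _; apply: cf; right; exact: vcons_neq0.
- by move=> n' [e]; subst n' => f gf; apply: T.
Qed.

Lemma rint_norm_le n M K (f : 'rV[R]_n -> R) : 0 <= M -> 0 <= K -> good M K f ->
  `|rint f| <= K * (2 * M) ^+ n.
Proof. by move=> M0 K0; have [H _] := rint_props n M0 K0; exact: H. Qed.

Lemma rint_cvg n M K (f_ : nat -> 'rV[R]_n -> R) f : 0 <= M -> 0 <= K ->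
  (forall k, good M K (f_ k)) -> good M K f ->
  (forall z, (n = 0%N \/ z != 0) -> f_ ^~ z @ \oo --> f z) ->
  (fun k => rint (f_ k)) @ \oo --> rint f.
Proof. by move=> M0 K0; have [_ [H _]] := rint_props n M0 K0; exact: H. Qed.

Lemma rint_tame n M K (f : 'rV[R]_n.+1 -> R) : 0 <= M -> 0 <= K -> good M K f ->
  tame M (K * (2 * M) ^+ n) (fun x => if x == 0 then 0 else rint (fun y => f (vcons x y))).
Proof. by move=> M0 K0; have [_ [_ H]] := rint_props n.+1 M0 K0; exact: H. Qed.

Lemma rintD n M K L (f g : 'rV[R]_n -> R) : 0 <= M -> 0 <= K -> 0 <= L ->
  good M K f -> good M L g ->
  rint (fun z => f z + g z) = rint f + rint g.
Proof.
move=> M0 K0 L0; elim: n f g => [//|n IH] f g gf gg /=.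
rewrite -RintegralD//; last 2 first.
- exact: tame_integrable (rint_tame M0 K0 gf).
- exact: tame_integrable (rint_tame M0 L0 gg).
apply: eq_Rintegral => x _; case: ifPn => x0; first by rewrite addr0.
by rewrite IH //; apply: fgood_good; exact: good_slice.
Qed.

Lemma rintZ n M K c (f : 'rV[R]_n -> R) : 0 <= M -> 0 <= K -> good M K f ->
  rint (fun z => c * f z) = c * rint f.
Proof.
move=> M0 K0; elim: n f => [//|n IH] f gf /=.
rewrite -RintegralZl//; last exact: tame_integrable (rint_tame M0 K0 gf).
apply: eq_Rintegral => x _; case: ifPn => x0; first by rewrite mulr0.
by rewrite IH //; apply: fgood_good; exact: good_slice.
Qed.

Lemma rint_le n M K L (f g : 'rV[R]_n -> R) : 0 <= M -> 0 <= K -> 0 <= L ->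
  good M K f -> good M L g -> (forall z, (n = 0%N \/ z != 0) -> f z <= g z) ->
  rint f <= rint g.
Proof.
move=> M0 K0 L0; elim: n f g => [|n IH] f g gf gg fg /=; first by apply: fg; left.
apply: le_Rintegral => //.
- exact: tame_integrable (rint_tame M0 K0 gf).
- exact: tame_integrable (rint_tame M0 L0 gg).
move=> x _; case: ifPn => x0 //; apply: IH.
- by apply: fgood_good; exact: good_slice.
- by apply: fgood_good; exact: good_slice.
- by move=> z _; apply: fg; right; exact: vcons_neq0.
Qed.

Lemma fgood_slice n M K (f : 'rV[R]_n.+1 -> R) x :
  fgood M K f -> fgood M K (fun y => f (vcons x y)).
Proof.
move=> [fK fM cf]; split => //.
  by move=> y i Mi; apply: (fM _ (lift ord0 i)); rewrite vconsS.
move=> y; apply: (@continuous_comp _ _ _ (vcons x) f); last exact: cf.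
exact: vcons_continuous.
Qed.

Lemma Rintegral_ae (f g : R -> R) (a : R) : (forall x, x != a -> f x = g x) -> I f = I g.
Proof.
by move=> fg; congr fine; apply: (@integral_ae _ _ _ a) => x xa; rewrite fg.
Qed.

Lemma rintE n (f : 'rV[R]_n.+1 -> R) :
  rint f = I (fun x => rint (fun y => f (vcons x y))).
Proof. by apply: (@Rintegral_ae _ _ 0) => x x0; rewrite (negbTE x0). Qed.

Lemma fgood_tame n M K (f : 'rV[R]_n.+1 -> R) : 0 <= M -> 0 <= K -> fgood M K f ->
  tame M (K * (2 * M) ^+ n) (fun x => rint (fun y => f (vcons x y))) /\
  continuous (fun x => rint (fun y => f (vcons x y))).
Proof.
move=> M0 K0 gf.
have c (x : R) : {for x, continuous (fun x : R => rint (fun y => f (vcons x y)))}.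
  apply: seq_continuous => u ux; apply: (@rint_cvg _ M K) => //.
  - by move=> k; apply: fgood_good; exact: fgood_slice.
  - by apply: fgood_good; exact: fgood_slice.
  - move=> y _; have [_ _ c] := gf.
    apply: (@cvg_comp _ _ _ (fun k => vcons (u k) y) f _ _ _ _ (c _)).
    by apply: vcons_cvg => //; exact: cvg_cst.
split => //; split.
- by move=> x; apply: rint_norm_le => //; apply: fgood_good; exact: fgood_slice.
- move=> x Mx; have [_ fM _] := gf.
  rewrite (_ : (fun y => f (vcons x y)) = fun y => 0 * 0).
    rewrite (@rintZ _ M 0) ?mul0r// => z _; split => //; first by rewrite normr0.
    exact: continuous_fun_cst.
  by apply/funext => y; rewrite mul0r (fM _ ord0) // vcons0.
- by move=> x _; exact: c.
Qed.

(** One variable at a time, each contributing a factor [a]; full continuity is needed because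
    translation moves the exceptional point. *)
Lemma rint_affine n M K (f : 'rV[R]_n -> R) (a : R) (v : 'rV[R]_n) :
  0 <= M -> 0 <= K -> 0 < a -> fgood M K f ->
  a ^+ n * rint (fun z => f (a *: z + v)) = rint f.
Proof.
move=> M0 K0 a0; elim: n f v => [|n IH] f v gf.
  by rewrite expr0 mul1r /=; congr f; apply/rowP => -[].
rewrite !rintE.
have [t c] := fgood_tame M0 K0 gf.
rewrite -(tame_affine (v 0 ord0) a0 t c) exprS -mulrA; congr (_ * _).
pose w := \row_i v 0 (lift ord0 i).
rewrite -RintegralZl//.
  apply: eq_Rintegral => x _.
  rewrite -(IH _ w (fgood_slice _ gf)); congr (_ * rint _).
  apply/funext => y; congr f; rewrite [in LHS](vcons_eta v).
  apply/rowP => i; rewrite !mxE; case: unliftP => // j _.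
  by rewrite !mxE.
(* The substituted function is supported in the cube of half-side [b / a]; this is used only for its
   integrability. *)
pose b := M + \sum_i `|v 0 i|.
have b0 : 0 <= b by rewrite addr_ge0 // sumr_ge0.
have vb i : `|v 0 i| <= \sum_i `|v 0 i|.
  by rewrite (bigD1 i) //= lerDl sumr_ge0.
have gh : fgood (b / a) K (fun z => f (a *: z + v)).
  have [fK fM cf] := gf; split => //.
    move=> z i; rewrite ltr_pdivrMr// => Mz; apply: (fM _ i); rewrite !mxE.
    have : `|a * z 0 i| <= `|a * z 0 i + v 0 i| + `|v 0 i|.
      by rewrite -[X in `|X| <= _](addrK (v 0 i)) (le_trans (ler_normB _ _)).
    by rewrite normrM (gtr0_norm a0); have := vb i; rewrite /b in Mz; lra.
  move=> z; apply: (@continuous_comp 'rV[R]_n.+1 'rV[R]_n.+1 R (fun z => a *: z + v) f); last exact: cf.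
  exact: affine_continuous.
have [t2 _] := @fgood_tame n (b / a) K (fun z => f (a *: z + v)) (divr_ge0 b0 (ltW a0)) K0 gh.
exact: tame_integrable t2.
Qed.

Lemma rint_ge0 n (f : 'rV[R]_n -> R) : (forall z, 0 <= f z) -> 0 <= rint f.
Proof.
elim: n f => [|n IH] f f0 /=; first exact: f0.
apply: (@Rintegral_ge0 _ _ R mu) => x _.
by case: ifP => // _; apply: IH.
Qed.

Lemma rint_gt0 n M K (f : 'rV[R]_n -> R) z0 : 0 <= M -> 0 <= K -> fgood M K f ->
  (forall z, 0 <= f z) -> 0 < f z0 -> 0 < rint f.
Proof.
move=> M0 K0; elim: n f z0 => [|n IH] f z0 gf f0 fz.
  by move: fz; rewrite /= [z0](_ : _ = 0) //; apply/rowP => -[].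
rewrite rintE; have [t c] := fgood_tame M0 K0 gf.
apply: (tame_gt0 (a := z0 0 ord0) t c) => [x|]; first exact: rint_ge0.
apply: (IH _ (\row_i z0 0 (lift ord0 i))) => //; first exact: fgood_slice.
by rewrite -vcons_eta.
Qed.

Lemma iint_rint n M K (f : 'rV[R]_n -> R) : 0 <= M -> 0 <= K -> good M K f ->
  iint (EFin \o f) = (rint f)%:E.
Proof.
move=> M0 K0; elim: n f => [//|n IH] f gf /=.
rewrite /Rintegral fineK; last first.
  exact: integrable_fin_num (tame_integrable (rint_tame M0 K0 gf)).
apply: (@integral_ae _ _ _ 0) => x x0; rewrite (negbTE x0).
by apply: IH; apply: fgood_good; exact: good_slice.
Qed.

(** Positive dimension matters: in dimension [0] the origin is the whole space and has mass one. *)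
Lemma iint_ae n (f g : 'rV[R]_n.+1 -> \bar R) : (forall z, z != 0 -> f z = g z) ->
  iint f = iint g.
Proof.
move=> fg /=; apply: (@integral_ae _ _ _ 0) => x x0; congr iint.
by apply/funext => y; apply: fg; exact: vcons_neq0.
Qed.

Lemma iint_ge0 n (f : 'rV[R]_n -> \bar R) : (forall z, 0 <= f z)%E -> (0 <= iint f)%E.
Proof.
elim: n f => [|n IH] f f0 /=; first exact: f0.
by apply: (@integral_ge0 _ _ R mu) => x _; exact: IH.
Qed.

Lemma iintZ n (f : 'rV[R]_n -> \bar R) c : (forall z, 0 <= f z)%E -> 0 < c ->
  iint (fun z => c%:E * f z)%E = (c%:E * iint f)%E.
Proof.
move=> + c0; elim: n f => [//|n IH] f f0 /=.
rewrite -nnintegralZ //; first by apply: eq_integral => x _; rewrite -IH.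
by move=> x; exact: iint_ge0.
Qed.

End IteratedIntegral.

(** Through this equivalence the mean value theorem and the chain rule of one variable apply to
    directional derivatives. *)
Lemma is_derive_line (R : realType) (V : normedModType R) (f : V -> R) (x e : V) (s l : R) :
  is_derive (x + s *: e) e f l <-> is_derive s 1 (fun s => f (x + s *: e)) l.
Proof.
have E : (fun h : R => h^-1 *: (((fun s => f (x + s *: e)) \o shift s) (h *: 1) - f (x + s *: e)))
   = (fun h => h^-1 *: ((f \o shift (x + s *: e)) (h *: e) - f (x + s *: e))).
  apply/funext => h /=; congr (_ *: (f _ - _)).
  by rewrite [h *: 1]mulr1 scalerDl addrCA.
by split; move=> [d <-]; split; move: d; rewrite /derivable /derive E.
Qed.

(** * Integration over the group and integrals of derivatives *)

Section GroupIntegral.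
Context {R : realType} {m : nat}.
Hypothesis m_gt0 : (0 < m)%N.
Local Notation mu := (@lebesgue_measure R).
Local Notation I g := (Rintegral mu [set: R] g).
Local Notation pt := (pt R m).
Implicit Types (f g : pt -> R) (x : pt).

Definition Gr f : R := I (fun t => rint (fun z => f (z, t))).

Definition ggood (M K : R) f :=
  forall x, x.1 != 0 ->
  [/\ `|f x| <= K, M < `|x| -> f x = 0 & {for x, continuous f}].

Definition gfgood (M K : R) f :=
  [/\ forall x, `|f x| <= K, forall x, M < `|x| -> f x = 0 & continuous f].

Lemma gfgood_ggood M K f : gfgood M K f -> ggood M K f.
Proof. by move=> [a b c] x _; split => //; [exact: b|exact: c]. Qed.

Lemma norm_coord_le (z : 'rV[R]_m) (i : 'I_m) : `|z 0 i| <= `|z|.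
Proof.
rewrite [leRHS]mx_normrE; apply: (@le_trans _ _ `|z (0, i).1 (0, i).2|) => //.
exact: (le_bigmax _ (fun ij => `|z ij.1 ij.2|)).
Qed.

Lemma norm_fst_le x : `|x.1| <= `|x|.
Proof. by rewrite [leRHS]prod_normE le_max lexx. Qed.

Lemma norm_snd_le x : `|x.2| <= `|x|.
Proof. by rewrite [leRHS]prod_normE le_max lexx orbT. Qed.

Lemma cvg_pairl (T : Type) (F : set_system T) (FF : Filter F) (u : T -> 'rV[R]_m) (v : T -> R)
  (a : 'rV[R]_m) (b : R) :
  u t @[t --> F] --> a -> v t @[t --> F] --> b -> (u t, v t) @[t --> F] --> ((a, b) : pt).
Proof. by move=> ua vb; exact: (@cvg_pair _ _ _ F (nbhs a) (nbhs b) _ _ _ u v ua vb). Qed.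

Lemma pairl_continuous (t : R) : continuous (fun z : 'rV[R]_m => (z, t) : pt).
Proof.
move=> z; apply: (@cvg_pairl _ (nbhs z) _ id (fun=> t)); first exact: cvg_id.
exact: cvg_cst.
Qed.

Lemma line_continuous (x e : pt) : continuous (fun s : R => x + s *: e).
Proof.
move=> s; apply: (@cvgD _ _ _ (nbhs s) _ (fun=> x) (fun s => s *: e)).
  exact: cvg_cst.
exact: scalel_continuous.
Qed.

Lemma ggood_slice M K f t : ggood M K f -> good M K (fun z => f (z, t)).
Proof.
move=> gf z [m0|z0]; first by exfalso; move: m_gt0; rewrite m0.
have [fK fM cf] := gf (z, t) z0; split => //.
  move=> i Mi; apply: fM; apply: lt_le_trans Mi _.
  exact: le_trans (norm_coord_le z i) (norm_fst_le (z, t)).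
apply: (@continuous_comp 'rV[R]_m pt R (fun z => (z, t)) f) => //.
exact: pairl_continuous.
Qed.

(** Each slice with [t] fixed meets the axis only in [z = 0], so no value of [t] is exceptional and
    the inner integral is continuous on the whole line. *)
Lemma ggood_tame M K f : 0 <= M -> 0 <= K -> ggood M K f ->
  tame M (K * (2 * M) ^+ m) (fun t => rint (fun z => f (z, t))) /\
  continuous (fun t => rint (fun z => f (z, t))).
Proof.
move=> M0 K0 gf.
have c (x : R) : {for x, continuous (fun t : R => rint (fun z => f (z, t)))}.
  apply: seq_continuous => u ux; apply: (@rint_cvg _ _ M K) => //.
  - by move=> k; exact: ggood_slice.
  - exact: ggood_slice.
  - move=> z [m0|z0]; first by exfalso; move: m_gt0; rewrite m0.
    have [_ _ cf] := gf (z, x) z0.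
    apply: (@cvg_comp _ _ _ (fun k => (z, u k)) f _ _ _ _ cf).
    by apply: cvg_pairl => //; exact: cvg_cst.
split => //; split.
- by move=> t; apply: rint_norm_le => //; exact: ggood_slice.
- move=> t Mt.
  have : `|rint (fun z => f (z, t))| <= 0 * (2 * M) ^+ m.
    apply: rint_norm_le => // z z0; have [fK fM cf] := ggood_slice t gf z0.
    split => //; case: z0 => [m0|z0]; first by exfalso; move: m_gt0; rewrite m0.
    have [_ + _] := gf (z, t) z0.
    by move=> ->; [rewrite normr0|exact: lt_le_trans Mt (norm_snd_le (z, t))].
  by rewrite mul0r normr_le0 => /eqP.
- by move=> t _; exact: c.
Qed.

Lemma ggoodD M K L f g : ggood M K f -> ggood M L g ->
  ggood M (K + L) (fun x => f x + g x).
Proof.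
move=> gf gg z /[dup] /gf [fK fM cf] /gg [gK gM cg]; split.
- by apply: le_trans (ler_normD _ _) _; rewrite lerD.
- by move=> Mi; rewrite fM// gM// addr0.
- exact: continuous_funD.
Qed.

Lemma ggoodZ M K c f : ggood M K f -> ggood M (`|c| * K) (fun x => c * f x).
Proof.
move=> gf z /gf [fK fM cf]; split.
- by rewrite normrM ler_wpM2l.
- by move=> Mi; rewrite fM// mulr0.
- exact: continuous_funZ.
Qed.

Lemma GrD M K L f g : 0 <= M -> 0 <= K -> 0 <= L -> ggood M K f -> ggood M L g ->
  Gr (fun x => f x + g x) = Gr f + Gr g.
Proof.
move=> M0 K0 L0 gf gg; rewrite /Gr -RintegralD//; last 2 first.
- exact: tame_integrable (ggood_tame M0 K0 gf).1.
- exact: tame_integrable (ggood_tame M0 L0 gg).1.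
apply: eq_Rintegral => t _.
by apply: (@rintD _ _ M K L) => //; exact: ggood_slice.
Qed.

Lemma GrZ M K c f : 0 <= M -> 0 <= K -> ggood M K f ->
  Gr (fun x => c * f x) = c * Gr f.
Proof.
move=> M0 K0 gf; rewrite /Gr -RintegralZl//; last first.
  exact: tame_integrable (ggood_tame M0 K0 gf).1.
apply: eq_Rintegral => t _.
by apply: (@rintZ _ _ M K) => //; exact: ggood_slice.
Qed.

Lemma Gr_le M K L f g : 0 <= M -> 0 <= K -> 0 <= L -> ggood M K f -> ggood M L g ->
  (forall x, x.1 != 0 -> f x <= g x) -> Gr f <= Gr g.
Proof.
move=> M0 K0 L0 gf gg fg; apply: le_Rintegral => //.
- exact: tame_integrable (ggood_tame M0 K0 gf).1.
- exact: tame_integrable (ggood_tame M0 L0 gg).1.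
move=> t _; apply: (@rint_le _ _ M K L) => //; [exact: ggood_slice|exact: ggood_slice|].
by move=> z [m0|z0]; [exfalso; move: m_gt0; rewrite m0|exact: fg].
Qed.

Lemma Gr_cvg M K (f_ : nat -> pt -> R) f : 0 <= M -> 0 <= K ->
  (forall k, ggood M K (f_ k)) -> ggood M K f ->
  (forall x, x.1 != 0 -> f_ ^~ x @ \oo --> f x) ->
  (fun k => Gr (f_ k)) @ \oo --> Gr f.
Proof.
move=> M0 K0 gf_ gf cf; apply: (@tame_cvg _ M (K * (2 * M) ^+ m)) => //.
- by move=> k; exact: (ggood_tame M0 K0 (gf_ k)).1.
- exact: (ggood_tame M0 K0 gf).1.
move=> t; apply: (@rint_cvg _ _ M K) => //.
- by move=> k; exact: ggood_slice.
- exact: ggood_slice.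
by move=> z [m0|z0]; [exfalso; move: m_gt0; rewrite m0|exact: cf].
Qed.

(** Only [z] is dilated, hence the Jacobian [a ^+ m]. The case [a = 1] is translation invariance;
    other values of [a] serve to shift the logarithmic cutoffs. *)
Lemma Gr_affine M K f (a : R) (v : pt) : 0 <= M -> 0 <= K -> 0 < a -> gfgood M K f ->
  a ^+ m * Gr (fun x => f (a *: x.1 + v.1, x.2 + v.2)) = Gr f.
Proof.
move=> M0 K0 a0 gf; have [fK fM cf] := gf.
have sf t : fgood M K (fun z => f (z, t)).
  split => //.
    move=> z i Mi; apply: fM; apply: lt_le_trans Mi _.
    exact: le_trans (norm_coord_le z i) (norm_fst_le (z, t)).
  move=> z; apply: (@continuous_comp 'rV[R]_m pt R (fun z => (z, t)) f) => //.
    exact: pairl_continuous.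
  exact: cf.
have [t c] := ggood_tame M0 K0 (gfgood_ggood gf).
have e (s : R) : rint (fun z => f (a *: z + v.1, s)) = a ^- m * rint (fun z => f (z, s)).
  rewrite -(@rint_affine _ _ M K (fun z => f (z, s)) a v.1)//.
  by rewrite mulrA mulVf ?mul1r// expf_neq0// gt_eqF.
have := @tame_affine _ M _ _ 1 v.2 ltr01 t c; rewrite mul1r /Gr => <-.
have -> : (fun s => rint (fun z => f (a *: (z, s).1 + v.1, (z, s).2 + v.2))) =
    (fun s => a ^- m * rint (fun z => f (z, 1 * s + v.2))).
  by apply/funext => s; rewrite mul1r; exact: (e (s + v.2)).
rewrite RintegralZl//; first by rewrite mulrA mulfV ?mul1r// ?expf_neq0 ?gt_eqF.
exact: tame_integrable (tame_comp_affine v.2 ltr01 t c).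
Qed.

Lemma Gint_Gr M K f : 0 <= M -> 0 <= K -> ggood M K f -> Gint (EFin \o f) = (Gr f)%:E.
Proof.
move=> M0 K0 gf; rewrite /Gr /Rintegral fineK; last first.
  exact: integrable_fin_num (tame_integrable (ggood_tame M0 K0 gf).1).
apply: eq_integral => t _ /=.
have := @iint_rint _ _ M K (fun z => f (z, t)) M0 K0 (ggood_slice t gf).
by move=> <-.
Qed.

(** For arbitrary integrands. The sets [z = 0] and [t = 0] are those where no derivative of the
    extremal function is computed. *)
Lemma Gint_ae (f g : pt -> \bar R) :
  (forall x, x.1 != 0 -> x.2 != 0 -> f x = g x) -> Gint f = Gint g.
Proof.
move=> fg; apply: (@integral_ae _ _ _ 0) => t t0.
move: f g fg; case: m m_gt0 => // n _ f g fg.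
by apply: iint_ae => z z0; exact: fg.
Qed.

Lemma GintZ (f : pt -> \bar R) c : (forall x, 0 <= f x)%E -> 0 < c ->
  Gint (fun x => c%:E * f x)%E = (c%:E * Gint f)%E.
Proof.
move=> f0 c0; rewrite /Gint -nnintegralZ//.
  by apply: eq_integral => t _; rewrite iintZ.
by move=> t; exact: iint_ge0.
Qed.

(** The difference quotients [q k] have zero integral by translation invariance, converge to [g] off
    the axis and are bounded by [L], so dominated convergence applies. For the bound: the coordinate
    [j] is constant along lines of direction [e], so if it is nonzero the line misses the axis and
    the mean value theorem holds on it. *)
Lemma Gr_derive0 M K L f (g : pt -> R) (e : pt) (j : 'I_m) :
  0 <= M -> 0 <= K -> 0 <= L -> gfgood M K f -> ggood M L g -> e.1 0 j = 0 ->
  (forall x, x.1 != 0 -> is_derive x e f (g x)) -> Gr g = 0.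
Proof.
move=> M0 K0 L0 gf gg ej df; have [fK fM cf] := gf.
pose q (k : nat) (x : pt) := k.+1%:R * (f (x + k.+1%:R^-1 *: e) + (-1) * f x).
have cs (y : pt) : continuous (fun x : pt => f (x + y)).
  move=> x; apply: (@continuous_comp pt pt R (fun x => x + y) f); last exact: cf.
  by apply: cvgD; [exact: cvg_id|exact: cvg_cst].
have cq k : continuous (q k).
  move=> x; apply: (@continuous_funZ R pt); apply: continuous_funD; first exact: cs.
  by apply: continuous_funZ; exact: cf.
have qL0 k x : x.1 0 j != 0 -> `|q k x| <= L.
  move=> xj.
  have line (s : R) : (x + s *: e).1 != 0.
    by apply/eqP => /rowP /(_ j); rewrite !mxE ej mulr0 addr0; apply/eqP.
  have ds (s : R) : is_derive s 1 (fun s => f (x + s *: e)) (g (x + s *: e)).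
    exact: ((@is_derive_line R _ f x e s (g (x + s *: e))).1 (df _ (line s))).
  have k0 : 0 < k.+1%:R^-1 :> R by rewrite invr_gt0.
  have cl : continuous (fun s : R => f (x + s *: e)).
    by move=> s; apply: (@continuous_comp R pt R (fun s => x + s *: e) f); [exact: line_continuous|exact: cf].
  have [s _] := MVT k0 (fun s _ => ds s) (continuous_subspaceT cl).
  rewrite scale0r addr0 subr0 => H.
  rewrite /q mulN1r H mulrCA mulfV ?pnatr_eq0// mulr1.
  by have [] := gg _ (line s).
(* If the coordinate [j] vanishes, the bound is the limit of the bounds at nearby points where it
   does not, since [q k] is continuous everywhere. *)
have qL k x : `|q k x| <= L.
  have [xj|] := eqVneq (x.1 0 j) 0; last exact: qL0.
  pose y (l : nat) : pt := x + l.+1%:R^-1 *: ((delta_mx 0 j : 'rV[R]_m), 0).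
  have yx : y l @[l --> \oo] --> x.
    rewrite -[X in _ --> X]addr0 -(scale0r ((delta_mx 0 j : 'rV[R]_m), 0)).
    exact: (@cvg_comp _ _ _ harmonic (fun s : R => x + s *: _) _ _ _ cvg_harmonic
       (@line_continuous _ _ 0)).
  have := @cvg_comp _ _ _ y (q k) _ _ _ yx (cq k x).
  move=> /cvg_norm H; rewrite -(cvg_lim _ H)//; apply: limr_le; first by apply/cvg_ex; eexists; exact: H.
  apply: nearW => l; apply: qL0.
  by rewrite !mxE xj add0r !eqxx mulr1 invr_eq0 pnatr_eq0.
(* The steps are at most [1], so the translates of [f] used here have support within this radius. *)
pose M' := M + `|e|.
have gM' (M1 : R) h H : M <= M1 -> ggood M H h -> ggood M1 H h.
  by move=> MM gh x /gh [a b c]; split => // h1; apply: b; exact: le_lt_trans h1.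
have M'0 : 0 <= M' by rewrite addr_ge0.
have gq k : ggood M' L (q k).
  move=> x _; split => //; last exact: cq.
  move=> Mx; have k1 : k.+1%:R^-1 <= 1 :> R by rewrite invf_le1// ler1n.
  have k0 : 0 <= k.+1%:R^-1 :> R by [].
  rewrite /q !fM ?mulr0 ?addr0 ?mulr0//; first by apply: le_lt_trans Mx; rewrite lerDl.
  have : `|x| <= `|x + k.+1%:R^-1 *: e| + `|k.+1%:R^-1 *: e|.
    by rewrite -[X in `|X| <= _](addrK (k.+1%:R^-1 *: e)) (le_trans (ler_normB _ _)).
  rewrite normrZ ger0_norm//; have : k.+1%:R^-1 * `|e| <= 1 * `|e| by rewrite ler_wpM2r.
  rewrite mul1r => h1 h2; have := lt_le_trans Mx (le_trans h2 (lerD (lexx _) h1)).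
  by rewrite ltrD2r.
have Gq k : Gr (q k) = 0.
  have gs y : `|y| <= `|e| -> ggood M' K (fun x => f (x + y)).
    move=> ye x _; split => //; last exact: cs.
    move=> Mx; apply: fM.
    have : `|x| <= `|x + y| + `|y|.
      by rewrite -[X in `|X| <= _](addrK y) (le_trans (ler_normB _ _)).
    move=> h2; have := lt_le_trans Mx (le_trans h2 (lerD (lexx _) ye)).
    by rewrite ltrD2r.
  have g1 : ggood M' K (fun x => f (x + k.+1%:R^-1 *: e)).
    apply: gs; rewrite normrZ ger0_norm// -[leRHS]mul1r ler_wpM2r//.
    by rewrite invf_le1// ler1n.
  have g2 : ggood M' (`|-1| * K) (fun x => (-1) * f x).
    apply: ggoodZ; apply: (gM' _ _ _ _ (gfgood_ggood gf)); by rewrite lerDl.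
  rewrite /q (@GrZ M' (K + `|-1| * K))//; [|by rewrite addr_ge0 ?mulr_ge0|exact: ggoodD g1 g2].
  rewrite (@GrD M' K (`|-1| * K))//; last by rewrite mulr_ge0.
  rewrite (@GrZ M K)//; last exact: gfgood_ggood.
  have := @Gr_affine M K f 1 (k.+1%:R^-1 *: e) M0 K0 ltr01 gf.
  rewrite expr1n mul1r => <-.
  rewrite (_ : (fun x : pt => f (1 *: x.1 + _, _)) = (fun x => f (x + k.+1%:R^-1 *: e))).
    by rewrite mulN1r subrr mulr0.
  by apply/funext => -[z t]; rewrite scale1r.
have gg' : ggood M' L g by apply: (gM' _ _ _ _ gg); rewrite lerDl.
have /cvg_lim : (fun k => Gr (q k)) @ \oo --> Gr g.
  apply: (@Gr_cvg M' L) => // x x0.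
  have [+ dE] := df x x0; rewrite /derivable.
  move=> /cvg_ex [l H].
  have lE : l = g x by rewrite -dE; apply/esym; exact: cvg_lim H.
  rewrite lE in H.
  have := (cvgr_dnbhsP _ _ _).1 H harmonic; move/(_ (conj _ _)) => /= H2.
  have {}H2 := H2 _ cvg_harmonic.
  apply: cvg_trans (H2 _) => //; apply: near_eq_cvg; apply: nearW => k.
  by rewrite /q mulN1r invrK [x + _]addrC.
move=> <- //; under eq_fun do rewrite Gq; exact: lim_cst.
Qed.

End GroupIntegral.

(** * Directional derivatives of functions on a normed space *)

Section DirectionalCalculus.
Context {R : realType} {V : normedModType R}.
Implicit Types (f g : V -> R) (x y v w : V).

Lemma MVT_dir f y w (k : R) :
  (forall s, `|s| <= `|k| -> derivable f (y + s *: w) w) ->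
  exists xi, `|xi| <= `|k| /\ f (y + k *: w) - f y = k * 'D_w f (y + xi *: w).
Proof.
move=> df.
have ds (s : R) : `|s| <= `|k| ->
    is_derive s 1 (fun s => f (y + s *: w)) ('D_w f (y + s *: w)).
  move=> sk; apply: ((@is_derive_line R V f y w s _).1).
  by apply/derivableP; exact: df.
have H (a b : R) : (forall s, a <= s <= b -> `|s| <= `|k|) -> a <= b ->
    exists2 c, `|c| <= `|k| & f (y + b *: w) - f (y + a *: w) = 'D_w f (y + c *: w) * (b - a).
  move=> ab_k ab.
  have [|||c cab E] := @MVT_segment R (fun s => f (y + s *: w)) (fun s => 'D_w f (y + s *: w)) a b => //.
  - by move=> s sab; apply: ds; apply: ab_k; move: sab; rewrite in_itv /= => /andP[/ltW -> /ltW ->].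
  - apply: derivable_within_continuous => s; rewrite in_itv /= => sab.
    exact: (@ex_derive _ _ _ _ _ _ _ (ds s (ab_k _ sab))).
  by exists c => //; apply: ab_k; move: cab; rewrite in_itv.
have [k0|k0] := leP 0 k.
  have [|//|c ck E] := H 0 k; first by move=> s /andP[s0 sk]; rewrite !ger0_norm.
  by exists c; split => //; move: E; rewrite scale0r addr0 subr0 mulrC.
have [||c ck E] := H k 0; [|exact: ltW|].
  by move=> s /andP[s0 sk]; rewrite (ltr0_norm k0) (ler0_norm sk) lerN2.
exists c; split => //; move: E; rewrite scale0r addr0 sub0r => E.
by rewrite -opprB E mulrN opprK mulrC.
Qed.

Lemma derive_eq_val f x v l : is_derive x v f l -> 'D_v f x = l.
Proof. by case. Qed.

(** A substitute for total differentiability that can be read off [Ck] directly. *)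
Definition C1at f x := forall v,
  (\forall y \near x, derivable f y v) /\ {for x, continuous ('D_v f)}.

Lemma line2_cvg x v w (T : Type) (F : set_system T) (FF : Filter F) (h k : T -> R) :
  h t @[t --> F] --> 0 -> k t @[t --> F] --> 0 ->
  x + h t *: v + k t *: w @[t --> F] --> x.
Proof.
move=> h0 k0.
have := @cvgD _ _ _ F FF (fun t => x + h t *: v) (fun t => k t *: w) (x + 0 *: v) (0 *: w).
rewrite !scale0r !addr0; apply.
  have := @cvgD _ _ _ F FF (fun=> x) (fun t => h t *: v) x (0 *: v).
  rewrite !scale0r !addr0; apply; first exact: cvg_cst.
  rewrite -[X in _ --> X](scale0r v).
  exact: (@cvg_comp _ _ _ h (fun s : R => s *: v) _ _ _ h0 (@scalel_continuous _ _ v 0)).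
rewrite -[X in _ --> X](scale0r w).
exact: (@cvg_comp _ _ _ k (fun s : R => s *: w) _ _ _ k0 (@scalel_continuous _ _ w 0)).
Qed.

(** The increment is split at [x + h v]. The part along [w] is a derivative at an intermediate
    point, by the mean value theorem, and converges by continuity of ['D_w f]; the part along [v]
    starts at [x] and only needs the derivative there. Taking [k h = h] gives additivity in the
    direction, [k h = h ^ 2] differentiates along a dilation curve. *)
Lemma dir_cvg f x v w (k : R -> R) (c : R) : C1at f x ->
  k h @[h --> 0^'] --> 0 -> k h / h @[h --> 0^'] --> c ->
  h^-1 * (f (x + h *: v + k h *: w) - f x) @[h --> 0^'] --> 'D_v f x + c * 'D_w f x.
Proof.
move=> C1 k0 kc.
have id0 : (h : R) @[h --> (0:R)^'] --> (0:R) by exact: nbhs_dnbhs.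
have [nw cw] := C1 w.
have [r /= r0 Hr] := (nbhs_ballP _ _).1 nw.
(* A point [xi] must be chosen for every [h]; the dummy value [0] serves those [h] for which the
   derivative may fail to exist on the segment. *)
have ex (h : R) : exists xi, `|xi| <= `|k h| /\
   ((forall s, `|s| <= `|k h| -> derivable f (x + h *: v + s *: w) w) ->
     f (x + h *: v + k h *: w) - f (x + h *: v) = k h * 'D_w f (x + h *: v + xi *: w)).
  have [H|nH] := pselect (forall s, `|s| <= `|k h| -> derivable f (x + h *: v + s *: w) w).
    by have [xi [a b]] := MVT_dir H; exists xi.
  by exists 0; split => [|//]; rewrite normr0.
have [xi Hxi] := choice ex.
have xi0 : xi h @[h --> 0^'] --> 0.
  apply/cvgr0Pnorm_lt => e e0; have /cvgr0Pnorm_lt /(_ _ e0) := k0.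
  by apply: filterS => h; apply: le_lt_trans; case: (Hxi h).
have nb : \forall h \near 0^', forall s, `|s| <= `|k h| -> derivable f (x + h *: v + s *: w) w.
  have : h *: v @[h --> (0:R)^'] --> (0:V).
    rewrite -[X in _ --> X](scale0r v).
    exact: (@cvg_comp _ _ _ id (fun s : R => s *: v) _ _ _ id0 (@scalel_continuous _ _ v 0)).
  have r2 : 0 < r / 2 by rewrite divr_gt0.
  move=> /cvgr0Pnorm_lt /(_ _ r2) n1.
  have : `|k h| *: w @[h --> (0:R)^'] --> (0:V).
    rewrite -[X in _ --> X](scale0r w).
    apply: (@cvg_comp _ _ _ (fun h => `|k h|) (fun s : R => s *: w) _ _ _ _ (@scalel_continuous _ _ w 0)).
    apply/cvgr0Pnorm_lt => e e0; have /cvgr0Pnorm_lt /(_ _ e0) := k0.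
    by apply: filterS => h; rewrite normr_id.
  move=> /cvgr0Pnorm_lt /(_ _ r2); apply: filterS2 n1 => h h1 h2 s sk.
  apply: Hr; rewrite -ball_normE /ball_ /= opprD addrA opprD addrA subrr sub0r -opprD normrN.
  apply: le_lt_trans (ler_normD _ _) _; rewrite [ltRHS](splitr r) ltr_leD//.
  apply: le_trans (ltW h2); rewrite !normrZ normr_id; apply: ler_wpM2r => //.
have H1 : h^-1 * (f (x + h *: v) - f x) @[h --> 0^'] --> 'D_v f x.
  have [nv _] := C1 v; have := nbhs_singleton nv.
  rewrite /derivable => /cvg_ex [l Hl]; rewrite /derive (cvg_lim _ Hl)//.
  by apply: cvg_trans Hl; apply: near_eq_cvg; apply: nearW => h /=; rewrite [x + _]addrC.
have H2 : (k h / h) * 'D_w f (x + h *: v + xi h *: w) @[h --> 0^'] --> c * 'D_w f x.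
  apply: cvgM; first exact: kc.
  apply: (@cvg_comp _ _ _ (fun h => x + h *: v + xi h *: w) ('D_w f) _ _ _ _ cw).
  exact: line2_cvg.
rewrite addrC; apply: cvg_trans (cvgD H2 H1); apply: near_eq_cvg.
apply: filterS nb => h Hh; have [_ /(_ Hh) E] := Hxi h.
rewrite -[f (x + h *: v + k h *: w)](subrK (f (x + h *: v))) E.
change (k h / h * 'D_w f (x + h *: v + xi h *: w) + h^-1 * (f (x + h *: v) - f x) =
  h^-1 * (k h * 'D_w f (x + h *: v + xi h *: w) + f (x + h *: v) - f x)); ring.
Qed.

Lemma derivative_unique f x v (l : R) :
  h^-1 * (f (x + h *: v) - f x) @[h --> 0^'] --> l -> is_derive x v f l.
Proof.
move=> H.
have H' : h^-1 *: ((f \o shift x) (h *: v) - f x) @[h --> 0^'] --> l.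
  by apply: cvg_trans H; apply: near_eq_cvg; apply: nearW => h /=; rewrite [x + _]addrC.
by split; [apply/cvg_ex; exists l|exact: cvg_lim H'].
Qed.

Lemma is_derive_dirD f x v w : C1at f x -> is_derive x (v + w) f ('D_v f x + 'D_w f x).
Proof.
move=> C1; apply: derivative_unique.
have := @dir_cvg f x v w id 1 C1; rewrite mul1r => H.
apply: cvg_trans (H _ _).
- by apply: near_eq_cvg; apply: nearW => h; rewrite scalerDr addrA.
- exact: nbhs_dnbhs.
- have : (fun=> 1 : R) h @[h --> (0:R)^'] --> (1 : R) by exact: cvg_cst.
  apply: cvg_trans; apply: near_eq_cvg.
  by apply: filterS (nbhs_dnbhs_neq (0:R)) => h h0; rewrite mulfV.
Qed.

Lemma is_derive_dirZ f x v (c : R) : derivable f x v -> is_derive x (c *: v) f (c * 'D_v f x).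
Proof.
move=> df.
have d0 : is_derive (c * 0) 1 (fun s => f (x + s *: v)) ('D_v f x).
  apply: ((@is_derive_line R V f x v (c * 0) _).1).
  by rewrite mulr0 scale0r addr0; exact/derivableP.
have dc : is_derive (0:R) 1 (fun s => c * s) c.
  by apply: is_derive_eq; rewrite [_ *: _]mulr1.
have := @is_derive1_comp _ (fun s => f (x + s *: v)) (fun s => c * s) 0 _ _ d0 dc.
rewrite (_ : _ \o _ = fun s => f (x + s *: (c *: v))); last first.
  by apply/funext => s /=; rewrite scalerA mulrC.
move=> H; have := (@is_derive_line R V f x (c *: v) 0 _).2.
by rewrite scale0r addr0; apply; rewrite mulrC.
Qed.

Lemma derive_dir_sum f x (J : finType) (c : J -> R) (v : J -> V) : C1at f x ->
  'D_(\sum_i c i *: v i) f x = \sum_i c i * 'D_(v i) f x.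
Proof.
move=> C1; elim: (index_enum J) => [|a s IH].
  by rewrite !big_nil derive0.
rewrite !big_cons (derive_eq_val (is_derive_dirD _ _ C1)) IH.
have [n _] := C1 (v a).
by rewrite (derive_eq_val (is_derive_dirZ _ (nbhs_singleton n))).
Qed.

(** Two applications of the mean value theorem: along [v] to the increment of [f] in the direction
    [w], then along [w] to ['D_v f]. *)
Lemma second_difference_cvg f x v w :
  (forall y, derivable f y v) -> (forall y, derivable ('D_v f) y w) ->
  {for x, continuous ('D_w ('D_v f))} ->
  (fun n : nat => let h := n.+1%:R^-1 in h ^- 2 *
     (f (x + h *: v + h *: w) - f (x + h *: v) - f (x + h *: w) + f x)) @ \oo -->
  'D_w ('D_v f) x.
Proof.
move=> dv dw cvw.
have ex (n : nat) : let h : R := n.+1%:R^-1 in exists ab : R * R,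
  [/\ `|ab.1| <= h, `|ab.2| <= h &
  f (x + h *: v + h *: w) - f (x + h *: v) - f (x + h *: w) + f x =
  h ^+ 2 * 'D_w ('D_v f) (x + ab.1 *: v + ab.2 *: w)].
  move=> h; have h0 : 0 <= h by rewrite /h.
  pose g y := f (y + h *: w) - f y.
  have dg y : is_derive y v g ('D_v f (y + h *: w) - 'D_v f y).
    have d1 : is_derive y v (fun y => f (y + h *: w)) ('D_v f (y + h *: w)).
      apply: derivative_unique.
      have := dv (y + h *: w); rewrite /derivable => /cvg_ex [l Hl].
      rewrite /derive (cvg_lim _ Hl)//.
      apply: cvg_trans Hl; apply: near_eq_cvg; apply: nearW => s /=.
      by congr (_ * (f _ - _)); rewrite addrCA addrA.
    by apply: is_deriveB; exact/derivableP.
  have [xi [xih E1]] := @MVT_dir g x v h (fun s _ => @ex_derive _ _ _ _ _ _ _ (dg _)).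
  have [eta [etah E2]] := @MVT_dir ('D_v f) (x + xi *: v) w h (fun s _ => dw _).
  exists (xi, eta); rewrite -(ger0_norm h0); split => //=.
  rewrite ger0_norm// (derive_eq_val (dg _)) E2 in E1 *.
  rewrite expr2 -mulrA -E1 /g; ring.
have [ab Hab] := choice ex.
have bnd (u : nat -> R) : (forall n, `|u n| <= n.+1%:R^-1) -> u n @[n --> \oo] --> 0.
  move=> un; apply/cvgr0Pnorm_lt => e e0.
  have /cvgr0Pnorm_lt /(_ _ e0) := @cvg_harmonic R.
  apply: filterS => n; apply: le_lt_trans; rewrite /= [leRHS]ger0_norm//.
have a0 : (ab n).1 @[n --> \oo] --> 0 by apply: bnd => n; case: (Hab n).
have b0 : (ab n).2 @[n --> \oo] --> 0 by apply: bnd => n; case: (Hab n).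
have := @cvg_comp _ _ _ (fun n => x + (ab n).1 *: v + (ab n).2 *: w) ('D_w ('D_v f))
  _ _ _ (line2_cvg _ _ _ a0 b0) cvw.
move=> H; apply: cvg_trans (H _); apply: near_eq_cvg; apply: nearW => n /=.
have [_ _ ->] := Hab n.
by rewrite mulrA mulVf ?mul1r// expf_neq0// invr_eq0 pnatr_eq0.
Qed.

(** Both mixed derivatives are limits of the same second difference, which is symmetric in [v] and
    [w]. *)
Lemma schwarz f x v w :
  (forall y, derivable f y v) -> (forall y, derivable f y w) ->
  (forall y, derivable ('D_v f) y w) -> (forall y, derivable ('D_w f) y v) ->
  {for x, continuous ('D_w ('D_v f))} -> {for x, continuous ('D_v ('D_w f))} ->
  'D_w ('D_v f) x = 'D_v ('D_w f) x.
Proof.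
move=> d1 d2 d3 d4 c1 c2.
have h1 := second_difference_cvg d1 d3 c1.
have h2 := second_difference_cvg d2 d4 c2.
rewrite -(cvg_lim _ h1)// -(cvg_lim _ h2)//; congr (lim _).
congr (_ @ \oo); apply/funext => n /=; congr (_ * _).
by rewrite [x + _ *: w + _]addrAC; ring.
Qed.

End DirectionalCalculus.

(** * Rules of differentiation, and coordinate functions *)

Section DeriveRules.
Context {R : realType} {V : normedModType R}.
Implicit Types (f g : V -> R) (x v : V).

Lemma is_derive_funD f g x v a b : is_derive x v f a -> is_derive x v g b ->
  is_derive x v (fun y => f y + g y) (a + b).
Proof. by move=> df dg; exact: is_deriveD. Qed.

Lemma is_derive_funM f g x v a b : is_derive x v f a -> is_derive x v g b ->
  is_derive x v (fun y => f y * g y) (a * g x + f x * b).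
Proof.
move=> df dg; have := is_deriveM df dg; rewrite addrC => H.
by rewrite mulrC; exact: H.
Qed.

Lemma is_derive_cast f x v a b : is_derive x v f a -> a = b -> is_derive x v f b.
Proof. by move=> df <-. Qed.

Lemma is_derive_fun_cst c x v : is_derive x v (fun _ : V => c : R) 0.
Proof. exact: is_derive_cst. Qed.

Lemma is_derive_funZ (c : R) f x v a : is_derive x v f a -> is_derive x v (fun y => c * f y) (c * a).
Proof. by move=> df; have := is_derive_funM (is_derive_fun_cst c x v) df; rewrite mul0r add0r. Qed.

Lemma is_derive_fun_sum (J : finType) (F : J -> V -> R) x v (a : J -> R) :
  (forall i, is_derive x v (F i) (a i)) -> is_derive x v (fun y => \sum_i F i y) (\sum_i a i).
Proof.
move=> cF; elim: (index_enum J) => [|i s IH].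
  rewrite big_nil (_ : (fun y => _) = fun=> 0); first exact: is_derive_fun_cst.
  by apply/funext => y; rewrite big_nil.
rewrite big_cons (_ : (fun y => _) = fun y => F i y + \sum_(i <- s) F i y); first exact: is_derive_funD.
by apply/funext => y; rewrite big_cons.
Qed.

Lemma is_derive_fun_comp (h : R -> R) f x v k l : is_derive (f x) 1 h k -> is_derive x v f l ->
  is_derive x v (fun y => h (f y)) (k * l).
Proof.
move=> dh df.
have d1 : is_derive (0 : R) 1 (fun s => f (x + s *: v)) l.
  by apply: ((@is_derive_line R V f x v 0 l).1); rewrite scale0r addr0.
have d2 : is_derive (f (x + 0 *: v)) 1 h k by rewrite scale0r addr0.
have := @is_derive1_comp _ h (fun s => f (x + s *: v)) 0 _ _ d2 d1.
move=> H; have := (@is_derive_line R V (fun y => h (f y)) x v 0 (k * l)).2.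
by rewrite scale0r addr0; apply.
Qed.

Lemma is_derive_near f g x v l : (\near x, f x = g x) -> is_derive x v f l -> is_derive x v g l.
Proof. exact: near_eq_is_derive. Qed.

End DeriveRules.

Section Coordinates.
Context {R : realType} {m : nat}.
Local Notation pt := (pt R m).
Implicit Types (x v : pt).

Lemma is_derive_linear (h : pt -> R) x v : (forall (s : R) y, h (x + s *: y) = h x + s * h y) ->
  is_derive x v h (h v).
Proof.
move=> lh; apply: derivative_unique.
have H : (fun=> h v : R) s @[s --> (0:R)^'] --> (h v : R) by exact: cvg_cst.
apply: cvg_trans H; apply: near_eq_cvg.
apply: filterS (nbhs_dnbhs_neq (0:R)) => s s0 /=.
by rewrite lh addrC addKr mulKf.
Qed.

Lemma is_derive_coord (j : 'I_m) x v : is_derive x v (fun y : pt => y.1 0 j) (v.1 0 j).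
Proof. by apply: (is_derive_linear (h := fun y : pt => y.1 0 j)) => s y /=; rewrite !mxE. Qed.

Lemma is_derive_snd x v : is_derive x v (fun y : pt => y.2) v.2.
Proof. exact: (is_derive_linear (h := fun y : pt => y.2)). Qed.

Lemma continuous_coord (j : 'I_m) x : {for x, continuous (fun y : pt => y.1 0 j)}.
Proof.
apply: (@continuous_comp pt 'rV[R]_m R fst (fun z => z 0 j)); first exact: cvg_fst.
exact: coord_continuous.
Qed.

Lemma continuous_snd x : {for x, continuous (fun y : pt => y.2)}.
Proof. exact: cvg_snd. Qed.

Lemma open_offL x : x.1 != 0 -> \forall y \near x, y.1 != 0.
Proof. by move=> x0; apply: (@cvgr_neq0 _ _ pt (nbhs x) _ fst x.1 _ x0); exact: cvg_fst. Qed.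

End Coordinates.

(** * Powers of the absolute value and the tangent inequality *)

Section Powers.
Context {R : realType}.
Implicit Types (s a b p : R).

Lemma is_derive_powR s a : 0 < s -> is_derive s 1 (fun s => s `^ a) (a * s `^ (a - 1)).
Proof.
move=> s0; have sI : s \in `]0, +oo[%R by rewrite in_itv /= s0.
split; first exact: derivable_powR.
by rewrite -derive1E powR_derive1.
Qed.

Lemma powR_cont s a : 0 < s -> {for s, continuous (fun s => s `^ a)}.
Proof.
move=> s0; apply: differentiable_continuous; apply/derivable1_diffP.
by have [] := is_derive_powR a s0.
Qed.

Lemma abs_powR_cvg0 b : 0 < b -> `|s| `^ b @[s --> (0:R)] --> (0 : R).
Proof.
move=> b0; apply/cvgr0Pnorm_lt => e e0.
have d0 : 0 < e `^ b^-1 by rewrite powR_gt0.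
have H : \forall s \near (0:R), `|s| < e `^ b^-1 by exact: nbhs0_lt.
move: H; apply: filterS => s sd; rewrite ger0_norm ?powR_ge0//.
have -> : e = (e `^ b^-1) `^ b by rewrite -powRrM mulVf ?gt_eqF// powRr1 ?ltW.
by rewrite gt0_ltr_powR// nnegrE// ltW.
Qed.

Lemma abs_powR_cont b : 0 <= b -> continuous (fun s => `|s| `^ b).
Proof.
rewrite le_eqVlt => /predU1P[<- s|b0 s].
  by rewrite (_ : (fun s => _) = fun=> 1); [exact: cvg_cst|apply/funext => r; rewrite powRr0].
have [->|s0] := eqVneq s 0.
  by rewrite /continuous_at normr0 powR0 ?gt_eqF//; exact: abs_powR_cvg0.
apply: (@continuous_fun_comp R R (fun s => s `^ b) Num.norm); last exact: norm_continuous.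
by apply: powR_cont; rewrite normr_gt0.
Qed.

(* The derivative of [|s|^p]. *)
Definition om p s := p * (`|s| `^ (p - 2) * s).

Lemma near_norm_pos s : 0 < s -> \forall r \near s, `|r| = r.
Proof.
move=> s0.
have H : \forall t \near s, 0 < t by exact: lt_nbhsr.
by apply: filterS H => r /ltW /ger0_norm.
Qed.

Lemma near_norm_neg s : s < 0 -> \forall r \near s, `|r| = - r.
Proof.
move=> s0.
have H : \forall t \near s, t < 0 by exact: lt_nbhsl.
by apply: filterS H => r /ltW /ler0_norm.
Qed.

Lemma is_derive_abs_powR_neq0 s a : s != 0 ->
  is_derive s 1 (fun s => `|s| `^ a) (a * (`|s| `^ (a - 2) * s)).
Proof.
move=> s0; have pE t : 0 < t -> t `^ (a - 1) = t `^ (a - 2) * t.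
  move=> t0; rewrite [in LHS](_ : a - 1 = a - 2 + 1); last by lra.
    by rewrite powRD ?powRr1 ?ltW// (gt_eqF t0) implybT.
have [sp|sn|//] := ltgtP s 0; last by move=> sE; rewrite sE eqxx in s0.
  have nn := near_norm_neg sp; rewrite (nbhs_singleton nn).
  apply: (@is_derive_near _ _ (fun s => (- s) `^ a)); first by apply: filterS nn => r ->.
  have sp' : 0 < - s by lra.
  have d1 : is_derive s 1 (fun s : R => - s) (-1 : R) by apply: is_deriveN.
  have := @is_derive_fun_comp R _ (fun s => s `^ a) (fun s => - s) s 1 _ _ (is_derive_powR a sp') d1.
  by rewrite pE// => H; apply: is_derive_eq; ring.
have nn := near_norm_pos sn; rewrite (nbhs_singleton nn).
apply: (@is_derive_near _ _ (fun s => s `^ a)); first by apply: filterS nn => r ->.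
by rewrite -pE//; exact: is_derive_powR.
Qed.

Lemma is_derive_abs_powR s p : 2 <= p -> is_derive s 1 (fun s => `|s| `^ p) (om p s).
Proof.
move=> p2; have [->|s0] := eqVneq s 0; last exact: is_derive_abs_powR_neq0.
rewrite /om mulr0 mulr0; apply: derivative_unique.
have p1 : 0 < p - 1 by lra.
apply/cvgr0Pnorm_lt => e e0.
have /cvgr0Pnorm_lt /(_ _ e0) := abs_powR_cvg0 p1.
move=> H; have := nbhs_dnbhs H; apply: filterS2 (nbhs_dnbhs_neq (0:R)) => h h0.
rewrite add0r normr0 powR0 ?subr0 ?gt_eqF//; last by lra.
rewrite [h *: 1]mulr1 normrM normrV ?unitfE// -(@mulr_powRB1 _ `|h| p)//; last by lra.
by rewrite normrM normr_id mulKf ?normr_eq0.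
Qed.

Lemma is_derive_om s p : 2 <= p -> is_derive s 1 (om p) (p * (p - 1) * `|s| `^ (p - 2)).
Proof.
move=> p2; have [->|s0] := eqVneq s 0.
  apply: derivative_unique.
  (* If [p = 2] then [p - 1 = 1], and [0] to the power [0] is [1]; if [p > 2] both sides vanish. *)
  have -> : p * (p - 1) * `|0 : R| `^ (p - 2) = p * `|0 : R| `^ (p - 2).
    have [->|p3] := eqVneq p 2; first by rewrite (_ : (2 : R) - 1 = 1) ?mulr1//; ring.
    by rewrite normr0 powR0 ?mulr0// subr_eq0.
  have p20 : 0 <= p - 2 by lra.
  have c := @continuous_funZ R R p (fun s => `|s| `^ (p - 2)) 0 (abs_powR_cont p20 (x := 0)).
  have {}c : p * `|h| `^ (p - 2) @[h --> (0:R)^'] --> p * `|0 : R| `^ (p - 2).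
    by apply: cvg_trans c; apply: cvg_app; exact: nbhs_dnbhs.
  apply: cvg_trans c; apply: near_eq_cvg.
  apply: filterS (nbhs_dnbhs_neq (0:R)) => h h0.
  by rewrite add0r [_ *: _]mulr1 /om mulr0 mulr0 subr0; field.
have := is_derive_funZ p (is_derive_funM (is_derive_abs_powR_neq0 (p - 2) s0) (is_derive_id s 1)).
move=> H.
have s2 : s * s = `|s| * `|s| by rewrite -!expr2 real_normK// num_real.
have sp : 0 < `|s| by rewrite normr_gt0.
have e1 : `|s| `^ (p - 2 - 2) * (s * s) = `|s| `^ (p - 2).
  rewrite s2 [X in _ = _ `^ X](_ : p - 2 = (p - 2 - 2) + 1 + 1); last by lra.
  by rewrite !powRD ?(gt_eqF sp) ?implybT// powRr1 ?mulrA// ltW.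
suff -> : p * (p - 1) * `|s| `^ (p - 2) =
  p * ((p - 2) * (`|s| `^ (p - 2 - 2) * s) * s + `|s| `^ (p - 2) * 1) by exact: H.
by rewrite -e1; ring.
Qed.

Lemma om_cont p : 2 <= p -> continuous (om p).
Proof.
move=> p2 s; apply: differentiable_continuous; apply/derivable1_diffP.
by have [] := is_derive_om s p2.
Qed.

Lemma om_mul (b p : R) : 0 < p -> om p b * b = p * `|b| `^ p.
Proof.
move=> p0.
have [->|b0] := eqVneq b 0; first by rewrite normr0 powR0 ?gt_eqF// !mulr0.
have bp : 0 < `|b| by rewrite normr_gt0.
rewrite /om -!mulrA; congr (_ * _).
rewrite (_ : b * b = `|b| * `|b|); last by rewrite -!expr2 real_normK// num_real.
rewrite [X in _ = _ `^ X](_ : p = (p - 2) + 1 + 1); last by lra.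
by rewrite !powRD ?(gt_eqF bp) ?implybT// powRr1 ?mulrA// ltW.
Qed.

(** Convexity of [|s|^p] in the form of Young's inequality for [|a|] and [|b|^(p-1)], with exponents
    [p] and [p / (p - 1)]. *)
Lemma abs_powR_ge_tangent (a b p : R) : 2 <= p ->
  `|b| `^ p + om p b * (a - b) <= `|a| `^ p.
Proof.
move=> p2; have p0 : 0 < p by lra.
have p1 : 0 < p - 1 by lra.
pose q := p / (p - 1).
have q0 : 0 < q by rewrite divr_gt0.
have pq : p^-1 + q^-1 = 1 by rewrite /q; field; rewrite !gt_eqF.
have Y := @conjugate_powR R `|a| (`|b| `^ (p - 1)) p q (normr_ge0 _) (powR_ge0 _ _) p0 q0 pq.
have bb := om_mul b p0.
have bq : (`|b| `^ (p - 1)) `^ q = `|b| `^ p.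
  by rewrite -powRrM /q; congr (_ `^ _); field; rewrite gt_eqF.
have ba : om p b * a <= p * (`|a| * `|b| `^ (p - 1)).
  have [->|b0] := eqVneq b 0.
    by rewrite /om !mulr0 mul0r !mulr_ge0// ?powR_ge0// ltW.
  have bp : 0 < `|b| by rewrite normr_gt0.
  rewrite [X in _ `^ X](_ : p - 1 = (p - 2) + 1); last by lra.
  rewrite powRD ?(gt_eqF bp) ?implybT//= powRr1 // /om -mulrA ler_pM2l// -mulrA.
  rewrite [leRHS]mulrCA ler_wpM2l ?powR_ge0//.
  by rewrite -normrM [a * b]mulrC ler_norm.
rewrite bq in Y.
have Y2 : p * (`|a| * `|b| `^ (p - 1)) <= `|a| `^ p + (p - 1) * `|b| `^ p.
  have -> : `|a| `^ p + (p - 1) * `|b| `^ p = p * (`|a| `^ p / p + `|b| `^ p / q).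
    by rewrite /q; field; rewrite !gt_eqF.
  by rewrite ler_pM2l.
rewrite mulrBr bb; lra.
Qed.

End Powers.

(** * The pointwise divergence identity as linear algebra *)

Section Algebra.
Context {R : realType} {m : nat}.
Variables C B : 'I_m -> 'I_m -> R.
Hypothesis Canti : forall i j, C i j = - C j i.
Hypothesis CB : forall i k, \sum_j C i j * B j k = (i == k)%:R.
Hypothesis Banti : forall i j, B i j = - B j i.

Lemma anti_sym_sum0 (S : 'I_m -> 'I_m -> R) : (forall i j, S i j = S j i) ->
  \sum_i \sum_j C i j * S i j = 0.
Proof.
move=> Ss; suff H : \sum_i \sum_j C i j * S i j = - \sum_i \sum_j C i j * S i j by lra.
rewrite {1}exchange_big /= -sumrN; apply: eq_bigr => i _.
rewrite -sumrN; apply: eq_bigr => j _.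
by rewrite Canti Ss mulNr.
Qed.

Lemma trace_CB : \sum_i \sum_j C i j * B i j = - m%:R.
Proof.
rewrite (eq_bigr (fun=> -1)); last first.
  move=> i _; have -> : (-1 : R) = - \sum_j C i j * B j i by rewrite CB eqxx.
  by rewrite -sumrN; apply: eq_bigr => j _; rewrite Banti mulrN.
by rewrite sumr_const card_ord mulNrn.
Qed.

Variables (z b u_ Xu f_ utj : 'I_m -> R) (hess DX : 'I_m -> 'I_m -> R) (DtX : 'I_m -> R).
Variables (t ut utt f ft phi w w' pth : R).
Hypothesis Cb : forall i, \sum_j C i j * b j = z i.
Hypothesis bz : \sum_j z j * b j = 0.
Hypothesis XuE : forall i, Xu i = u_ i + 2^-1 * b i * ut.
Hypothesis hess_sym : forall i j, hess i j = hess j i.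
Hypothesis DXE : forall j i, DX j i = hess j i + 2^-1 * (B i j * ut + b i * utj j).
Hypothesis DtXE : forall i, DtX i = utj i + 2^-1 * (b i * utt).
Hypothesis euler : \sum_j z j * f_ j + 2 * t * ft = - pth * f.
Hypothesis m_gt0 : (0 < m)%N.

Let mR : m%:R != 0 :> R. Proof. by rewrite pnatr_eq0 -lt0n. Qed.

Lemma sum_C_weight (a c : 'I_m -> R) (k : R) :
  \sum_i a i * (\sum_j C i j * (c j + 2^-1 * b j * k)) =
  \sum_i \sum_j C i j * (a i * c j) + 2^-1 * k * \sum_i z i * a i.
Proof.
rewrite mulr_sumr -big_split /=; apply: eq_bigr => i _.
rewrite -(Cb i) mulr_suml !mulr_sumr -big_split /=; apply: eq_bigr => j _; ring.
Qed.

(** All variables are values at one point: [C = B^-1], [b = B z], [f = d^(-p theta)], [phi = |u|^p],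
    [w] and [w'] the first two derivatives of [|s|^p] at [u], and [DX], [DtX] the derivatives of
    [X_i u]. The coefficient [(m + 2) / m] of [Z_d] appears as [1 + 2 / m]: the [1] comes from the
    Euler field, the [2 / m] from differentiating the factor [t] in the other piece. *)
Lemma divergence_identity :
  \sum_j ((4 / m%:R) * (f_ j * t * (\sum_i C i j * (w * Xu i))
            + f * t * (\sum_i C i j * (w' * u_ j * Xu i + w * DX j i)))
          + (f_ j * phi * z j + f * (w * u_ j) * z j + f * phi))
  + ((2 / m%:R) * (ft * t * (\sum_i z i * (w * Xu i)) + f * (\sum_i z i * (w * Xu i))
       + f * t * (\sum_i z i * (w' * ut * Xu i + w * DtX i)))
     + 2 * (f * phi + t * ft * phi + t * f * (w * ut))) =
  w * (\sum_i Xu i * ((m%:R + 2) / m%:R * f * z i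
      + 4 / m%:R * t * \sum_j C i j * (f_ j + 2^-1 * b j * ft)))
  + (m%:R + 2 - pth) * (phi * f).
Proof.
pose A := \sum_i \sum_j C i j * (Xu i * f_ j).
pose S := \sum_i z i * Xu i.
have SE : \sum_i z i * u_ i = S.
  rewrite /S [RHS](eq_bigr (fun i => z i * u_ i + 2^-1 * ut * (z i * b i))).
    by rewrite big_split /= -mulr_sumr bz mulr0 addr0.
  by move=> i _; rewrite XuE; ring.
have s1 : \sum_i z i * (w * Xu i) = w * S.
  by rewrite /S mulr_sumr; apply: eq_bigr => i _; ring.
pose T2 := \sum_i \sum_j C i j * (Xu i * u_ j).
pose T3 := \sum_i \sum_j C i j * DX j i.
pose S3 := \sum_i z i * DtX i.
have s2 : \sum_i z i * (w' * ut * Xu i + w * DtX i) = w' * ut * S + w * S3.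
  by rewrite /S /S3 !mulr_sumr -big_split /=; apply: eq_bigr => i _; ring.
(* The left side is [sum_ij C_ij X_i u X_j u], a skew matrix against a symmetric one. *)
have T2E : T2 + 2^-1 * ut * S = 0.
  have := sum_C_weight Xu u_ ut; rewrite -/T2 -/S => <-.
  rewrite -[RHS](@anti_sym_sum0 (fun i j => Xu i * Xu j)); last by move=> i j; rewrite mulrC.
  apply: eq_bigr => i _; rewrite mulr_sumr; apply: eq_bigr => j _.
  by rewrite (XuE j); ring.
(* The left side is [sum_ij C_ij X_j X_i u]. Its part symmetric in [i] and [j] is [h0] and drops
   out; the rest is [2^-1 ut] times [sum_ij C_ij B_ij = - m]. *)
have T3E : T3 + 2^-1 * S3 = - (m%:R / 2) * ut.
  have -> : 2^-1 * S3 = \sum_i \sum_j C i j * (2^-1 * b j * DtX i).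
    rewrite /S3 mulr_sumr; apply: eq_bigr => i _; rewrite -(Cb i) mulr_suml mulr_sumr.
    by apply: eq_bigr => j _; ring.
  rewrite /T3 -big_split /=.
  have h0 := @anti_sym_sum0 (fun i j => hess j i
    + 2^-1 * (b i * utj j + b j * utj i) + 2^-1 * 2^-1 * (b i * b j * utt)).
  have -> : - (m%:R / 2) * ut = 2^-1 * ut * \sum_i \sum_j C i j * B i j.
    by rewrite trace_CB; ring.
  have {}h0 := h0 (fun i j => ltac:(by rewrite hess_sym; ring)).
  rewrite -[RHS]addr0 -[X in _ = _ + X]h0.
  rewrite mulr_sumr -big_split /=; apply: eq_bigr => i _.
  rewrite mulr_sumr -!big_split /=; apply: eq_bigr => j _.
  by rewrite DXE DtXE; ring.
have rE : \sum_i Xu i * ((m%:R + 2) / m%:R * f * z i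
      + 4 / m%:R * t * \sum_j C i j * (f_ j + 2^-1 * b j * ft)) =
   (m%:R + 2) / m%:R * f * S + 4 / m%:R * t * (A + 2^-1 * ft * S).
  have := sum_C_weight Xu f_ ft; rewrite -/A -/S => <-.
  rewrite /S !mulr_sumr -big_split /=; apply: eq_bigr => i _; ring.
have lE : \sum_j ((4 / m%:R) * (f_ j * t * (\sum_i C i j * (w * Xu i))
            + f * t * (\sum_i C i j * (w' * u_ j * Xu i + w * DX j i)))
          + (f_ j * phi * z j + f * (w * u_ j) * z j + f * phi)) =
   4 / m%:R * (t * w * A + f * t * (w' * T2 + w * T3)) +
   (phi * (\sum_j z j * f_ j) + f * w * S + m%:R * (f * phi)).
  rewrite -SE big_split /=; congr (_ + _).
    rewrite -mulr_sumr big_split /=; congr (_ * (_ + _)).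
      rewrite /A exchange_big mulr_sumr /=; apply: eq_bigr => j _.
      by rewrite !mulr_sumr; apply: eq_bigr => i _; ring.
    rewrite /T2 /T3 -mulr_sumr; congr (_ * _).
    rewrite [X in _ = w' * X + _]exchange_big [X in _ = _ + w * X]exchange_big /=.
    rewrite !mulr_sumr -big_split /=; apply: eq_bigr => j _.
    by rewrite !mulr_sumr -big_split /=; apply: eq_bigr => i _; ring.
  rewrite !big_split /= sumr_const card_ord.
  congr (_ + _ + _); rewrite ?mulr_sumr; try by apply: eq_bigr => j _; ring.
  by rewrite mulr_natl.
rewrite lE rE s1 s2.
have -> : \sum_j z j * f_ j = - pth * f - 2 * t * ft by rewrite -euler; ring.
have -> : T2 = - (2^-1 * ut * S) by lra.
have -> : T3 = - (m%:R / 2) * ut - 2^-1 * S3 by lra.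
by field.
Qed.

End Algebra.

(** * Functions bounded near every point but the origin *)

Section Admissible.
Context {R : realType} {m : nat}.
Local Notation pt := (pt R m).
Implicit Types (f g : pt -> R) (x : pt).

(** With [P] the complement of the axis this is the local boundedness of (d.2): the centre [x0] may
    lie on the axis, only the points of evaluation avoid it. *)
Definition locbd (P : pt -> Prop) g :=
  forall x0 : pt, x0 != 0 -> exists C : R, \forall x \near x0, P x -> `|g x| <= C.

Lemma compact_locbd (P : pt -> Prop) g (K : set pt) :
  locbd P g -> compact K -> ~ K 0 -> exists2 L : R, 0 <= L & forall x, K x -> P x -> `|g x| <= L.
Proof.
move=> lg /compact_near_coveringP cK K0.
have H : exists2 L : R, 0 <= L & K `<=` [set x | P x -> `|g x| <= L].
  apply: (@pinfty_ex_ge _ 0 [set L | K `<=` [set x | P x -> `|g x| <= L]]); first exact: num_real.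
  apply: (cK R +oo%R (fun L x => P x -> `|g x| <= L)) => x Kx.
  have x0 : x != 0 by apply/eqP => xE; apply: K0; rewrite -xE.
  have [C HC] := lg x x0.
  exists ([set y | P y -> `|g y| <= C], [set L | C <= L]) => /=.
    by split => //; exact: nbhs_pinfty_ge (num_real C).
  by move=> [y L] /= [h1 h2] Py; apply: le_trans h2; exact: h1.
by have [L L0 HL] := H; exists L.
Qed.

Lemma locbd_cont (P : pt -> Prop) g : (forall x, x != 0 -> {for x, continuous g}) -> locbd P g.
Proof.
move=> cg x0 /cg c; exists (`|g x0| + 1).
have /cvgrPdist_lt /(_ _ ltr01) := c; apply: filterS => x H _.
have := ler_distD (g x0) (g x) 0; rewrite !subr0 distrC => h.
by apply: le_trans h _; rewrite addrC lerD2l ltW.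
Qed.

(** Closed under sums and products, so membership of the long expressions below is read off their
    factors; a compact support away from the origin turns it into [ggood]. *)
Definition adm g := (forall x, x.1 != 0 -> {for x, continuous g}) /\ locbd (fun x => x.1 != 0) g.

Lemma fst_neq0 x : x.1 != 0 -> x != 0.
Proof. by apply: contra_neq => ->. Qed.

Lemma adm_cont g : (forall x, x != 0 -> {for x, continuous g}) -> adm g.
Proof. by move=> cg; split; [move=> x /fst_neq0; exact: cg|exact: locbd_cont]. Qed.

Lemma adm_cst (c : R) : adm (fun=> c).
Proof. by apply: adm_cont => x _; exact: continuous_fun_cst. Qed.

Lemma admD f g : adm f -> adm g -> adm (fun x => f x + g x).
Proof.
move=> [cf bf] [cg bg]; split; first by move=> x x0; apply: continuous_funD; [exact: cf|exact: cg].
move=> x0 nx0; have [C HC] := bf _ nx0; have [D HD] := bg _ nx0; exists (C + D).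
apply: filterS2 HC HD => x h1 h2 x1; apply: le_trans (ler_normD _ _) _.
by apply: lerD; [exact: h1|exact: h2].
Qed.

Lemma admM f g : adm f -> adm g -> adm (fun x => f x * g x).
Proof.
move=> [cf bf] [cg bg]; split; first by move=> x x0; apply: continuous_funM; [exact: cf|exact: cg].
move=> x0 nx0; have [C HC] := bf _ nx0; have [D HD] := bg _ nx0; exists (C * D).
apply: filterS2 HC HD => x h1 h2 x1; rewrite normrM.
by apply: ler_pM => //; [exact: h1|exact: h2].
Qed.

Lemma admZ (c : R) f : adm f -> adm (fun x => c * f x).
Proof. by move=> af; apply: admM => //; exact: adm_cst. Qed.

Lemma adm_sum (J : finType) (F : J -> pt -> R) : (forall i, adm (F i)) ->
  adm (fun x => \sum_i F i x).
Proof.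
move=> aF; elim: (index_enum J) => [|i s IH].
  rewrite (_ : (fun y => _) = fun=> 0); first exact: adm_cst.
  by apply/funext => y; rewrite big_nil.
rewrite (_ : (fun y => _) = fun y => F i y + \sum_(i <- s) F i y); first exact: admD.
by apply/funext => y; rewrite big_cons.
Qed.

Lemma adm_abs_powR p g : 0 <= p -> adm g -> adm (fun x => `|g x| `^ p).
Proof.
move=> p0 [cg bg]; split.
  move=> x x0; apply: (@continuous_fun_comp R pt (fun s => `|s| `^ p) g); last exact: cg.
  exact: abs_powR_cont.
move=> x0 nx0; have [C HC] := bg _ nx0; exists (`|C| `^ p).
apply: filterS HC => x h x1; rewrite ger0_norm ?powR_ge0//.
apply: ge0_ler_powR => //; rewrite ?nnegrE//.
exact: le_trans (h x1) (ler_norm _).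
Qed.

Lemma compact_norm_bound (K : set pt) : compact K ->
  exists2 M : R, 0 <= M & forall x, M < `|x| -> ~ K x.
Proof.
move=> /compact_bounded /(@pinfty_ex_ge _ 0 _ (num_real _)) [M M0 HM].
by exists M => // x Mx Kx; move: (HM _ Kx) => /=; rewrite leNgt Mx.
Qed.

Hypothesis m_gt0 : (0 < m)%N.
Variables (K : set pt) (M : R).
Hypothesis cK : compact K.
Hypothesis K0 : ~ K 0.
Hypothesis M0 : 0 <= M.
Hypothesis KM : forall x, M < `|x| -> ~ K x.

Lemma near_notK x : ~ K x -> \forall y \near x, ~ K y.
Proof.
move=> nKx; have oK : open (~` K).
  by apply: closed_openC; apply: compact_closed => //; exact: norm_hausdorff.
exact: (open_nbhs_nbhs (conj oK nKx)).
Qed.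

Lemma adm_ggood g : adm g -> (forall x, x.1 != 0 -> ~ K x -> g x = 0) ->
  exists2 L, 0 <= L & ggood M L g.
Proof.
move=> [cg bg] g0; have [L L0 HL] := compact_locbd bg cK K0.
exists L => // x x0; split; last exact: cg.
  have [Kx|nKx] := pselect (K x); first exact: HL.
  by rewrite g0// normr0.
by move=> /KM nKx; rewrite g0.
Qed.

(** Continuity at the origin comes for free: [K] is closed and misses it, so [g] vanishes nearby. *)
Lemma cont_gfgood g : (forall x, x != 0 -> {for x, continuous g}) ->
  (forall x, ~ K x -> g x = 0) -> exists2 L, 0 <= L & gfgood M L g.
Proof.
move=> cg g0; have [L L0 HL] := compact_locbd (@locbd_cont (fun=> True) _ cg) cK K0.
exists L => //; split.
- move=> x; have [Kx|nKx] := pselect (K x); first exact: HL.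
  by rewrite g0// normr0.
- by move=> x /KM nKx; rewrite g0.
- move=> x; have [->|x0] := eqVneq x 0; last exact: cg.
  have n0 := near_notK K0.
  have H : (fun=> 0 : R) y @[y --> (0:pt)] --> (0 : R) by exact: cvg_cst.
  rewrite /continuous_at g0//; apply: cvg_trans H; apply: near_eq_cvg.
  by apply: filterS n0 => y ny; rewrite g0.
Qed.

(** The bound is kept along with the zero integral because additivity of [Gr] requires it. *)
Definition nullint g := exists2 L, 0 <= L & ggood M L g /\ Gr g = 0.

Lemma nullint_derive f g (e : pt) (j : 'I_m) :
  (forall x, x != 0 -> {for x, continuous f}) -> (forall x, ~ K x -> f x = 0) ->
  adm g -> e.1 0 j = 0 -> (forall x, x.1 != 0 -> is_derive x e f (g x)) ->
  nullint g.
Proof.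
move=> cf f0 ag ej df.
have g0 x : x.1 != 0 -> ~ K x -> g x = 0.
  move=> x0 nK; rewrite -(derive_eq_val (df x x0)).
  rewrite -(@near_eq_derive R _ _ (cst 0) f x e); first exact: derive_cst.
  by apply: filterS (near_notK nK) => y ny; rewrite f0.
have [L L0 gL] := adm_ggood ag g0.
have [L' L'0 fL] := cont_gfgood cf f0.
by exists L => //; split => //; exact: (Gr_derive0 m_gt0 M0 L'0 L0 fL gL ej df).
Qed.

Lemma nullintD f g : nullint f -> nullint g -> nullint (fun x => f x + g x).
Proof.
move=> [L L0 [gL GL]] [L' L'0 [gL' GL']]; exists (L + L'); first exact: addr_ge0.
by split; [exact: ggoodD|rewrite (GrD m_gt0 M0 L0 L'0)// GL GL' addr0].
Qed.

Lemma nullint0 : nullint (fun=> 0).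
Proof.
exists 0 => //; have g0 : ggood M 0 (fun _ : pt => 0 : R).
  by move=> x x0; split => //; [rewrite normr0|exact: continuous_fun_cst].
split => //; have := @GrZ R m m_gt0 M 0 0 (fun=> 0) M0 (lexx _) g0.
move=> H; rewrite -[RHS](mul0r (Gr (fun _ : pt => 0 : R))) -H.
by congr Gr; apply/funext => x; rewrite mul0r.
Qed.

Lemma nullint_sum (J : finType) (F : J -> pt -> R) : (forall i, nullint (F i)) ->
  nullint (fun x => \sum_i F i x).
Proof.
move=> aF; elim: (index_enum J) => [|i s IH].
  rewrite (_ : (fun y => _) = fun=> 0); first exact: nullint0.
  by apply/funext => y; rewrite big_nil.
rewrite (_ : (fun y => _) = fun y => F i y + \sum_(i <- s) F i y); first exact: nullintD.
by apply/funext => y; rewrite big_cons.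
Qed.

End Admissible.

(** * Smooth functions, skew-symmetric matrices and their inverses *)

Section CkFacts.
Context {R : realType} {m : nat}.
Local Notation pt := (pt R m).
Implicit Types (f : pt -> R) (U : set pt).

Lemma smooth_C1at U f x : open U -> smooth_on U f -> U x -> C1at f x.
Proof.
move=> oU sf Ux v; have [_ /(_ v) [dv cv]] := sf 1%N; split; last exact: cv.
by have := open_nbhs_nbhs (conj oU Ux); apply: filterS => y; exact: dv.
Qed.

Lemma smoothT_derivable f x v : smooth_on setT f -> derivable f x v.
Proof. by move=> sf; have [_ /(_ v) [dv _]] := sf 1%N; exact: dv. Qed.

Lemma smoothT_cont f x : smooth_on setT f -> {for x, continuous f}.
Proof. by move=> sf; have := sf 0%N; exact. Qed.

Lemma smooth_derive U f v : smooth_on U f -> smooth_on U ('D_v f).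
Proof. by move=> sf k; have [_ /(_ v) [_ H]] := sf k.+1. Qed.

Lemma open_Lset : open (~` @Lset R m).
Proof.
rewrite openE => x Lx; have : x.1 != 0 by apply/eqP.
by move=> /open_offL; apply: filterS => y /eqP.
Qed.

End CkFacts.

Section SkewMatrix.
Context {R : realType} {m : nat}.
Variable B : 'M[R]_m.
Hypothesis m_gt0 : (0 < m)%N.
Hypothesis Bskew : B^T = - B.
Hypothesis Binj : forall v : 'cV[R]_m, B *m v = 0 -> v = 0.

Lemma Bunit : B \in unitmx.
Proof.
rewrite -row_free_unit -kermx_eq0; apply/eqP/row_matrixP => i; rewrite row0.
have : row i (kermx B) *m B = 0 by rewrite -row_mul mulmx_ker row0.
move=> /(congr1 trmx); rewrite trmx_mul Bskew trmx0 mulNmx => /eqP.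
rewrite oppr_eq0 => /eqP /Binj /(congr1 trmx); by rewrite trmxK trmx0.
Qed.

Lemma invB_skew : (invmx B)^T = - invmx B.
Proof.
have H : (invmx B)^T *m B = - 1%:M.
  by rewrite -[B in _ *m B]opprK -Bskew mulmxN -trmx_mul mulmxV ?Bunit// trmx1.
by rewrite -[LHS](mulmxK Bunit) H mulNmx mul1mx.
Qed.

Lemma invB_anti i j : invmx B i j = - invmx B j i.
Proof. by have /matrixP /(_ j i) := invB_skew; rewrite !mxE. Qed.

Lemma B_anti i j : B i j = - B j i.
Proof. by have /matrixP /(_ j i) := Bskew; rewrite !mxE. Qed.

Lemma invB_B i k : \sum_j invmx B i j * B j k = (i == k)%:R.
Proof. by have /matrixP /(_ i k) := mulVmx Bunit; rewrite !mxE. Qed.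

Lemma BmulE (z : 'rV[R]_m) i : Bmul B z 0 i = \sum_k z 0 k * B i k.
Proof. by rewrite mxE; apply: eq_bigr => k _; rewrite mxE. Qed.

Lemma BinvE (z : 'rV[R]_m) i : Binv B z 0 i = \sum_k invmx B i k * z 0 k.
Proof. by rewrite mxE; apply: eq_bigr => k _; rewrite mxE mulrC. Qed.

Lemma invB_Bmul (z : 'rV[R]_m) i : \sum_j invmx B i j * Bmul B z 0 j = z 0 i.
Proof. by rewrite -BinvE /Binv /Bmul -mulmxA -trmx_mul mulVmx ?Bunit// trmx1 mulmx1. Qed.

Lemma dot_Bmul (z : 'rV[R]_m) : \sum_j z 0 j * Bmul B z 0 j = 0.
Proof.
have H : \sum_j z 0 j * Bmul B z 0 j = \sum_i \sum_j B i j * (z 0 i * z 0 j).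
  apply: eq_bigr => i _; rewrite BmulE mulr_sumr; apply: eq_bigr => j _; ring.
by rewrite H; apply: (anti_sym_sum0 B_anti) => i j; rewrite mulrC.
Qed.

(** A skew-symmetric matrix of size one is zero and has a kernel. *)
Lemma dim_gt1 : (1 < m)%N.
Proof.
case: m B m_gt0 Bskew Binj => // -[|//] B' _ Bs Bi; exfalso.
have B0 : B' = 0.
  apply/matrixP => i j; rewrite !ord1 mxE.
  by have /matrixP /(_ 0 0) := Bs; rewrite !mxE; lra.
have := Bi (const_mx 1); rewrite B0 mul0mx => /(_ erefl) /matrixP /(_ 0 0).
by rewrite !mxE => /eqP; rewrite oner_eq0.
Qed.

(* Lines parallel to a coordinate axis of [z] avoid [z = 0] as soon as another coordinate is nonzero. *)
Lemma other_coord (i : 'I_m) : exists j : 'I_m, ebase R i 0 j = 0.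
Proof.
pose j0 : 'I_m := Ordinal m_gt0; pose j1 : 'I_m := Ordinal dim_gt1.
have [->|ij] := eqVneq i j0; first by exists j1; rewrite mxE.
by exists j0; rewrite mxE (negbTE ij).
Qed.

End SkewMatrix.

(** * Euler's identity and bounds for regular homogeneous functions *)

Section RegularHomogeneous.
Context {R : realType} {m : nat}.
Variables (B : 'M[R]_m) (d : pt R m -> R).
Local Notation pt := (pt R m).
Hypothesis reg : regular_hom B d.
Implicit Types x v : pt.
Local Notation E j := ((ebase R j, 0) : pt).
Local Notation T := ((0, 1) : pt).

Lemma d_gt0 x : x != 0 -> 0 < d x.
Proof. by case: reg => -[_ [_ H]] _ _ _; exact: H. Qed.

Lemma d_cont x : {for x, continuous d}.
Proof. by case: reg => -[H _] _ _ _; exact: H. Qed.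

Lemma d_dil l x : 0 < l -> d (dil l x) = l * d x.
Proof. by case: reg => -[_ [H _]] _ _ _; exact: H. Qed.

Lemma d_smooth : smooth_on (~` @Lset R m) d.
Proof. by case: reg. Qed.

Lemma d_C1 x : x.1 != 0 -> C1at d x.
Proof.
by move=> /eqP x0; apply: (smooth_C1at (@open_Lset R m)) => //; exact: d_smooth.
Qed.

Lemma d_is_derive x v : x.1 != 0 -> is_derive x v d ('D_v d x).
Proof.
move=> x0; apply/derivableP; have [n _] := d_C1 x0 v; exact: nbhs_singleton n.
Qed.

Lemma basis_expand (z : 'rV[R]_m) (t : R) : (z, t) = \sum_j z 0 j *: E j + t *: T :> pt.
Proof.
have H : forall s : seq 'I_m, \sum_(j <- s) z 0 j *: E j = (\sum_(j <- s) z 0 j *: ebase R j, 0) :> pt.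
  elim=> [|a s IH]; first by rewrite !big_nil.
  by rewrite !big_cons IH /GRing.add /=; congr (_, _); rewrite /= scaler0 addr0.
rewrite H; congr (_, _) => /=; last by rewrite add0r [_ *: _]mulr1.
rewrite scaler0 addr0; apply/rowP => i; rewrite summxE (bigD1 i) //= big1 => [|j ji].
  by rewrite !mxE eqxx mulr1 addr0.
by rewrite !mxE (negbTE ji) mulr0.
Qed.

(** The dilation curve is the parabola [dil (1 + h) x = x + h (z, 2 t) + h^2 (0, t)]. By homogeneity
    [d] grows along it with constant slope [d x], and the quadratic term does not affect the
    derivative at [h = 0]. *)
Lemma euler_d x : x.1 != 0 -> \sum_j x.1 0 j * 'D_(E j) d x + 2 * x.2 * 'D_T d x = d x.
Proof.
move=> x0; have C1 := d_C1 x0.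
pose v : pt := (x.1, 2 * x.2).
have <- : 'D_v d x = \sum_j x.1 0 j * 'D_(E j) d x + 2 * x.2 * 'D_T d x.
  rewrite /v basis_expand (derive_eq_val (is_derive_dirD _ _ C1)) derive_dir_sum//.
  by congr (_ + _); rewrite (derive_eq_val (is_derive_dirZ _ _))//; have [] := d_is_derive T x0.
have id0 : (h : R) @[h --> (0:R)^'] --> (0:R) by exact: nbhs_dnbhs.
have := @dir_cvg R pt d x v (0, x.2) (fun h => h * h) 0 C1.
rewrite mul0r addr0 => H.
have {}H : h^-1 * (d (x + h *: v + (h * h) *: ((0, x.2) : pt)) - d x) @[h --> 0^'] --> 'D_v d x.
  apply: H.
    by rewrite -[X in _ --> X](mul0r 0); apply: cvgM.
  apply: cvg_trans id0; apply: near_eq_cvg.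
  by apply: filterS (nbhs_dnbhs_neq (0:R)) => h h0; rewrite mulfK.
have dilE h : x + h *: v + (h * h) *: ((0, x.2) : pt) = dil (1 + h) x.
  apply: injective_projections.
    change (x.1 + h *: x.1 + (h * h) *: (0 : 'rV[R]_m) = (1 + h) *: x.1).
    by rewrite scaler0 addr0 scalerDl scale1r.
  by change (x.2 + h * (2 * x.2) + (h * h) * x.2 = (1 + h) ^+ 2 * x.2); ring.
have H2 : (fun=> d x) h @[h --> (0:R)^'] --> d x by exact: cvg_cst.
rewrite -(cvg_lim _ H)//; rewrite -[RHS](cvg_lim _ H2)//; congr (lim _).
rewrite eqEsubset; split; apply: near_eq_cvg.
  near=> h.
  have h0 : h != 0 by near: h; exact: nbhs_dnbhs_neq.
  have h1 : 0 < 1 + h.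
    near: h; apply: nbhs_dnbhs; have := @nbhs0_lt R R 1 ltr01.
    by apply: filterS => h; rewrite ltr_norml => /andP[h1 _]; lra.
  have -> : x + h *: v + (h * h) *: ((0, x.2) : pt) = dil (1 + h) x.
    exact: dilE.
  by rewrite d_dil// mulrDl mul1r addrC addKr mulKf.
near=> h.
have h0 : h != 0 by near: h; exact: nbhs_dnbhs_neq.
have h1 : 0 < 1 + h.
  near: h; apply: nbhs_dnbhs; have := @nbhs0_lt R R 1 ltr01.
  by apply: filterS => h; rewrite ltr_norml => /andP[h1 _]; lra.
have -> : x + h *: v + (h * h) *: ((0, x.2) : pt) = dil (1 + h) x.
  exact: dilE.
by rewrite d_dil// mulrDl mul1r addrC addKr mulKf.
Unshelve. all: by end_near. Qed.

Lemma cont_d_powR a x : x != 0 -> {for x, continuous (fun y => d y `^ a)}.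
Proof.
move=> x0; apply: (@continuous_fun_comp R pt (fun s => s `^ a) d); last exact: d_cont.
by apply: powR_cont; exact: d_gt0.
Qed.

Lemma adm_d_powR a : adm (fun y => d y `^ a).
Proof. by apply: adm_cont => x; exact: cont_d_powR. Qed.

Lemma d_powR_is_derive a x v : x.1 != 0 ->
  is_derive x v (fun y => d y `^ a) (a * d x `^ a * (d x `^ (-1) * 'D_v d x)).
Proof.
move=> x0; have dx := d_gt0 (fst_neq0 x0).
have := is_derive_fun_comp (is_derive_powR a dx) (d_is_derive v x0).
rewrite powRB ?(gt_eqF dx) ?implybT// powRr1 ?ltW// powRN powRr1 ?ltW//.
by rewrite !mulrA.
Qed.

Lemma cont_derive_d v x : x.1 != 0 -> {for x, continuous ('D_v d)}.
Proof. by move=> x0; have [_] := d_C1 x0 v. Qed.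

Lemma adm_coord j : adm (fun x : pt => x.1 0 j).
Proof. by apply: adm_cont => x _; exact: continuous_coord. Qed.

Lemma adm_snd : adm (fun x : pt => x.2).
Proof. by apply: adm_cont => x _; exact: continuous_snd. Qed.

Lemma cont_Bmul j x : {for x, continuous (fun x : pt => Bmul B x.1 0 j)}.
Proof.
rewrite (_ : (fun x : pt => _) = fun x : pt => \sum_k B j k * x.1 0 k).
  by apply: continuous_fun_sum => k; apply: (@continuous_funZ R pt); exact: continuous_coord.
by apply/funext => y; rewrite BmulE; apply: eq_bigr => k _; rewrite mulrC.
Qed.

Lemma adm_Bmul j : adm (fun x : pt => Bmul B x.1 0 j).
Proof. by apply: adm_cont => x _; exact: cont_Bmul. Qed.

Lemma adm_dt : adm (dt d).
Proof.
split; first by move=> x; exact: cont_derive_d.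
case: reg => _ _ H _ x0 /H [r [r0 [C HC]]]; exists C.
apply/nbhs_ballP; exists r => //= x xr /eqP x1; by have [] := HC x xr x1.
Qed.

Lemma cont_Xf j x : x.1 != 0 -> {for x, continuous (Xf B j d)}.
Proof.
move=> x0; apply: continuous_funD; first exact: cont_derive_d.
apply: continuous_funM; last exact: cont_derive_d.
by apply: (@continuous_funZ R pt); exact: cont_Bmul.
Qed.

Lemma adm_Xf j : adm (Xf B j d).
Proof.
split; first by move=> x; exact: cont_Xf.
case: reg => _ _ H _ x0 /H [r [r0 [C HC]]]; exists C.
apply/nbhs_ballP; exists r => //= x xr /eqP x1; have [h _] := HC x xr x1.
by have := h j; rewrite mxE.
Qed.

(** Condition (d.2) bounds [X_j d] and [D_t d]; the Euclidean derivative is recovered from these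
    two. *)
Lemma adm_dz j : adm (dz d j).
Proof.
rewrite (_ : dz d j = fun x => Xf B j d x + (-1) * (2^-1 * Bmul B x.1 0 j * dt d x)).
  apply: admD (adm_Xf j) _; apply: admZ; apply: admM adm_dt; apply: admZ; exact: adm_Bmul.
by apply/funext => x; rewrite /Xf; ring.
Qed.

End RegularHomogeneous.

Lemma ZdE (R : realType) m (B : 'M[R]_m) p theta (d : pt R m -> R) x i :
  Zd B p theta d x 0 i = (m%:R + 2) / m%:R / d x * x.1 0 i
    - 4 * p * theta / m%:R * x.2 / d x ^+ 2 * \sum_k invmx B i k * Xf B k d x.
Proof.
have E (a c : R) (v w : 'rV[R]_m) : (a *: v - c *: w) 0 i = a * v 0 i - c * w 0 i.
  by rewrite !mxE.
rewrite /Zd E BinvE; congr (_ - _ * _).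
by apply: eq_bigr => k _; rewrite mxE.
Qed.

(** * The weighted Hardy inequality *)

Section HardyInequality.
Context {R : realType} {m : nat}.
Variables (B : 'M[R]_m) (p theta : R) (d : pt R m -> R).
Local Notation pt := (pt R m).
Local Notation E j := ((ebase R j, 0) : pt).
Local Notation T := ((0, 1) : pt).
Hypothesis m_gt0 : (0 < m)%N.
Hypothesis Bskew : B^T = - B.
Hypothesis Binj : forall v : 'cV[R]_m, B *m v = 0 -> v = 0.
Hypothesis p2 : 2 <= p.
Let p_gt0 : 0 < p. Proof. have := p2; lra. Qed.
Let p_ge0 : 0 <= p. Proof. have := p2; lra. Qed.
Let pm2_ge0 : 0 <= p - 2. Proof. have := p2; lra. Qed.
Let p_neq0 : p != 0. Proof. by rewrite gt_eqF. Qed.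
Hypothesis reg : regular_hom B d.
Variable u : pt -> R.
Hypothesis su : smooth_on setT u.
Variable K : set pt.
Hypothesis cK : compact K.
Hypothesis K0 : ~ K 0.
Hypothesis uK : forall x, ~ K x -> u x = 0.

Let C := invmx B.
Let f x := d x `^ (- (p * theta)).
Let b (x : pt) i := Bmul B x.1 0 i.
Let phi x := `|u x| `^ p.
Let w x := om p (u x).
Let w' x := p * (p - 1) * `|u x| `^ (p - 2).

(* [sum_j D_j (psi j) + D_t psit] is the remainder [H] of the tangent inequality: see [H_formula]. *)
Let psi j x := (4 / m%:R) * (f x * x.2 * (\sum_i C i j * (w x * Xf B i u x))) + f x * phi x * x.1 0 j.
Let psit x := (2 / m%:R) * (f x * x.2 * (\sum_i x.1 0 i * (w x * Xf B i u x)))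
  + 2 * (x.2 * f x * phi x).

Let u_der x v : is_derive x v u ('D_v u x).
Proof. by apply/derivableP; apply: smoothT_derivable; exact: su. Qed.

Let uu_der x v v' : is_derive x v' ('D_v u) ('D_v' ('D_v u) x).
Proof. by apply/derivableP; apply: smoothT_derivable; exact: smooth_derive. Qed.

Let u_cont x : {for x, continuous u}.
Proof. exact: smoothT_cont. Qed.

Let du_cont v x : {for x, continuous ('D_v u)}.
Proof. by apply: smoothT_cont; exact: smooth_derive. Qed.

Let ddu_cont v v' x : {for x, continuous ('D_v' ('D_v u))}.
Proof. by apply: smoothT_cont; apply: smooth_derive; exact: smooth_derive. Qed.

Let Xu_cont i x : {for x, continuous (Xf B i u)}.
Proof.
apply: continuous_funD; first exact: du_cont.
by apply: continuous_funM; [apply: (@continuous_funZ R pt); exact: cont_Bmul|exact: du_cont].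
Qed.

Let phi_cont x : {for x, continuous phi}.
Proof. by apply: (@continuous_fun_comp R pt (fun s => `|s| `^ p) u) => //; exact: abs_powR_cont. Qed.

Let w_cont x : {for x, continuous w}.
Proof. by apply: (@continuous_fun_comp R pt (om p) u) => //; exact: om_cont. Qed.

Let w'_cont x : {for x, continuous w'}.
Proof.
apply: (@continuous_funZ R pt); apply: (@continuous_fun_comp R pt (fun s => `|s| `^ (p - 2)) u) => //.
exact: abs_powR_cont.
Qed.

Let f_cont x : x != 0 -> {for x, continuous f}.
Proof. exact: (cont_d_powR reg). Qed.

Lemma psi_cont j x : x != 0 -> {for x, continuous (psi j)}.
Proof.
move=> x0; apply: continuous_funD.
  apply: (@continuous_funZ R pt); apply: continuous_funM.
    by apply: continuous_funM; [exact: f_cont|exact: continuous_snd].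
  apply: continuous_fun_sum => i; apply: (@continuous_funZ R pt).
  by apply: continuous_funM; [exact: w_cont|exact: Xu_cont].
by apply: continuous_funM; [apply: continuous_funM; [exact: f_cont|exact: phi_cont]|exact: continuous_coord].
Qed.

Lemma psit_cont x : x != 0 -> {for x, continuous psit}.
Proof.
move=> x0; apply: continuous_funD.
  apply: (@continuous_funZ R pt); apply: continuous_funM.
    by apply: continuous_funM; [exact: f_cont|exact: continuous_snd].
  apply: continuous_fun_sum => i; apply: continuous_funM; first exact: continuous_coord.
  by apply: continuous_funM; [exact: w_cont|exact: Xu_cont].
apply: (@continuous_funZ R pt).
by apply: continuous_funM; [apply: continuous_funM; [exact: continuous_snd|exact: f_cont]|exact: phi_cont].
Qed.

Let phi0 x : ~ K x -> phi x = 0.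
Proof. by move=> nK; rewrite /phi uK// normr0 powR0. Qed.

Let w0 x : ~ K x -> w x = 0.
Proof. by move=> nK; rewrite /w /om uK// mulr0 mulr0. Qed.

Lemma psi0 j x : ~ K x -> psi j x = 0.
Proof.
move=> nK; rewrite /psi phi0// big1 ?mulr0 ?mul0r ?addr0// => i _.
by rewrite w0// mul0r mulr0.
Qed.

Lemma psit0 x : ~ K x -> psit x = 0.
Proof.
move=> nK; rewrite /psit phi0// big1 ?mulr0 ?mul0r ?addr0// => i _.
by rewrite w0// mul0r mulr0.
Qed.

Let fv v x := - (p * theta) * f x * (d x `^ (-1) * 'D_v d x).

Let f_der x v : x.1 != 0 -> is_derive x v f (fv v x).
Proof. exact: (d_powR_is_derive reg). Qed.

Let DXu v i x := 'D_v (dz u i) x + 2^-1 * (Bmul B v.1 0 i * dt u x + b x i * 'D_v (dt u) x).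

Let Bmul_der x v i : is_derive x v (fun y : pt => Bmul B y.1 0 i) (Bmul B v.1 0 i).
Proof.
apply: (@is_derive_linear R m (fun y : pt => Bmul B y.1 0 i)) => s y /=.
rewrite !BmulE mulr_sumr -big_split /=; apply: eq_bigr => k _.
by rewrite !mxE; ring.
Qed.

Let Xu_der x v i : is_derive x v (Xf B i u) (DXu v i x).
Proof.
have := is_derive_funD (uu_der x (E i) v)
  (is_derive_funM (is_derive_funZ 2^-1 (Bmul_der x v i)) (uu_der x T v)).
by rewrite -!mulrA -mulrDr.
Qed.

Let phi_der x v : is_derive x v phi (w x * 'D_v u x).
Proof. exact: (is_derive_fun_comp (is_derive_abs_powR (u x) p2) (u_der x v)). Qed.

Let w_der x v : is_derive x v w (w' x * 'D_v u x).
Proof. exact: (is_derive_fun_comp (is_derive_om (u x) p2) (u_der x v)). Qed.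

Let gpsi j x := (4 / m%:R) * (fv (E j) x * x.2 * (\sum_i C i j * (w x * Xf B i u x))
            + f x * x.2 * (\sum_i C i j * (w' x * dz u j x * Xf B i u x + w x * DXu (E j) i x)))
          + (fv (E j) x * phi x * x.1 0 j + f x * (w x * dz u j x) * x.1 0 j + f x * phi x).

Let gpsit x := (2 / m%:R) * (fv T x * x.2 * (\sum_i x.1 0 i * (w x * Xf B i u x))
     + f x * (\sum_i x.1 0 i * (w x * Xf B i u x))
     + f x * x.2 * (\sum_i x.1 0 i * (w' x * dt u x * Xf B i u x + w x * DXu T i x)))
   + 2 * (f x * phi x + x.2 * fv T x * phi x + x.2 * f x * (w x * dt u x)).

Lemma psi_der j x : x.1 != 0 -> is_derive x (E j) (psi j) (gpsi j x).
Proof.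
move=> x0.
apply: (is_derive_cast (is_derive_funD (is_derive_funZ (4 / m%:R)
   (is_derive_funM (is_derive_funM (f_der (E j) x0) (is_derive_snd x (E j)))
   (is_derive_fun_sum (fun i => is_derive_funZ (C i j) (is_derive_funM (w_der x (E j)) (Xu_der x (E j) i))))))
   (is_derive_funM (is_derive_funM (f_der (E j) x0) (phi_der x (E j))) (is_derive_coord j x (E j))))).
have -> : (E j).2 = 0 by [].
have -> : (E j).1 0 j = 1 by rewrite mxE eqxx.
by rewrite mulr0 addr0 mulr1 [X in _ + (X + _)]mulrDl.
Qed.

Lemma psit_der x : x.1 != 0 -> is_derive x T psit (gpsit x).
Proof.
move=> x0.
apply: (is_derive_cast (is_derive_funD (is_derive_funZ (2 / m%:R)
   (is_derive_funM (is_derive_funM (f_der T x0) (is_derive_snd x T))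
   (is_derive_fun_sum (fun i => is_derive_funM (is_derive_coord i x T)
     (is_derive_funM (w_der x T) (Xu_der x T i))))))
   (is_derive_funZ 2 (is_derive_funM (is_derive_funM (is_derive_snd x T) (f_der T x0)) (phi_der x T))))).
have -> : T.2 = 1 by [].
rewrite /gpsit; congr (_ * _ + 2 * _); last by rewrite mul1r [X in X + _]mulrDl.
rewrite mulr1 mulrDl; congr (_ + _ * _).
apply: eq_bigr => i _; have -> : T.1 0 i = 0 by rewrite mxE.
by rewrite mul0r add0r.
Qed.

Let adm_c g : (forall x : pt, {for x, continuous g}) -> adm g.
Proof. by move=> cg; apply: adm_cont. Qed.

Let adm_f : adm f. Proof. exact: (adm_d_powR reg). Qed.
Let adm_w : adm w. Proof. exact: adm_c. Qed.
Let adm_w' : adm w'. Proof. exact: adm_c. Qed.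
Let adm_phi : adm phi. Proof. exact: adm_c. Qed.
Let adm_X i : adm (Xf B i u). Proof. exact: adm_c. Qed.
Let adm_du v : adm ('D_v u). Proof. by apply: adm_c => x; exact: du_cont. Qed.
Let adm_ddu v v' : adm ('D_v ('D_v' u)). Proof. by apply: adm_c => x; exact: ddu_cont. Qed.
Let adm_DXu v i : adm (DXu v i).
Proof.
apply: admD; first exact: adm_ddu.
apply: admZ; apply: admD; first by apply: admZ; exact: adm_du.
by apply: admM; [exact: adm_Bmul|exact: adm_ddu].
Qed.
Let adm_fvE j : adm (fv (E j)).
Proof.
apply: admM; first by apply: admZ; exact: adm_f.
by apply: admM; [exact: (adm_d_powR reg)|exact: adm_dz reg j].
Qed.
Let adm_fvT : adm (fv T).
Proof.
apply: admM; first by apply: admZ; exact: adm_f.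
by apply: admM; [exact: (adm_d_powR reg)|exact: adm_dt reg].
Qed.

Ltac adm_solve := lazymatch goal with
  | |- adm (fun x => @?a x + @?b x) => apply (@admD _ _ a b); adm_solve
  | |- adm (fun x => @?a x * @?b x) => apply (@admM _ _ a b); adm_solve
  | |- adm (fun x => \sum_i @?a i x) =>
      apply (@adm_sum _ _ _ (fun i x => a i x)); intros ?; cbv beta; adm_solve
  | |- adm (fun x => snd x) => exact adm_snd
  | |- adm (fun x => Xf _ ?i _ x) => exact (adm_X i)
  | |- adm (fun x => DXu ?v ?i x) => exact (adm_DXu v i)
  | |- adm (fun x => fv (ebase _ ?j, _) x) => exact (adm_fvE j)
  | |- adm (fun x => fv _ x) => exact adm_fvT
  | |- adm (fun x => f x) => exact adm_f
  | |- adm (fun x => phi x) => exact adm_phi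
  | |- adm (fun x => w x) => exact adm_w
  | |- adm (fun x => w' x) => exact adm_w'
  | |- adm (fun x => dz u ?j x) => exact (adm_du (E j))
  | |- adm (fun x => dt u x) => exact (adm_du T)
  | |- adm (fun x => fun_of_matrix (fst x) _ ?j) => exact (adm_coord j)
  | _ => exact (adm_cst _)
  end.

Lemma adm_gpsi j : adm (gpsi j).
Proof. by unfold gpsi; adm_solve. Qed.

Lemma adm_gpsit : adm gpsit.
Proof. by unfold gpsit; adm_solve. Qed.

Let H x := \sum_j gpsi j x + gpsit x.

Variable M : R.
Hypothesis M0 : 0 <= M.
Hypothesis KM : forall x, M < `|x| -> ~ K x.

(** The derivative of [psi j] is taken along the [j]-th axis, which leaves another coordinate of [z]
    fixed; that of [psit] is taken along [t], which fixes all of them. *)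
Lemma nullint_H : nullint M H.
Proof.
apply: nullintD => //.
  apply: nullint_sum => // j.
  have [i ji] := other_coord m_gt0 Bskew Binj j.
  apply: (@nullint_derive R m m_gt0 K M cK K0 M0 KM (psi j) (gpsi j) (E j) i) => //.
  - exact: psi_cont.
  - exact: psi0.
  - exact: adm_gpsi.
  - exact: psi_der.
apply: (@nullint_derive R m m_gt0 K M cK K0 M0 KM psit gpsit T (Ordinal m_gt0)) => //.
- exact: psit_cont.
- exact: psit0.
- exact: adm_gpsit.
- by rewrite mxE.
- exact: psit_der.
Qed.

Let mR : m%:R != 0 :> R. Proof. by rewrite pnatr_eq0 -lt0n. Qed.

Let dd_sym v v' x : 'D_v' ('D_v u) x = 'D_v ('D_v' u) x.
Proof.
apply: (@schwarz R pt u x v v').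
- by move=> y; apply: smoothT_derivable; exact: su.
- by move=> y; apply: smoothT_derivable; exact: su.
- by move=> y; apply: smoothT_derivable; exact: smooth_derive.
- by move=> y; apply: smoothT_derivable; exact: smooth_derive.
- exact: ddu_cont.
- exact: ddu_cont.
Qed.

Lemma H_formula x : x.1 != 0 ->
  H x = w x * dotr (gradG B u x) (Zd B p theta d x) * d x `^ (1 - p * theta)
       + (m%:R + 2 - p * theta) * (phi x * f x).
Proof.
move=> x0; have dx := d_gt0 reg (fst_neq0 x0).
have CB i k : \sum_j C i j * B j k = (i == k)%:R by exact: invB_B.
have := @divergence_identity R m C B (invB_anti Bskew Binj) CB (B_anti Bskew)
  (x.1 0) (b x) (fun i => dz u i x) (fun i => Xf B i u x) (fun j => fv (E j) x)
  (fun j => 'D_(E j) (dt u) x) (fun j i => 'D_(E i) (dz u j) x)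
  (fun j i => DXu (E j) i x) (fun i => DXu T i x)
  x.2 (dt u x) ('D_T (dt u) x) (f x) (fv T x) (phi x) (w x) (w' x) (p * theta).
rewrite -/(gpsi) /H => D; rewrite {}D.
- congr (_ + _); rewrite -[RHS]mulrA; congr (_ * _).
  rewrite /dotr mulr_suml; apply: eq_bigr => i _.
  rewrite /gradG mxE -[RHS]mulrA; congr (_ * _).
  rewrite ZdE.
  have fE : d x `^ (1 - p * theta) = d x * f x.
    by rewrite powRD ?(gt_eqF dx) ?implybT// powRr1 ?ltW.
  have di : d x `^ (-1) = (d x)^-1 by rewrite powRN powRr1// ltW.
  (* This is [B^-1] applied to the horizontal gradient of [d^(-p theta)]; it produces the second
     term of [Z_d]. *)
  have -> : \sum_j C i j * (fv (E j) x + 2^-1 * b x j * fv T x) =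
    - (p * theta) * f x / d x * \sum_k invmx B i k * Xf B k d x.
    rewrite mulr_sumr; apply: eq_bigr => j _.
    by rewrite /C /b /Xf /fv di /dz /dt; ring.
  rewrite fE /C; set s := \sum_k _; field; rewrite mR gt_eqF//.
- by move=> i; exact: invB_Bmul.
- exact: dot_Bmul.
- by move=> i; rewrite /Xf.
- by move=> i j; exact: dd_sym.
- move=> j i; have bm : Bmul B (E j).1 0 i = B i j.
    rewrite BmulE (bigD1 j)//= big1 ?addr0; first by rewrite mxE eqxx mul1r.
    by move=> k kj; rewrite mxE eq_sym (negbTE kj) mul0r.
  have sw : 'D_(E j) (dz u i) x = 'D_(E i) (dz u j) x by exact: dd_sym.
  by rewrite /DXu sw bm.
- move=> i; have bm : Bmul B T.1 0 i = 0.
    by rewrite BmulE big1// => k _; rewrite mxE mul0r.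
  have sw : 'D_T (dz u i) x = 'D_(E i) (dt u) x by exact: dd_sym.
  by rewrite /DXu sw bm mul0r add0r.
- have e := euler_d reg x0; rewrite /fv.
  have -> : \sum_j x.1 0 j * (- (p * theta) * f x * (d x `^ (-1) * 'D_(E j) d x)) =
     - (p * theta) * f x * d x `^ (-1) * \sum_j x.1 0 j * 'D_(E j) d x.
    by rewrite mulr_sumr; apply: eq_bigr => j _; ring.
  have di : d x `^ (-1) = (d x)^-1 by rewrite powRN powRr1// ltW.
  have -> : \sum_j x.1 0 j * 'D_(E j) d x = d x - 2 * x.2 * 'D_T d x by rewrite -[in RHS]e; ring.
  by rewrite di; field; rewrite gt_eqF.
- exact: m_gt0.
Qed.

Let kappa := (m%:R + 2 - p * theta) / p.
Let F x := `|dotr (gradG B u x) (Zd B p theta d x)| `^ p / d x `^ (p * (theta - 1)).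
Let G x := `|u x| `^ p / d x `^ (p * theta).

Lemma adm_dotZ : adm (fun x => dotr (gradG B u x) (Zd B p theta d x)).
Proof.
rewrite (_ : (fun x => _) = fun x => \sum_i Xf B i u x *
   ((m%:R + 2) / m%:R * (d x `^ (-1) * x.1 0 i)
     + (-1) * (4 * p * theta / m%:R * (x.2 * d x `^ (-2)) * \sum_k C i k * Xf B k d x))).
  apply: adm_sum => i; apply: admM => //; apply: admD.
    by apply: admZ; apply: admM; [exact: (adm_d_powR reg)|exact: adm_coord].
  apply: admZ; apply: admM.
    by apply: admZ; apply: admM; [exact: adm_snd|exact: (adm_d_powR reg)].
  by apply: adm_sum => k; apply: admZ; exact: adm_Xf.
apply/funext => x; apply: eq_bigr => i _; rewrite /gradG mxE; congr (_ * _).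
(* The two functions must agree at every point, so the origin is included; homogeneity with factor
   [2] forces [d 0 = 0]. *)
have d0 : 0 <= d x.
  have [->|x0] := eqVneq x 0; last exact: ltW (d_gt0 reg x0).
  have H0 := @d_dil _ _ _ _ reg 2 0 (ltr0Sn _ 1); rewrite /dil scaler0 mulr0 in H0.
  suff -> : d 0 = 0 by [].
  have H1 : d 0 = 2 * d 0 by exact: H0.
  by lra.
rewrite ZdE powRN powRr1// powRN -[2 in X in _ = _ + _ * (_ * (_ * X) * _)]/(2%:R) (powR_mulrn 2 d0).
by rewrite /C; set s := \sum_k _; ring.
Qed.

Lemma hardy_pointwise x : x.1 != 0 ->
  `|kappa| `^ p * G x + - (om p kappa / p) * H x <= F x.
Proof.
move=> x0; have dx := d_gt0 reg (fst_neq0 x0).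
rewrite H_formula//.
pose A := dotr (gradG B u x) (Zd B p theta d x) * d x `^ (1 - theta).
pose A' := - (kappa * u x * d x `^ (- theta)).
have := @abs_powR_ge_tangent R A A' p p2.
have FA : `|A| `^ p = F x.
  rewrite /A normrM powRM// [`|d x `^ _|]ger0_norm ?powR_ge0// -powRrM /F.
  by rewrite -powRN; congr (_ * _ `^ _); ring.
have GA : `|A'| `^ p = `|kappa| `^ p * G x.
  rewrite /A' normrN !normrM !powRM ?mulr_ge0// [`|d x `^ _|]ger0_norm ?powR_ge0//.
  by rewrite -powRrM mulNr powRN [theta * p]mulrC /G mulrA.
have pk : m%:R + 2 - p * theta = p * kappa by rewrite /kappa [RHS]mulrC divfK.
rewrite FA GA => H1; apply: le_trans H1; rewrite lerD2l pk.
(* [om p] is odd and positively homogeneous of degree [p - 1]. *)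
have omA : om p A' = - (om p kappa / p * w x * d x `^ (- theta * (p - 1))).
  rewrite /om /w /om /A' normrN !normrM !powRM ?mulr_ge0// [`|d x `^ _|]ger0_norm ?powR_ge0//.
  rewrite -powRrM (_ : - theta * (p - 1) = - theta * (p - 2) + - theta); last by ring.
  rewrite [d x `^ (_ + _)]powRD ?(gt_eqF dx) ?implybT//.
  by field.
rewrite omA.
have e1 : d x `^ (1 - p * theta) = d x `^ (- theta * (p - 1)) * d x `^ (1 - theta).
  by rewrite -powRD ?(gt_eqF dx) ?implybT//; congr (_ `^ _); ring.
have e2 : f x = d x `^ (- theta * (p - 1)) * d x `^ (- theta).
  by rewrite -powRD ?(gt_eqF dx) ?implybT//; congr (_ `^ _); ring.
have e3 : w x * u x = p * phi x by exact: om_mul.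
rewrite e1 e2 /A /A'.
set z0 := dotr _ _; set a := d x `^ (- theta * _); set a1 := d x `^ (1 - theta); set a2 := d x `^ (- theta).
rewrite le_eqVlt; apply/orP; left; apply/eqP.
rewrite (_ : p * kappa * (phi x * (a * a2)) = kappa * (w x * u x) * (a * a2)); last by rewrite e3; ring.
by ring.
Qed.

Let F_adm : adm F.
Proof.
rewrite (_ : F = fun x => `|dotr (gradG B u x) (Zd B p theta d x)| `^ p * d x `^ (- (p * (theta - 1)))).
  apply: admM; last exact: (adm_d_powR reg).
  by apply: adm_abs_powR => //; exact: adm_dotZ.
by apply/funext => x; rewrite powRN.
Qed.

Let G_adm : adm G.
Proof.
rewrite (_ : G = fun x => `|u x| `^ p * d x `^ (- (p * theta))).
  by apply: admM; [exact: adm_phi|exact: (adm_d_powR reg)].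
by apply/funext => x; rewrite powRN.
Qed.

Lemma gradG_notK x : ~ K x -> gradG B u x = 0.
Proof.
move=> nK; have D0 v : 'D_v u x = 0.
  rewrite -(@near_eq_derive R _ _ (cst 0) u x v); first exact: derive_cst.
  by apply: filterS (near_notK cK nK) => y ny; rewrite uK.
by apply/rowP => i; rewrite !mxE /Xf /dz /dt !D0 mulr0 addr0.
Qed.

Lemma F_notK x : ~ K x -> F x = 0.
Proof.
move=> nK; rewrite /F gradG_notK// /dotr big1 ?normr0 ?powR0 ?mul0r//.
by move=> i _; rewrite mxE mul0r.
Qed.

Lemma G_notK x : ~ K x -> G x = 0.
Proof. by move=> nK; rewrite /G uK// normr0 powR0// mul0r. Qed.

Lemma F_ggood : exists2 L, 0 <= L & ggood M L F.
Proof. by apply: (adm_ggood cK K0 KM F_adm) => x _; exact: F_notK. Qed.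

Lemma G_ggood : exists2 L, 0 <= L & ggood M L G.
Proof. by apply: (adm_ggood cK K0 KM G_adm) => x _; exact: G_notK. Qed.

Lemma lhs_Gr : lhs_int B p theta d u = (Gr F)%:E.
Proof. by have [L L0 gL] := F_ggood; exact: (Gint_Gr m_gt0 M0 L0 gL). Qed.

Lemma rhs_Gr : rhs_int p theta d u = (Gr G)%:E.
Proof. by have [L L0 gL] := G_ggood; exact: (Gint_Gr m_gt0 M0 L0 gL). Qed.

Lemma hardy_inequality :
  (lhs_int B p theta d u >= (`|kappa| `^ p)%:E * rhs_int p theta d u)%E.
Proof.
rewrite lhs_Gr rhs_Gr -EFinM lee_fin.
have [L L0 gF] := F_ggood; have [L' L'0 gG] := G_ggood.
have [L'' L''0 [gH H0]] := nullint_H.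
have g1 := ggoodZ (`|kappa| `^ p) gG.
have g2 := ggoodZ (- (om p kappa / p)) gH.
rewrite -(GrZ m_gt0 _ M0 L'0 gG).
(* The multiple of [H] in the pointwise bound is inserted under the integral at no cost, its
   integral being zero. *)
rewrite -[leLHS]addr0 -(mulr0 (- (om p kappa / p))) -H0 -(GrZ m_gt0 _ M0 L''0 gH).
rewrite -(GrD m_gt0 M0 _ _ g1 g2) ?mulr_ge0//.
apply: (Gr_le m_gt0 M0 _ L0 (ggoodD g1 g2) gF); first by rewrite addr_ge0 ?mulr_ge0.
exact: hardy_pointwise.
Qed.

End HardyInequality.

(** * The orthogonal case: functions of [t] and [|z|^2], and the extremal *)

Section Radial.
Context {R : realType} {m : nat}.
Variables (B : 'M[R]_m) (p theta : R) (d : pt R m -> R).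
Local Notation pt := (pt R m).
Local Notation E j := ((ebase R j, 0) : pt).
Local Notation T := ((0, 1) : pt).
Hypothesis m_gt0 : (0 < m)%N.
Hypothesis Bskew : B^T = - B.
Hypothesis Binj : forall v : 'cV[R]_m, B *m v = 0 -> v = 0.
Hypothesis reg : regular_hom B d.
Hypothesis orth : forall x : pt, x != 0 -> dotr x.1 (Binv B (gradz d x)) = 0.
Implicit Types x : pt.

(** [B^-1] applied to the horizontal gradient is [B^-1 grad_z d + (1/2) D_t d z], and the
    orthogonality hypothesis removes the first term. *)
Lemma sum_z_BinvX x : x.1 != 0 ->
  \sum_i x.1 0 i * \sum_k invmx B i k * Xf B k d x = 2^-1 * dt d x * dotr x.1 x.1.
Proof.
move=> x0.
have H i : \sum_k invmx B i k * Xf B k d x = Binv B (gradz d x) 0 i + 2^-1 * dt d x * x.1 0 i.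
  rewrite BinvE -[x.1 0 i](invB_Bmul Bskew Binj) mulr_sumr -big_split /=.
  by apply: eq_bigr => k _; rewrite mxE /Xf; ring.
rewrite -[RHS]add0r -[X in _ = X + _](orth (fst_neq0 x0)) /dotr mulr_sumr -big_split /=.
by apply: eq_bigr => i _; rewrite H; ring.
Qed.

(** Skew-symmetry moves [B^-1] onto [B z], leaving minus the product of [z] with the horizontal
    gradient of [d], which Euler's identity evaluates. *)
Lemma sum_b_BinvX x : x.1 != 0 ->
  \sum_i Bmul B x.1 0 i * \sum_k invmx B i k * Xf B k d x = 2 * x.2 * dt d x - d x.
Proof.
move=> x0.
have -> : \sum_i Bmul B x.1 0 i * \sum_k invmx B i k * Xf B k d x =
    \sum_k - (x.1 0 k * Xf B k d x).
  under eq_bigr do rewrite mulr_sumr.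
  rewrite exchange_big /=; apply: eq_bigr => k _.
  rewrite -[in RHS](invB_Bmul Bskew Binj) mulr_suml -sumrN.
  by apply: eq_bigr => i _; rewrite (invB_anti Bskew Binj i k); ring.
rewrite sumrN -[in RHS](euler_d reg x0).
have -> : \sum_k x.1 0 k * Xf B k d x = \sum_k x.1 0 k * 'D_(E k) d x
     + 2^-1 * dt d x * \sum_k x.1 0 k * Bmul B x.1 0 k.
  by rewrite mulr_sumr -big_split /=; apply: eq_bigr => k _; rewrite /Xf /dz; ring.
by rewrite (dot_Bmul Bskew) mulr0 /dt; ring.
Qed.

(** Here [a] stands for the derivative of [u] with respect to [|z|^2]. *)
Lemma dotZ_radial (u : pt -> R) x (a c : R) : x.1 != 0 ->
  (forall i, dz u i x = 2 * a * x.1 0 i) -> dt u x = c ->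
  dotr (gradG B u x) (Zd B p theta d x) =
    2 * (m%:R + 2) / m%:R / d x * (a * dotr x.1 x.1)
    - 4 * p * theta / m%:R * x.2 / d x ^+ 2
      * (a * dotr x.1 x.1 * dt d x - 2^-1 * c * (d x - 2 * x.2 * dt d x)).
Proof.
move=> x0 uz ut.
have S1 := sum_z_BinvX x0; have S2 := sum_b_BinvX x0; have S3 := dot_Bmul Bskew x.1.
have -> : dotr (gradG B u x) (Zd B p theta d x) =
    2 * a * ((m%:R + 2) / m%:R / d x) * dotr x.1 x.1
   + 2^-1 * c * ((m%:R + 2) / m%:R / d x) * (\sum_i x.1 0 i * Bmul B x.1 0 i)
   - (4 * p * theta / m%:R * x.2 / d x ^+ 2) * 2 * a *
      (\sum_i x.1 0 i * \sum_k invmx B i k * Xf B k d x)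
   - (4 * p * theta / m%:R * x.2 / d x ^+ 2) * 2^-1 * c *
      (\sum_i Bmul B x.1 0 i * \sum_k invmx B i k * Xf B k d x).
  rewrite /dotr !mulr_sumr -!sumrN -!big_split /=; apply: eq_bigr => i _.
  rewrite ZdE /gradG mxE /Xf uz ut.
  set s := \sum_k _; ring.
by rewrite S1 S2 S3; field; rewrite gt_eqF ?pnatr_eq0 -?lt0n ?(d_gt0 reg (fst_neq0 x0)).
Qed.

Lemma dotr_gt0 (z : 'rV[R]_m) : z != 0 -> 0 < dotr z z.
Proof.
move=> z0; have [i zi] : exists i, z 0 i != 0.
  apply: contrapT => nz; move/eqP: z0; apply; apply/rowP => i; rewrite mxE.
  by apply/eqP/negP => /negP ?; apply: nz; exists i.
rewrite /dotr (bigD1 i)//= ltr_pwDl//.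
  by rewrite -expr2 lt0r sqrf_eq0 zi sqr_ge0.
by apply: sumr_ge0 => j _; rewrite -expr2 sqr_ge0.
Qed.

Lemma is_derive_dotr x v : is_derive x v (fun y : pt => dotr y.1 y.1) (2 * dotr x.1 v.1).
Proof.
apply: (is_derive_cast (is_derive_fun_sum (fun i =>
  is_derive_funM (is_derive_coord i x v) (is_derive_coord i x v)))).
by rewrite /dotr mulr_sumr; apply: eq_bigr => i _; ring.
Qed.

Lemma is_derive_split (A W : R -> R) (A' W' : R) x v :
  is_derive x.2 1 A A' -> is_derive (dotr x.1 x.1) 1 W W' ->
  is_derive x v (fun y : pt => A y.2 * W (dotr y.1 y.1))
    (A' * v.2 * W (dotr x.1 x.1) + A x.2 * (W' * (2 * dotr x.1 v.1))).
Proof.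
move=> dA dW; apply: is_derive_funM; first
  exact: (@is_derive_fun_comp R pt A snd x v _ _ dA (is_derive_snd x v)).
exact: (@is_derive_fun_comp R pt W (fun y : pt => dotr y.1 y.1) x v _ _ dW (is_derive_dotr x v)).
Qed.

Lemma dotr_ebase (z : 'rV[R]_m) i : dotr z (ebase R i) = z 0 i.
Proof.
rewrite /dotr (bigD1 i)//= big1 ?addr0; first by rewrite mxE eqxx mulr1.
by move=> k ki; rewrite mxE eq_sym (negbTE ki) mulr0.
Qed.

Lemma dotr0 (z : 'rV[R]_m) : dotr z 0 = 0.
Proof. by rewrite /dotr big1// => k _; rewrite mxE mulr0. Qed.

Lemma dotr_ge0 (z : 'rV[R]_m) : 0 <= dotr z z.
Proof. by apply: sumr_ge0 => j _; rewrite -expr2 sqr_ge0. Qed.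

Lemma dotZ_split (A W : R -> R) (A' W' : R) x : x.1 != 0 ->
  is_derive x.2 1 A A' -> is_derive (dotr x.1 x.1) 1 W W' ->
  dotr (gradG B (fun y : pt => A y.2 * W (dotr y.1 y.1)) x) (Zd B p theta d x) =
    2 * (m%:R + 2) / m%:R / d x * (A x.2 * W' * dotr x.1 x.1)
    - 4 * p * theta / m%:R * x.2 / d x ^+ 2
      * (A x.2 * W' * dotr x.1 x.1 * dt d x
         - 2^-1 * (A' * W (dotr x.1 x.1)) * (d x - 2 * x.2 * dt d x)).
Proof.
move=> x0 dA dW; have D v := is_derive_split v dA dW; apply: dotZ_radial => //.
- move=> i; rewrite /dz (derive_eq_val (D (E i))) dotr_ebase /=; ring.
- by rewrite /dt (derive_eq_val (D T)) dotr0 /= !mulr0 addr0 mulr1.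
Qed.

Hypothesis p_gt0 : 0 < p.
Let kappa := (m%:R + 2 - p * theta) / p.
Let u0 x := (`|x.2| / (dotr x.1 x.1)) `^ (m%:R / (2 * p)).

(** [u0] is invariant under dilations, so the terms containing [D_t d] cancel. A general exponent
    [a] would give [- (2 a / m) (Q - p theta) u0 / d]; the choice [a = m / (2 p)] turns the factor
    into [kappa]. *)
Lemma extremal_dotZ x : x.1 != 0 -> x.2 != 0 ->
  dotr (gradG B u0 x) (Zd B p theta d x) = - (kappa * u0 x / d x).
Proof.
move=> x0 t0; have dx := d_gt0 reg (fst_neq0 x0).
have r0 := dotr_gt0 x0.
pose a := m%:R / (2 * p).
have u0E : u0 = fun y : pt => `|y.2| `^ a * dotr y.1 y.1 `^ (- a).
  apply/funext => y; rewrite /u0 powRM ?invr_ge0 ?dotr_ge0//.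
  by rewrite -[(dotr _ _)^-1]powR_inv1 ?dotr_ge0// -powRrM mulN1r.
rewrite u0E (dotZ_split x0 (is_derive_abs_powR_neq0 a t0) (is_derive_powR (- a) r0)).
have e1 : dotr x.1 x.1 `^ (- a - 1) * dotr x.1 x.1 = dotr x.1 x.1 `^ (- a).
  by rewrite powRB ?(gt_eqF r0) ?implybT// powRr1 ?ltW// divfK// gt_eqF.
have t_gt0 : 0 < `|x.2| by rewrite normr_gt0.
have e2 : `|x.2| `^ (a - 2) * (x.2 * x.2) = `|x.2| `^ a.
  rewrite (_ : x.2 * x.2 = `|x.2| * `|x.2|); last by rewrite -!expr2 real_normK// num_real.
  rewrite [X in _ = _ `^ X](_ : a = (a - 2) + 1 + 1); last by ring.
  by rewrite !powRD ?(gt_eqF t_gt0) ?implybT// powRr1 ?mulrA// ltW.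
have mR : m%:R != 0 :> R by rewrite pnatr_eq0 -lt0n.
set w := dotr x.1 x.1 `^ (- a) in e1 *; set w1 := dotr x.1 x.1 `^ (- a - 1) in e1 *.
set h1 := `|x.2| `^ (a - 2) in e2 *; set h := `|x.2| `^ a in e2 *.
have e3 : h * (- a * w1) * dotr x.1 x.1 = - (a * h * w) by rewrite -e1; ring.
rewrite e3.
have e4 : 4 * p * theta / m%:R * x.2 / d x ^+ 2 * (- (a * h * w) * dt d x
    - 2^-1 * (a * (h1 * x.2) * w) * (d x - 2 * x.2 * dt d x)) =
    - (2 * p * theta / m%:R * a * h * w / d x).
  by rewrite -e2; field; rewrite mR gt_eqF.
by rewrite e4 /kappa /a; field; rewrite mR !gt_eqF.
Qed.

Lemma extremal_equality :
  lhs_int B p theta d u0 = ((`|kappa| `^ p)%:E * rhs_int p theta d u0)%E.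
Proof.
rewrite /lhs_int /rhs_int.
have FG x : x.1 != 0 -> x.2 != 0 ->
    `|dotr (gradG B u0 x) (Zd B p theta d x)| `^ p / d x `^ (p * (theta - 1)) =
    `|kappa| `^ p * (`|u0 x| `^ p / d x `^ (p * theta)).
  move=> x0 t0; have dx := d_gt0 reg (fst_neq0 x0).
  rewrite extremal_dotZ// normrN (normrM (kappa * u0 x)) (normrM kappa) normfV (gtr0_norm dx).
  rewrite !powRM ?mulr_ge0 ?invr_ge0 ?(ltW dx)// -[(d x)^-1]powR_inv1 ?ltW// -powRrM mulN1r.
  rewrite -mulrA -powRN -mulrA -powRN -powRD ?(gt_eqF dx) ?implybT//.
  by congr (_ * (_ * _ `^ _)); ring.
(* A positive constant leaves the integral even if it is infinite. For [kappa = 0] the right side is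
   [0] by the convention for [0] times infinity, and the left integrand vanishes off a null set. *)
have [k0|k0] := eqVneq kappa 0; last first.
  have kp : 0 < `|kappa| `^ p by rewrite powR_gt0// normr_gt0.
  rewrite -(GintZ _ kp); last first.
    by move=> x; rewrite lee_fin divr_ge0 ?powR_ge0.
  by apply: (Gint_ae m_gt0) => x x0 t0; rewrite FG// EFinM.
rewrite k0 normr0 powR0 ?gt_eqF// mul0e.
have g0 : ggood 0 0 (fun _ : pt => 0 : R).
  by move=> x x0; split => //; [rewrite normr0|exact: continuous_fun_cst].
have z0 : Gint (fun _ : pt => (0 : R)%:E) = 0%E.
  rewrite (Gint_Gr m_gt0 (lexx 0) (lexx 0) g0); congr EFin.
  have := @GrZ R m m_gt0 0 0 0 (fun=> 0) (lexx _) (lexx _) g0.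
  move=> H; rewrite -[RHS](mul0r (Gr (fun _ : pt => 0 : R))) -H.
  by congr Gr; apply/funext => x; rewrite mul0r.
rewrite -z0; apply: (Gint_ae m_gt0) => x x0 t0.
by rewrite FG// k0 normr0 powR0 ?gt_eqF// mul0r.
Qed.

End Radial.

(** * Smooth functions with explicit derivatives, and bumps *)

Section SmoothClass.
Context {R : realType}.

(** Unlike [Ck], it asks for some function that is the derivative, so closure under products and
    composition follows by exhibiting a formula; [Cn_Ck] converts back. *)
Fixpoint Cn {V : normedModType R} (k : nat) (f : V -> R) : Prop :=
  match k with
  | 0%N => forall x, {for x, continuous f}
  | k'.+1 => (forall x, {for x, continuous f}) /\
      forall v, exists2 g, (forall x, is_derive x v f (g x)) & Cn k' g
  end.

Section Closure.
Context {V : normedModType R}.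
Implicit Types (f g : V -> R) (x v : V).

Lemma CnW k f : Cn k.+1 f -> Cn k f.
Proof.
elim: k f => [|k IH] f [cf H]; first exact: cf.
by split=> // v; have [g dg /IH cg] := H v; exists g.
Qed.

Lemma Cn_cst k (c : R) : Cn k (fun _ : V => c).
Proof.
elim: k c => [|k IH] c; first by move=> x; exact: continuous_fun_cst.
split; first by move=> x; exact: continuous_fun_cst.
by move=> v; exists (fun=> 0) => // x; exact: is_derive_fun_cst.
Qed.

Lemma CnD k f g : Cn k f -> Cn k g -> Cn k (fun x => f x + g x).
Proof.
elim: k f g => [|k IH] f g; first by move=> cf cg x; exact: continuous_funD (cf x) (cg x).
move=> [cf Hf] [cg Hg]; split; first by move=> x; exact: continuous_funD (cf x) (cg x).
move=> v; have [f' df cf'] := Hf v; have [g' dg cg'] := Hg v.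
by exists (fun x => f' x + g' x); [move=> x; exact: is_derive_funD|exact: IH].
Qed.

Lemma CnM k f g : Cn k f -> Cn k g -> Cn k (fun x => f x * g x).
Proof.
elim: k f g => [|k IH] f g; first by move=> cf cg x; exact: continuous_funM (cf x) (cg x).
move=> Hf' Hg'; have [cf Hf] := Hf'; have [cg Hg] := Hg'.
split; first by move=> x; exact: continuous_funM (cf x) (cg x).
move=> v; have [f' df cf'] := Hf v; have [g' dg cg'] := Hg v.
exists (fun x => f' x * g x + f x * g' x); first by move=> x; exact: is_derive_funM.
by apply: CnD; apply: IH => //; exact: CnW.
Qed.

Lemma CnZ k (c : R) f : Cn k f -> Cn k (fun x => c * f x).
Proof. by move=> cf; apply: CnM => //; exact: Cn_cst. Qed.

Lemma Cn_sum k (J : finType) (F : J -> V -> R) : (forall i, Cn k (F i)) ->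
  Cn k (fun x => \sum_i F i x).
Proof.
move=> aF; elim: (index_enum J) => [|i s IH].
  rewrite (_ : (fun y => _) = fun=> 0); first exact: Cn_cst.
  by apply/funext => y; rewrite big_nil.
rewrite (_ : (fun y => _) = fun y => F i y + \sum_(j <- s) F j y); first exact: CnD.
by apply/funext => y; rewrite big_cons.
Qed.

Lemma Cn_const_derive k f (l : V -> R) : (forall x v, is_derive x v f (l v)) ->
  (forall x, {for x, continuous f}) -> Cn k f.
Proof.
move=> df cf; case: k => [//|k]; split=> // v.
by exists (fun=> l v) => //; exact: Cn_cst.
Qed.

End Closure.

Lemma Cn_comp {V : normedModType R} k (h : R -> R) (f : V -> R) :
  Cn k h -> Cn k f -> Cn k (fun x => h (f x)).
Proof.
elim: k h f => [|k IH] h f; first by move=> ch cf x; exact: continuous_fun_comp (ch _) (cf x).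
move=> Hh' Hf'; have [ch Hh] := Hh'; have [cf Hf] := Hf'.
split; first by move=> x; exact: continuous_fun_comp (ch _) (cf x).
move=> v; have [h' dh ch'] := Hh 1; have [f' df cf'] := Hf v.
exists (fun x => h' (f x) * f' x); first by move=> x; exact: is_derive_fun_comp.
by apply: CnM => //; apply: IH => //; exact: CnW.
Qed.

Lemma is_derive_scale (f : R -> R) (x v l : R) :
  is_derive x 1 f l -> is_derive x v f (v * l).
Proof.
move=> df; apply: (is_derive_cast (is_derive_fun_comp df (@is_derive_id R R x v))).
by rewrite mulrC.
Qed.

Lemma Cn1 k (f f' : R -> R) : (forall x : R, is_derive x 1 f (f' x)) -> Cn k f' -> Cn k.+1 f.
Proof.
move=> df cf'; split.
  move=> x; apply: differentiable_continuous; apply/derivable1_diffP.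
  by have [] := df x.
move=> v; exists (fun x => v * f' x); last exact: CnZ.
by move=> x; exact: is_derive_scale.
Qed.

Lemma Cn1_0 k (f f' : R -> R) : (forall x : R, is_derive x 1 f (f' x)) ->
  (forall j, k = j.+1 -> Cn j f') -> Cn k f.
Proof.
move=> df; case: k => [_|k H]; last by apply: Cn1 (H _ erefl).
move=> x; apply: differentiable_continuous; apply/derivable1_diffP.
by have [] := df x.
Qed.

Lemma Cn_expR k : Cn k (@expR R).
Proof. by elim: k => [|k IH]; apply: (@Cn1_0 _ _ expR) => // j [<-]. Qed.

Lemma Cn_affine k (a b : R) : Cn k (fun x : R => a * x + b).
Proof.
apply: (@Cn1_0 _ _ (fun=> a)) => [x|j _]; last exact: Cn_cst.
apply: (is_derive_cast (is_derive_funD (is_derive_funZ a (is_derive_id x 1)) (is_derive_fun_cst b x 1))).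
by rewrite mulr1 addr0.
Qed.

(* The powers of [1 / x] make this family of flat functions closed under differentiation. *)
Definition flat (n : nat) (x : R) : R :=
  if 0 < x then x^-1 ^+ n * expR (- x^-1) else 0.

Lemma flat_ge0 n x : 0 <= flat n x.
Proof.
rewrite /flat; case: ifP => // x0.
by rewrite mulr_ge0 ?expR_ge0// exprn_ge0// invr_ge0 ltW.
Qed.

(** With [y = 1 / x]: [exp y = exp (y / n)^n >= (y / n)^n]. For [n = 0] the bound reads [1], the
    value of [0 ^+ 0]. *)
Lemma flat_le n x : flat n x <= n%:R ^+ n.
Proof.
rewrite /flat; case: ifP => [x0|_]; last by rewrite exprn_ge0.
have y0 : 0 < x^-1 by rewrite invr_gt0.
rewrite expRN ler_pdivrMr ?expR_gt0//.
case: n => [|n]; first by rewrite !expr0 mul1r -expR0 ler_expR ltW.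
have -> : expR x^-1 = expR (x^-1 / n.+1%:R) ^+ n.+1.
  by rewrite -expRM_natl mulrC divfK// pnatr_eq0.
rewrite -exprMn lerXn2r ?nnegrE ?mulr_ge0 ?expR_ge0 ?(ltW y0)//.
rewrite -ler_pdivrMl ?ltr0n// mulrC; apply: le_trans (expR_ge1Dx _).
by rewrite lerDr.
Qed.

Lemma flat_shift n x : flat n x = x * flat n.+1 x.
Proof.
rewrite /flat; case: ifP => x0; last by rewrite mulr0.
by rewrite exprS !mulrA divff ?mul1r// gt_eqF.
Qed.

(** At the origin the quotient [flat n h / h] equals [h * flat n.+2 h] by two uses of [flat_shift],
    a bounded function times [h]. *)
Lemma flat_derive n (x : R) : is_derive x 1 (flat n) (- n%:R * flat n.+1 x + flat n.+2 x).
Proof.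
have [x0|x0|<-] := ltgtP 0 x.
- have E : \near x, x^-1 ^+ n * expR (- x^-1) = flat n x.
    have H : \forall t \near x, 0 < t by exact: lt_nbhsr.
    by apply: filterS H => t t0; rewrite /flat t0.
  apply: (is_derive_near E); rewrite /flat x0.
  have dV : is_derive x 1 (fun y : R => y^-1) (- x ^- 2).
    apply: is_derive_cast (is_deriveV _ (is_derive_id x 1)) _; first by rewrite gt_eqF.
    by rewrite [LHS]mulr1.
  have dX : is_derive x 1 (fun y : R => y^-1 ^+ n) (n%:R * x^-1 ^+ n.-1 * - x ^- 2).
    by have := is_deriveX n dV; rewrite exprfctE => H; exact: (is_derive_cast H).
  have dE : is_derive x 1 (fun y : R => expR (- y^-1)) (expR (- x^-1) * - - x ^- 2).
    apply: is_derive_fun_comp; apply: is_deriveN.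
  apply: (is_derive_cast (is_derive_funM dX dE)); rewrite opprK -exprVn.
  case: n {E dX} => [|n]; first by rewrite /= !mul0r oppr0 mul0r !add0r expr0 mul1r mulrC.
  by rewrite /= !exprS; ring.
- have E : \near x, 0 = flat n x.
    have H : \forall t \near x, t < 0 by exact: lt_nbhsl.
    by apply: filterS H => t t0; rewrite /flat ltNge ltW.
  have z k : flat k x = 0 by rewrite /flat ltNge ltW.
  by rewrite !z mulr0 addr0; apply: (is_derive_near E); exact: is_derive_fun_cst.
have z k : flat k 0 = 0 by rewrite /flat ltxx.
rewrite !z mulr0 addr0; apply: derivative_unique.
apply/cvgr0Pnorm_lt => e e0.
pose c : R := n.+2%:R ^+ n.+2.
have c0 : 0 < c by rewrite exprn_gt0.
have H : \forall h \near (0:R)^', `|h| < e / c.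
  have H0 : \forall h \near (0:R), `|h| < e / c by apply: nbhs0_lt; rewrite divr_gt0.
  exact: nbhs_dnbhs H0.
apply: filterS2 H (nbhs_dnbhs_neq (0:R)) => h hh h0.
rewrite z add0r [_ *: _]mulr1 subr0 flat_shift flat_shift mulKf//.
rewrite normrM (ger0_norm (flat_ge0 _ _)).
apply: le_lt_trans (_ : `|h| * c < _); first by rewrite ler_wpM2l// flat_le.
by rewrite -ltr_pdivlMr.
Qed.

Lemma Cn_flat k n : Cn k (flat n).
Proof.
elim: k n => [|k IH] n; apply: (Cn1_0 (flat_derive n)) => // j [<-].
by apply: CnD => //; apply: CnZ.
Qed.

Definition bump (x : R) := flat 0 (1 + x) * flat 0 (1 - x).
Definition bump' (x : R) := flat 2 (1 + x) * flat 0 (1 - x) - flat 0 (1 + x) * flat 2 (1 - x).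

Lemma bump_derive (x : R) : is_derive x 1 bump (bump' x).
Proof.
have dp : is_derive x 1 (fun y : R => 1 + y) 1.
  by apply: (is_derive_cast (is_derive_funD (is_derive_fun_cst 1 x 1) (is_derive_id x 1))); rewrite add0r.
have dm : is_derive x 1 (fun y : R => 1 - y) (-1).
  by apply: (is_derive_cast (is_derive_funD (is_derive_fun_cst 1 x 1)
    (is_deriveN (is_derive_id x 1)))); rewrite add0r.
apply: (is_derive_cast (is_derive_funM (is_derive_fun_comp (flat_derive 0 _) dp)
  (is_derive_fun_comp (flat_derive 0 _) dm))).
by rewrite /bump' oppr0 !mul0r !add0r; ring.
Qed.

Lemma Cn_bump k : Cn k bump.
Proof.
apply: CnM; apply: Cn_comp; try exact: Cn_flat.
  have := @Cn_affine k 1 1; congr (Cn k _).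
  by apply/funext => x; rewrite mul1r addrC.
have := @Cn_affine k (-1) 1; congr (Cn k _).
by apply/funext => x; rewrite mulN1r addrC.
Qed.

Lemma flat0_le1 x : flat 0 x <= 1.
Proof. exact: le_trans (flat_le 0 x) _. Qed.

Lemma bump_ge0 x : 0 <= bump x.
Proof. by rewrite mulr_ge0 ?flat_ge0. Qed.

Lemma bump_le1 x : bump x <= 1.
Proof.
rewrite -[leRHS]mulr1; apply: ler_pM; rewrite ?flat_ge0 ?flat0_le1//.
Qed.

Lemma bump'_le x : `|bump' x| <= 8.
Proof.
have f2 y : flat 2 y <= 4 by apply: le_trans (flat_le 2 y) _; rewrite -natrX.
have H a b : 0 <= flat 2 a * flat 0 b <= 4.
  rewrite mulr_ge0 ?flat_ge0//= -[leRHS]mulr1.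
  by apply: ler_pM; rewrite ?flat_ge0 ?flat0_le1 ?f2.
rewrite /bump'; have := H (1 + x) (1 - x); have := H (1 - x) (1 + x).
rewrite [_ * flat 0 (1 + x)]mulrC ler_norml; lra.
Qed.

Lemma bump_out x : 1 <= `|x| -> bump x = 0 /\ bump' x = 0.
Proof.
move=> x1.
have z k y : y <= 0 -> flat k y = 0 by move=> y0; rewrite /flat ltNge y0.
have [xp|xn] := leP 0 x.
  by rewrite /bump /bump' !(z _ (1 - x)) ?mulr0 ?subrr//; move: x1; rewrite ger0_norm//; lra.
by rewrite /bump /bump' !(z _ (1 + x)) ?mul0r ?subrr//; move: x1; rewrite ltr0_norm//; lra.
Qed.

Lemma bump_ge x : `|x| <= 2^-1 -> expR (-4) <= bump x.
Proof.
have f y : 2^-1 <= y -> expR (-2) <= flat 0 y.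
  move=> y2; have y0 : 0 < y by apply: lt_le_trans y2.
  rewrite /flat y0 expr0 mul1r ler_expR lerN2.
  by rewrite -[2]invrK lef_pV2 ?posrE.
rewrite ler_norml => /andP[x1 x2].
rewrite (_ : -4 = -2 + -2) ?expRD; last by lra.
by apply: ler_pM; rewrite ?expR_ge0//; apply: f; lra.
Qed.

Definition logf (g : R -> R) (s : R) : R := if 0 < s then g (ln s) else 0.

(** Since [g] vanishes below [- L], [logf g] vanishes for [s < exp (- L)], which covers [s <= 0].
    The derivative is again of the form [logf], which is what makes [Cn_logf] an induction. *)
Lemma logf_derive (g g' : R -> R) (L s : R) :
  (forall y : R, is_derive y 1 g (g' y)) -> (forall y, y < - L -> g y = 0) ->
  is_derive s 1 (logf g) (logf (fun y => expR (- y) * g' y) s).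
Proof.
move=> dg g0; rewrite {2}/logf; case: ifPn => s0.
  have E : \near s, g (ln s) = logf g s.
    have H : \forall t \near s, 0 < t by exact: lt_nbhsr.
    by apply: filterS H => t t0; rewrite /logf t0.
  apply: (is_derive_near E); apply: (is_derive_cast (is_derive_fun_comp (dg _) (is_derive1_ln s0))).
  by rewrite expRN lnK ?posrE// mulrC.
have E : \near s, 0 = logf g s.
  have H : \forall t \near s, t < expR (- L).
    by apply: lt_nbhsl; apply: le_lt_trans (expR_gt0 _); rewrite leNgt.
  apply: filterS H => t tL; rewrite /logf; case: ifP => // t0.
  by rewrite g0// -ltr_expR lnK.
by apply: (is_derive_near E); exact: is_derive_fun_cst.
Qed.

Lemma Cn_logf k (g : R -> R) (L : R) : Cn k.+1 g -> (forall y, y < - L -> g y = 0) ->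
  Cn k (logf g).
Proof.
elim: k g => [|k IH] g [_ /(_ 1) [g' dg cg']] g0; apply: (Cn1_0 (fun s => logf_derive s dg g0)) => // j [<-].
apply: IH.
  apply: CnM => //; apply: Cn_comp; first exact: Cn_expR.
  have := @Cn_affine k.+1 (-1) 0; congr (Cn _ _).
  by apply/funext => x; rewrite mulN1r addr0.
move=> y yL; have E : \near y, 0 = g y.
  have H : \forall t \near y, t < - L by exact: lt_nbhsl.
  by apply: filterS H => t tL; rewrite g0.
by rewrite -(derive_eq_val (dg y)) (derive_eq_val (is_derive_near E (is_derive_fun_cst 0 y 1))) mulr0.
Qed.

End SmoothClass.

Section SmoothPoint.
Context {R : realType} {m : nat}.
Local Notation pt := (pt R m).

Lemma Cn_Ck k (f : pt -> R) : Cn k f -> Ck k setT f.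
Proof.
elim: k f => [|k IH] f; first by move=> cf x _; exact: cf.
move=> [cf H]; split; first by move=> x _; exact: cf.
move=> v; have [g dg cg] := H v; split; first by move=> x _; have [] := dg x.
rewrite (_ : 'D_v f = g); first exact: IH.
by apply/funext => x; rewrite (derive_eq_val (dg x)).
Qed.

Lemma Cn_coord k (j : 'I_m) : Cn k (fun x : pt => x.1 0 j).
Proof.
apply: (@Cn_const_derive R pt k _ (fun v : pt => v.1 0 j)); first by move=> x v; exact: is_derive_coord.
exact: continuous_coord.
Qed.

Lemma Cn_snd k : Cn k (fun x : pt => x.2).
Proof.
apply: (@Cn_const_derive R pt k _ (fun v : pt => v.2)); first by move=> x v; exact: is_derive_snd.
exact: continuous_snd.
Qed.

Lemma Cn_dotr k : Cn k (fun x : pt => dotr x.1 x.1).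
Proof. by apply: Cn_sum => i; apply: CnM; exact: Cn_coord. Qed.

End SmoothPoint.

(** * A compact set carrying all cutoffs, and a perturbation bound *)

Section Box.
Context {R : realType} {m : nat}.
Hypothesis m_gt0 : (0 < m)%N.
Local Notation pt := (pt R m).

Lemma norm_le_dotr (z : 'rV[R]_m) : `|z| <= Num.sqrt (dotr z z).
Proof.
rewrite [leLHS]mx_normrE; apply: bigmax_le => /=; first exact: sqrtr_ge0.
move=> [i j] _ /=; rewrite -sqrtr_sqr ler_sqrt; last exact: dotr_ge0.
rewrite (ord1 i) /dotr (bigD1 j)//= -expr2 lerDl.
by apply: sumr_ge0 => k _; rewrite -expr2 sqr_ge0.
Qed.

(** A neighbourhood of the axis point [(0, 1)] that stays away from the origin. *)
Definition box : set pt := [set z | `|z| <= 1] `*` `[2^-1, 3 / 2]%classic.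

Lemma compact_box : compact box.
Proof.
apply: compact_setX; last exact: segment_compact.
apply: bounded_closed_compact.
  by exists 1; split => // M M1 z /= z1; apply: le_trans (ltW M1).
have [H _] := @continuous_closedP _ _ (fun z : 'rV[R]_m => `|z|).
apply: (H _ [set t : R | t <= 1]); first exact: norm_continuous.
exact: closed_le.
Qed.

Lemma box_not0 : ~ box 0.
Proof. by case=> _ /=; rewrite in_itv /= => /andP[h _]; move: h; lra. Qed.

Lemma Gr_gt0 M K (f : pt -> R) (x : pt) : 0 <= M -> 0 <= K -> gfgood M K f ->
  (forall x, 0 <= f x) -> 0 < f x -> 0 < Gr f.
Proof.
move=> M0 K0 gf f0; case: x => z t fx; have [fK fM cf] := gf.
have [tt ct] := ggood_tame m_gt0 M0 K0 (gfgood_ggood gf).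
apply: (tame_gt0 (a := t) tt ct); first by move=> s; exact: rint_ge0.
apply: (@rint_gt0 _ _ M K _ z) => //; split => //.
- move=> y i Mi; apply: fM; apply: lt_le_trans Mi _.
  by apply: le_trans (norm_coord_le _ _) _; exact: (norm_fst_le (y, t)).
- move=> y; apply: (@continuous_comp _ _ _ (fun z => (z, t) : pt) f); last exact: cf.
  exact: pairl_continuous.
Qed.

(** The tangent at [a + b], evaluated at [a]; its slope is at most [p (2 A)^(p-1)] in absolute
    value. *)
Lemma abs_powR_perturb (p a b A : R) : 2 <= p -> `|a| <= A -> `|b| <= A ->
  `|a + b| `^ p <= `|a| `^ p + p * (2 * A) `^ (p - 1) * `|b|.
Proof.
move=> p2 aA bA; have p0 : 0 <= p by lra.
have := abs_powR_ge_tangent a (a + b) p2; rewrite opprD addNKr addrC.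
rewrite -lerBrDl => H; rewrite -lerBlDl; apply: le_trans (_ : - (om p (a + b) * - b) <= _).
  by move: H; rewrite !mulrN; lra.
rewrite mulrN opprK; apply: le_trans (ler_norm _) _.
rewrite normrM ler_wpM2r// /om normrM ger0_norm// ler_wpM2l// normrM.
rewrite ger0_norm ?powR_ge0//.
have s : `|a + b| <= 2 * A by apply: le_trans (ler_normD _ _) _; lra.
have [->|ab0] := eqVneq (a + b) 0; first by rewrite normr0 mulr0 powR_ge0.
have e : `|a + b| `^ (p - 2) * `|a + b| = `|a + b| `^ (p - 1).
  rewrite [in RHS](_ : p - 1 = p - 2 + 1); last by lra.
  by rewrite [in RHS]powRD ?normr_eq0 ?ab0 ?implybT// powRr1.
by have ab := normr_ge0 (a + b); rewrite e ge0_ler_powR ?nnegrE//; lra.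
Qed.

End Box.

(** * Logarithmic cutoffs near an axis point *)

Section Cutoff.
Context {R : realType} {m : nat}.
Local Notation pt := (pt R m).
Hypothesis m_gt0 : (0 < m)%N.
Variables (p r N : R).
Hypothesis p_gt0 : 0 < p.
Hypothesis r_gt0 : 0 < r.
Hypothesis r_le : r <= 4^-1.
Hypothesis N_gt0 : 0 < N.
Implicit Types (b c y : R) (x : pt).

Let al : R := m%:R / (2 * p).

(** In the variable [y = ln |z|^2] the exponential is [|z|^(-m/p)]. The centre of the bump is
    [y = - (2 + c) N]: the offset [2] keeps the support in [y <= 0], that is in [|z| <= 1], for all
    shifts with [|c| <= 1]. *)
Definition profile c y := expR (- al * y) * bump (N^-1 * y + (2 + c)).
Definition profile' c y := expR (- al * y) *
  (- al * bump (N^-1 * y + (2 + c)) + N^-1 * bump' (N^-1 * y + (2 + c))).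

(* [b] and [c] translate the two bumps; the near-extremal functions have [b = c = 0]. *)
Definition cutoff b c x :=
  bump (r^-1 * x.2 + (b - r^-1)) * logf (profile c) (dotr x.1 x.1).

Lemma affine_derive (a c y : R) : is_derive y 1 (fun y : R => a * y + c) a.
Proof.
apply: (is_derive_cast (is_derive_funD (is_derive_funZ a (is_derive_id y 1)) (is_derive_fun_cst c y 1))).
by rewrite mulr1 addr0.
Qed.

Lemma profile_derive c y : is_derive y 1 (profile c) (profile' c y).
Proof.
have d1 : is_derive y 1 (fun y : R => expR (- al * y)) (expR (- al * y) * (- al)).
  apply: is_derive_fun_comp; apply: (is_derive_cast (is_derive_funZ (- al) (is_derive_id y 1))); exact: mulr1.
have d2 : is_derive y 1 (fun y => bump (N^-1 * y + (2 + c)))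
    (bump' (N^-1 * y + (2 + c)) * N^-1).
  by apply: (is_derive_fun_comp (bump_derive _)); exact: affine_derive.
by apply: (is_derive_cast (is_derive_funM d1 d2)); rewrite /profile'; ring.
Qed.

Lemma Cn_profile k c : Cn k (profile c).
Proof.
apply: CnM; apply: Cn_comp.
- exact: Cn_expR.
- have := @Cn_affine R k (- al) 0; congr (Cn _ _).
  by apply/funext => y; rewrite addr0.
- exact: Cn_bump.
- exact: Cn_affine.
Qed.

Lemma profile_out c y : c <= 1 -> y < - (4 * N) -> profile c y = 0.
Proof.
move=> c1 yN; have h : N^-1 * y < - 4.
  by rewrite mulrC ltr_pdivrMr// mulNr.
rewrite /profile; have [|-> _] := @bump_out R (N^-1 * y + (2 + c)); last by rewrite mulr0.
by rewrite ler0_norm; lra.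
Qed.

Lemma cutoff_smooth b c : c <= 1 -> smooth_on setT (cutoff b c).
Proof.
move=> c1 k; apply: Cn_Ck; apply: CnM.
  apply: (@Cn_comp R pt k (fun t => bump (r^-1 * t + (b - r^-1))) snd).
    apply: (@Cn_comp R R k (@bump R) (fun t => r^-1 * t + (b - r^-1))); first exact: Cn_bump.
    exact: Cn_affine.
  exact: Cn_snd.
apply: (@Cn_comp R pt k (logf (profile c)) (fun x => dotr x.1 x.1)).
  apply: (@Cn_logf R k (profile c) (4 * N)); first exact: Cn_profile.
  by move=> y; exact: profile_out.
exact: Cn_dotr.
Qed.

(** The bump in [t] lives in [|t - 1| < 2 r] when [|b| <= 1], which is why [r <= 1 / 4] is imposed.
    For [|z| > 1] the logarithm is nonnegative and the argument of the other bump is at least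
    [1]. *)
Lemma cutoff_notbox b c x : `|b| <= 1 -> `|c| <= 1 -> ~ box x -> cutoff b c x = 0.
Proof.
rewrite !ler_norml => /andP[b1 b2] /andP[c1 c2] nx; rewrite /cutoff.
have ri : 4 <= r^-1 by rewrite -[4]invrK lef_pV2 ?posrE.
have [h|h] := boolP (2^-1 <= x.2 <= 3 / 2); last first.
  have [|-> _] := @bump_out R (r^-1 * x.2 + (b - r^-1)); last by rewrite mul0r.
  have rr := mulVf (lt0r_neq0 r_gt0).
  move: h; rewrite negb_and -!ltNge => /orP[h|h].
    rewrite ler0_norm; nra.
  rewrite ger0_norm; nra.
have z1 : 1 < `|x.1|.
  by rewrite ltNge; apply/negP => z1; apply: nx; split => //=; rewrite in_itv.
have s1 : 1 < dotr x.1 x.1.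
  have := lt_le_trans z1 (norm_le_dotr x.1).
  by rewrite -[X in X < _ -> _]sqrtr1 ltr_sqrt// dotr_gt0// -normr_gt0; exact: lt_trans z1.
rewrite /logf ifT; last by apply: lt_trans s1.
have [|bz _] := @bump_out R (N^-1 * ln (dotr x.1 x.1) + (2 + c)).
  have : 0 <= N^-1 * ln (dotr x.1 x.1) by rewrite mulr_ge0 ?ln_ge0 ?invr_ge0 ?ltW.
  by move=> ?; rewrite ger0_norm; lra.
by rewrite /profile bz !mulr0.
Qed.

Lemma cutoffE b c x : 0 < dotr x.1 x.1 ->
  cutoff b c x = expR (- al * ln (dotr x.1 x.1))
    * (bump (r^-1 * x.2 + (b - r^-1)) * bump (N^-1 * ln (dotr x.1 x.1) + (2 + c))).
Proof. by move=> s0; rewrite /cutoff /logf s0 /profile; ring. Qed.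

Lemma abs_cutoffE b c x : 0 < dotr x.1 x.1 ->
  `|cutoff b c x| `^ p = expR (- al * ln (dotr x.1 x.1)) `^ p
    * (bump (r^-1 * x.2 + (b - r^-1)) * bump (N^-1 * ln (dotr x.1 x.1) + (2 + c))) `^ p.
Proof.
move=> s0; rewrite cutoffE//.
have hb : 0 <= bump (r^-1 * x.2 + (b - r^-1)) * bump (N^-1 * ln (dotr x.1 x.1) + (2 + c)).
  exact: mulr_ge0 (bump_ge0 _) (bump_ge0 _).
rewrite ger0_norm; last exact: mulr_ge0 (expR_ge0 _) hb.
by rewrite powRM ?expR_ge0.
Qed.

Lemma cutoff_cont b c x : c <= 1 -> {for x, continuous (fun x => `|cutoff b c x| `^ p)}.
Proof.
move=> c1; apply: (@continuous_fun_comp R pt (fun s => `|s| `^ p) (cutoff b c)).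
  by apply: abs_powR_cont; exact: ltW.
by apply: smoothT_cont; exact: cutoff_smooth.
Qed.

Variable M : R.
Hypothesis M0 : 0 <= M.
Hypothesis KM : forall x, M < `|x| -> ~ @box R m x.

Lemma cutoff_gfgood b c : `|b| <= 1 -> `|c| <= 1 ->
  exists2 L, 0 <= L & gfgood M L (fun x => `|cutoff b c x| `^ p).
Proof.
move=> b1 c1; apply: (cont_gfgood compact_box (@box_not0 R m) KM).
  by move=> x _; apply: cutoff_cont; move: c1; rewrite ler_norml => /andP[].
by move=> x nx; rewrite cutoff_notbox// normr0 powR0// gt_eqF.
Qed.

Lemma dotr_scale (a : R) (z : 'rV[R]_m) : dotr (a *: z) (a *: z) = a ^+ 2 * dotr z z.
Proof. by rewrite /dotr mulr_sumr; apply: eq_bigr => i _; rewrite !mxE; ring. Qed.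

(* [ln |z|^2] turns the dilation of [z] by [exp (c N / 2)] into the shift by [c] of the profile. *)
Lemma cutoff_shift b c x :
  `|cutoff 0 0 (expR (c * N / 2) *: x.1 + ((0, b * r) : pt).1, x.2 + ((0, b * r) : pt).2)| `^ p =
  (expR (c * N / 2) ^+ m)^-1 * `|cutoff b c x| `^ p.
Proof.
have E : dotr (expR (c * N / 2) *: x.1 + ((0, b * r) : pt).1)
   (expR (c * N / 2) *: x.1 + ((0, b * r) : pt).1) = expR (c * N) * dotr x.1 x.1.
  by rewrite addr0 dotr_scale -expRM_natl; congr (expR _ * _); field.
have [s0|s0] := ltP 0 (dotr x.1 x.1); last first.
  rewrite /cutoff /= E /logf !ifF; last 2 first.
  - by apply/negbTE; rewrite -leNgt.
  - by apply/negbTE; rewrite -leNgt pmulr_rle0// expR_gt0.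
  by rewrite !mulr0 normr0 powR0 ?mulr0// gt_eqF.
rewrite !abs_cutoffE ?E ?mulr_gt0 ?expR_gt0//= lnM ?posrE ?expR_gt0// expRK.
have -> : r^-1 * (x.2 + b * r) + (0 - r^-1) = r^-1 * x.2 + (b - r^-1).
  by field; rewrite gt_eqF.
have -> : N^-1 * (c * N + ln (dotr x.1 x.1)) + (2 + 0) = N^-1 * ln (dotr x.1 x.1) + (2 + c).
  by field; rewrite gt_eqF.
rewrite [RHS]mulrA; congr (_ * _).
rewrite -!expRM -expRM_natl -expRN -expRD; congr expR.
by rewrite /al; field; rewrite gt_eqF.
Qed.

Lemma Gr_cutoff b c : `|b| <= 1 -> `|c| <= 1 ->
  Gr (fun x => `|cutoff b c x| `^ p) = Gr (fun x => `|cutoff 0 0 x| `^ p).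
Proof.
move=> b1 c1; have [L L0 gL] := cutoff_gfgood b1 c1.
have [L' L'0 gL'] : exists2 L, 0 <= L & gfgood M L (fun x => `|cutoff 0 0 x| `^ p).
  by apply: cutoff_gfgood; rewrite normr0.
have H := Gr_affine m_gt0 ((0, b * r) : pt) M0 L'0 (expR_gt0 (c * N / 2)) gL'.
apply: etrans _ H; apply: esym.
apply: etrans (congr1 (fun s => expR (c * N / 2) ^+ m * Gr s) (funext (cutoff_shift b c))) _.
apply: etrans (congr1 _ (GrZ m_gt0 _ M0 L0 (@gfgood_ggood _ _ _ _ _ gL))) _.
by apply: mulVKf; rewrite expf_neq0// gt_eqF// expR_gt0.
Qed.

Lemma Gr_cutoff_gt0 : 0 < Gr (fun x => `|cutoff 0 0 x| `^ p).
Proof.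
have [L L0 gL] : exists2 L, 0 <= L & gfgood M L (fun x => `|cutoff 0 0 x| `^ p).
  by apply: cutoff_gfgood; rewrite normr0.
(* The point with [t = 1] and [|z| = exp (- N)], where both bumps are evaluated at [0]. *)
pose x : pt := (expR (- N) *: ebase R (Ordinal m_gt0), 1).
apply: (@Gr_gt0 R m m_gt0 M L _ x M0 L0 gL); first by move=> y; exact: powR_ge0.
have s : dotr x.1 x.1 = expR (- (2 * N)).
  rewrite dotr_scale dotr_ebase mxE eqxx mulr1 -expRM_natl; congr expR; ring.
have b0 : 0 < bump (0 : R).
  by apply: lt_le_trans (bump_ge _); rewrite ?expR_gt0// normr0 invr_ge0.
rewrite abs_cutoffE s ?expR_gt0// mulr_gt0// powR_gt0 ?expR_gt0// expRK /=.
have -> : r^-1 * 1 + (0 - r^-1) = 0 by ring.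
have -> : N^-1 * - (2 * N) + (2 + 0) = 0 by field; rewrite gt_eqF.
exact: mulr_gt0.
Qed.

End Cutoff.

(** * Sharpness of the constant *)

Section Sharpness.
Context {R : realType} {m : nat}.
Variables (B : 'M[R]_m) (p theta : R) (d : pt R m -> R).
Local Notation pt := (pt R m).
Local Notation E j := ((ebase R j, 0) : pt).
Local Notation T := ((0, 1) : pt).
Hypothesis m_gt0 : (0 < m)%N.
Hypothesis Bskew : B^T = - B.
Hypothesis Binj : forall v : 'cV[R]_m, B *m v = 0 -> v = 0.
Hypothesis p2 : 2 <= p.
Hypothesis reg : regular_hom B d.
Hypothesis orth : forall x : pt, x != 0 -> dotr x.1 (Binv B (gradz d x)) = 0.
Implicit Types x : pt.

Let p_gt0 : 0 < p. Proof. have := p2; lra. Qed.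
Let kappa := (m%:R + 2 - p * theta) / p.
Let al : R := m%:R / (2 * p).
Let mR : 0 < m%:R :> R. Proof. by rewrite ltr0n. Qed.

(** Near [(0, 1)] the powers of [d] are controlled by continuity. By Euler's identity
    [d - 2 t D_t d] is the product of [z] with [grad_z d], hence of order [|z|] since that gradient
    is bounded. *)
Lemma local_bounds : exists rho a1 a2 k : R, [/\ 0 < rho, 0 < a1, 0 <= a2, 0 <= k &
  forall x, x.1 != 0 -> `|x.1| < rho -> `|x.2 - 1| < rho ->
  [/\ a1 <= d x `^ (- (p * theta)), d x `^ (- (p * theta)) <= a2 &
      `|d x - 2 * x.2 * dt d x| <= k * `|x.1| * d x]].
Proof.
have T0 : T != 0.
  by apply/eqP => /(congr1 snd) /= /eqP; rewrite oner_eq0.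
pose A := d T `^ (- (p * theta)).
have A0 : 0 < A by rewrite powR_gt0// (d_gt0 reg T0).
have A2 : 0 < A / 2 by lra.
have /cvgrPdist_lt /(_ _ A2) H1 := cont_d_powR reg (a := - (p * theta)) T0.
(* The exponent [1] writes an absolute value in the form covered by [adm_abs_powR]. *)
pose g x := \sum_j `|dz d j x * d x `^ (-1)| `^ 1.
have ag : adm g.
  apply: (@adm_sum R m _ (fun j x => `|dz d j x * d x `^ (-1)| `^ 1)) => j.
  apply: (@adm_abs_powR R m 1 (fun x => dz d j x * d x `^ (-1))) => //.
  by apply: admM; [exact: (adm_dz reg)|exact: (adm_d_powR reg)].
have [k H2] := ag.2 _ T0.
have HH := filterI H1 H2.
have [rho /= rho0 H] : exists2 rho : R, 0 < rho & ball T rho `<=`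
    [set x | `|A - d x `^ (- (p * theta))| < A / 2 /\ (x.1 != 0 -> `|g x| <= k)].
  by apply/nbhs_ballP; exact: (HH _).
exists rho, (A / 2), (2 * A), `|k|; split => // [|x x0 z1 t1]; first by lra.
have xT : ball T rho x.
  split; rewrite -ball_normE /=; first by rewrite sub0r normrN.
  by rewrite distrC.
have [h1 h2] := H x xT; have dx := d_gt0 reg (fst_neq0 x0).
move: h1 => /=; rewrite -/A ltr_norml => /andP[h1 h1']; split; [lra|lra|].
rewrite -[X in X - _](euler_d reg x0) addrK.
have gk : g x <= `|k| by apply: le_trans (ler_norm _) _; apply: le_trans (h2 x0) (ler_norm _).
apply: (@le_trans _ _ (g x * `|x.1| * d x)); last first.
  by rewrite ler_wpM2r ?(ltW dx)// ler_wpM2r.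
apply: le_trans (ler_norm_sum _ _ _) _; rewrite /g !mulr_suml; apply: ler_sum => j _.
rewrite powRr1// normrM [X in _ <= X](_ : _ = `|x.1| * `|dz d j x|); last first.
  rewrite normrM powRN powRr1 ?(ltW dx)// (gtr0_norm (_ : 0 < (d x)^-1)) ?invr_gt0//.
  by field; rewrite gt_eqF.
by rewrite ler_wpM2r// norm_coord_le.
Qed.

(** Here [q] stands for [(d - 2 t D_t d) / d], [ri] for [1 / r], and [bX], [bY] and their primes for
    the two bumps and their derivatives. The first summand has an explicit [1 / N]; the second gets
    it from [q]. *)
Lemma error_le (c1 c2 q k N t ri a bX bY bX' bY' : R) :
  1 <= N -> 0 <= k -> 0 <= a -> 0 <= ri -> `|q| <= k * (2 / N) -> `|t| <= 2 ->
  `|bX| <= 1 -> `|bY| <= 1 -> `|bX'| <= 8 -> `|bY'| <= 8 ->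
  `|c1 / N * (bX * bY') + c2 * q * (bX * (- a * bY + N^-1 * bY') + t * ri * bX' * bY)|
    <= (8 * `|c1| + `|c2| * (2 * k) * (a + 8 + 16 * ri)) / N.
Proof.
move=> N1 k0 a0 ri0 hq ht hX hY hX' hY'; have N0 : 0 < N by lra.
have Ni : 0 < N^-1 by rewrite invr_gt0.
have Ni1 : N^-1 <= 1 by rewrite invf_le1.
apply: le_trans (ler_normD _ _) _; rewrite [leRHS]mulrDl; apply: lerD.
  rewrite !normrM (gtr0_norm Ni) [leRHS](_ : _ = `|c1| * N^-1 * (1 * 8)); last by ring.
  by rewrite ler_wpM2l ?mulr_ge0 ?(ltW Ni)// ler_pM.
rewrite !normrM [leRHS](_ : _ = `|c2| * (k * (2 / N)) * (a + 8 + 16 * ri)); last by ring.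
apply: ler_pM; rewrite ?mulr_ge0//; first by rewrite ler_wpM2l.
apply: le_trans (ler_normD _ _) _; apply: lerD.
  rewrite normrM -[leRHS]mul1r; apply: ler_pM => //.
  apply: le_trans (ler_normD _ _) _; rewrite !normrM normrN (ger0_norm a0) (gtr0_norm Ni).
  apply: lerD; first by rewrite -[leRHS]mulr1 ler_wpM2l.
  by rewrite -[leRHS]mul1r ler_pM// ltW.
rewrite !normrM (ger0_norm ri0) [leRHS](_ : _ = 2 * ri * 8 * 1); last by ring.
by rewrite !ler_pM ?mulr_ge0.
Qed.

(** The intervals [[-1/2, 1/2]], on which the bump exceeds [exp (-4)], cover [[-1, 1]] after shifts
    by [-1], [0], [1]. Two bumps thus need nine translates. *)
Lemma bump_cover (X : R) : `|X| <= 1 -> exists i : 'I_3, expR (-4) <= bump (X + (i%:R - 1)).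
Proof.
rewrite ler_norml => /andP[h1 h2].
have [l|g1] := ltP X (- 2^-1).
  exists (inord 2); apply: bump_ge; rewrite inordK// ler_norml; apply/andP; split; lra.
have [g2|l] := ltP (2^-1) X.
  exists (inord 0); apply: bump_ge; rewrite inordK// ler_norml; apply/andP; split; lra.
exists (inord 1); apply: bump_ge; rewrite inordK// ler_norml; apply/andP; split; lra.
Qed.

Lemma sum9_ge (a : 'I_3 -> 'I_3 -> R) i j : (forall i j, 0 <= a i j) ->
  a i j <= \sum_i \sum_j a i j.
Proof.
move=> a0; rewrite (bigD1 i)//= (bigD1 j)//= -addrA lerDl.
by apply: addr_ge0; apply: sumr_ge0 => // k _; apply: sumr_ge0.
Qed.

Lemma sum9D (a : 'I_3 -> 'I_3 -> R) b :
  \sum_i \sum_j (a i j + b) = \sum_i \sum_j a i j + 9 * b.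
Proof.
under eq_bigr do rewrite big_split /= sumr_const card_ord.
by rewrite big_split /= sumr_const card_ord -mulrnA -[in LHS]mulr_natl.
Qed.

Section Estimate.
Variables (rho a1 a2 k r N : R).
Hypothesis a2_ge0 : 0 <= a2.
Hypothesis k_ge0 : 0 <= k.
Hypothesis bounds : forall x, x.1 != 0 -> `|x.1| < rho -> `|x.2 - 1| < rho ->
  [/\ a1 <= d x `^ (- (p * theta)), d x `^ (- (p * theta)) <= a2 &
      `|d x - 2 * x.2 * dt d x| <= k * `|x.1| * d x].
Hypothesis r_gt0 : 0 < r.
Hypothesis r_le : r <= 4^-1.
Hypothesis r_rho : r < rho.
Hypothesis N_ge1 : 1 <= N.
Hypothesis N_rho : 2 / N < rho.

Let N_gt0 : 0 < N. Proof. have := N_ge1; lra. Qed.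
Local Notation u := (cutoff p r N 0 0).
Let tau x := r^-1 * x.2 + (0 - r^-1).
Let sig x := N^-1 * ln (dotr x.1 x.1) + (2 + 0).
Let D := 8 * `|2 * p * kappa / m%:R| + `|2 * p * theta / m%:R| * (2 * k) * (al + 8 + 16 * r^-1).
Let error x := 2 * p * kappa / m%:R / N * (bump (tau x) * bump' (sig x))
  + 2 * p * theta / m%:R * ((d x - 2 * x.2 * dt d x) / d x)
    * (bump (tau x) * (- al * bump (sig x) + N^-1 * bump' (sig x))
       + x.2 * r^-1 * bump' (tau x) * bump (sig x)).

Lemma cutoff_dotZ x : x.1 != 0 ->
  dotr (gradG B u x) (Zd B p theta d x) * d x =
  expR (- al * ln (dotr x.1 x.1)) * (- kappa * (bump (tau x) * bump (sig x)) + error x).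
Proof.
move=> x0; have dx := d_gt0 reg (fst_neq0 x0); have s0 := dotr_gt0 x0.
have dA : is_derive x.2 1 (fun t => bump (r^-1 * t + (0 - r^-1))) (bump' (tau x) * r^-1).
  by apply: (is_derive_fun_comp (bump_derive _)); exact: affine_derive.
have c01 : (0 : R) <= 1 by [].
have dW := logf_derive (dotr x.1 x.1) (@profile_derive R m p N 0)
  (fun y => @profile_out R m p N N_gt0 0 y c01).
have := dotZ_split p theta m_gt0 Bskew Binj reg orth x0 dA dW.
rewrite -/(tau x) => H; rewrite [X in X * _ = _]H {H dA dW}.
rewrite /logf s0 expRN lnK ?posrE// /profile /profile' -/al -/(sig x).
rewrite /error /kappa /al.
set e := expR _; set bt := bump (tau x); set bs := bump (sig x).
set bt' := bump' (tau x); set bs' := bump' (sig x); set dd := dt d x.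
by field; rewrite !gt_eqF.
Qed.

(** On the support [|z|^2 < exp (- N)], and [exp (N / 2) >= N / 2]; the exponential decay is relaxed
    to the order [1 / N] of the other error. *)
Lemma small_of_sig x : `|sig x| < 1 -> x.1 != 0 -> `|x.1| <= 2 / N.
Proof.
move=> sx x0; have s0 := dotr_gt0 x0.
apply: le_trans (norm_le_dotr _) _.
have lN : ln (dotr x.1 x.1) < - N.
  move: sx; rewrite /sig ltr_norml => /andP[_ h].
  have : N^-1 * ln (dotr x.1 x.1) < -1 by lra.
  by rewrite mulrC ltr_pdivrMr// mulN1r.
have s1 : dotr x.1 x.1 <= (2 / N) ^+ 2.
  rewrite -[X in X <= _]lnK ?posrE//; apply: (@le_trans _ _ (expR (- N))).
    by rewrite ler_expR ltW.
  rewrite -invf_div exprVn expRN lef_pV2 ?posrE ?expR_gt0 ?exprn_gt0 ?divr_gt0//.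
  have -> : expR N = expR (N / 2) ^+ 2 by rewrite -expRM_natl; congr expR; field.
  have h := expR_ge1Dx (N / 2).
  rewrite lerXn2r ?nnegrE ?expR_ge0 ?divr_ge0 ?(ltW N_gt0)//; lra.
have N2 : 0 <= 2 / N by rewrite divr_ge0// ltW.
by rewrite -[leRHS](ger0_norm N2) -sqrtr_sqr ler_sqrt// sqr_ge0.
Qed.

Lemma bump_norm_le (X : R) : `|bump X| <= 1.
Proof. by rewrite ger0_norm ?bump_ge0 ?bump_le1. Qed.

Let al_ge0 : 0 <= al.
Proof. by rewrite divr_ge0// mulr_ge0// ltW. Qed.

Lemma D_ge0 : 0 <= D.
Proof.
have ri : 0 <= r^-1 by rewrite invr_ge0 ltW.
apply: addr_ge0; first exact: mulr_ge0.
apply: mulr_ge0; first by rewrite !mulr_ge0.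
by apply: addr_ge0; [exact: addr_ge0|exact: mulr_ge0].
Qed.

Lemma cutoff_inside x : x.1 != 0 -> `|tau x| < 1 -> `|sig x| < 1 ->
  [/\ a1 <= d x `^ (- (p * theta)), d x `^ (- (p * theta)) <= a2 & `|error x| <= D / N].
Proof.
move=> x0 tx sx; have dx := d_gt0 reg (fst_neq0 x0).
have zN := small_of_sig sx x0.
have t1 : `|x.2 - 1| < r.
  have -> : x.2 - 1 = tau x * r by rewrite /tau; field; rewrite gt_eqF.
  by rewrite normrM (gtr0_norm r_gt0) -[ltRHS]mul1r ltr_pM2r.
have [h1 h2 h3] := bounds x0 (le_lt_trans zN N_rho) (lt_trans t1 r_rho).
split => //; apply: error_le => //; rewrite ?bump_norm_le ?bump'_le//.
- by rewrite invr_ge0 ltW.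
- rewrite normrM normfV (gtr0_norm dx) ler_pdivrMr//; apply: le_trans h3 _.
  by rewrite ler_wpM2r ?(ltW dx)// ler_wpM2l.
- move: t1 r_le; rewrite ltr_norml ler_norml => /andP[? ?] ?; apply/andP; split; lra.
Qed.

Let F x := `|dotr (gradG B u x) (Zd B p theta d x)| `^ p / d x `^ (p * (theta - 1)).
Let G x := `|u x| `^ p / d x `^ (p * theta).
Let S x := \sum_(i < 3) \sum_(j < 3) `|cutoff p r N (i%:R - 1) (j%:R - 1) x| `^ p.
Let c : R := (expR (-4) * expR (-4)) `^ p.
Let E0 := p * (2 * (`|kappa| + D)) `^ (p - 1) * D.

Lemma cE_ge0 : 0 <= a2 * E0 / c / N.
Proof.
rewrite !divr_ge0 ?powR_ge0 ?(ltW N_gt0)// mulr_ge0// mulr_ge0 ?D_ge0//.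
by rewrite mulr_ge0 ?powR_ge0// ltW.
Qed.

Lemma S_ge0 x : 0 <= S x.
Proof. by apply: sumr_ge0 => i _; apply: sumr_ge0 => j _; exact: powR_ge0. Qed.

Lemma S_ge x : x.1 != 0 -> `|tau x| <= 1 -> `|sig x| <= 1 ->
  expR (- al * ln (dotr x.1 x.1)) `^ p * c <= S x.
Proof.
move=> x0 /bump_cover[i hi] /bump_cover[j hj]; have s0 := dotr_gt0 x0.
apply: le_trans (sum9_ge (a := fun i j : 'I_3 =>
  `|cutoff p r N (i%:R - 1) (j%:R - 1) x| `^ p) i j _); last by move=> *; exact: powR_ge0.
rewrite abs_cutoffE// ler_wpM2l ?powR_ge0//.
have e4 : 0 <= expR (-4) :> R by exact: expR_ge0.
have bb : expR (-4) * expR (-4) <= bump (r^-1 * x.2 + ((i%:R - 1) - r^-1)) *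
    bump (N^-1 * ln (dotr x.1 x.1) + (2 + (j%:R - 1))) :> R.
  apply: ler_pM => //.
    by have -> : r^-1 * x.2 + ((i%:R - 1) - r^-1) = tau x + (i%:R - 1) by rewrite /tau; ring.
  have -> : N^-1 * ln (dotr x.1 x.1) + (2 + (j%:R - 1)) = sig x + (j%:R - 1) by rewrite /sig; ring.
  exact: hj.
have e44 : 0 <= expR (-4) * expR (-4) :> R by exact: mulr_ge0.
by apply: ge0_ler_powR; rewrite ?nnegrE ?(ltW p_gt0)//; exact: le_trans bb.
Qed.

Lemma F_E x : x.1 != 0 -> F x = `|dotr (gradG B u x) (Zd B p theta d x) * d x| `^ p
  * d x `^ (- (p * theta)).
Proof.
move=> x0; have dx := d_gt0 reg (fst_neq0 x0).
rewrite normrM (gtr0_norm dx) powRM ?(ltW dx)// /F -powRN -[RHS]mulrA.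
by rewrite -powRD ?(gt_eqF dx) ?implybT//; congr (_ * _ `^ _); ring.
Qed.

Lemma G_E x : x.1 != 0 -> G x = expR (- al * ln (dotr x.1 x.1)) `^ p
  * (bump (tau x) * bump (sig x)) `^ p * d x `^ (- (p * theta)).
Proof. by move=> x0; rewrite /G abs_cutoffE ?dotr_gt0// powRN. Qed.

(** The error is only bounded by [D / N], with no factor that decays where the bumps do, so it is
    not absorbed into [G]. The sum [S] of the nine translates stays above a fixed multiple of
    [|z|^(-m)] on the whole support and absorbs it. *)
Lemma F_le x : x.1 != 0 -> F x <= `|kappa| `^ p * G x + a2 * E0 / c / N * S x.
Proof.
move=> x0; have dx := d_gt0 reg (fst_neq0 x0); have s0 := dotr_gt0 x0.
have G0 : 0 <= G x by rewrite divr_ge0 ?powR_ge0.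
have R0 : 0 <= `|kappa| `^ p * G x + a2 * E0 / c / N * S x.
  apply: addr_ge0; first exact: mulr_ge0 (powR_ge0 _ _) G0.
  exact: mulr_ge0 cE_ge0 (S_ge0 x).
have [tx|tx] := ltP `|tau x| 1; last first.
  have [b0 b0'] := bump_out tx.
  apply: le_trans R0; rewrite F_E// cutoff_dotZ// /error b0 b0' !(mul0r, mulr0, addr0).
  by rewrite normr0 powR0 ?mul0r// gt_eqF.
have [sx|sx] := ltP `|sig x| 1; last first.
  have [b0 b0'] := bump_out sx.
  apply: le_trans R0; rewrite F_E// cutoff_dotZ// /error b0 b0' !(mul0r, mulr0, addr0).
  by rewrite normr0 powR0 ?mul0r// gt_eqF.
have [h1 h2 h3] := cutoff_inside x0 tx sx.
have hS := S_ge x0 (ltW tx) (ltW sx).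
rewrite F_E// G_E// cutoff_dotZ//; set e := expR _ in hS *.
have e0 : 0 < e by exact: expR_gt0.
rewrite normrM (gtr0_norm e0) (powRM p (ltW e0) (normr_ge0 _)).
set b := bump _ * bump _; have b0 : 0 <= b by exact: mulr_ge0 (bump_ge0 _) (bump_ge0 _).
have b1 : b <= 1.
  by rewrite -[leRHS]mulr1; apply: ler_pM; rewrite ?bump_ge0 ?bump_le1.
have DN : D / N <= D by rewrite ler_pdivrMr// ler_peMr// D_ge0.
have DN0 := D_ge0.
have P := @abs_powR_perturb R p (- kappa * b) (error x) (`|kappa| + D) p2.
have {}P : `|- kappa * b + error x| `^ p <= `|kappa| `^ p * b `^ p + E0 / N.
  apply: le_trans (P _ _) _.
  - rewrite normrM normrN (ger0_norm b0); apply: (@le_trans _ _ `|kappa|); last by lra.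
    by rewrite ler_piMr.
  - by apply: le_trans h3 _; apply: le_trans DN _; rewrite lerDr.
  rewrite normrM normrN (ger0_norm b0) (powRM p (normr_ge0 kappa) b0) lerD2l /E0 -[leRHS]mulrA.
  by rewrite ler_wpM2l// mulr_ge0 ?powR_ge0// ltW.
have c0 : 0 < c by rewrite powR_gt0// mulr_gt0 ?expR_gt0.
have E00 : 0 <= E0 / N.
  by rewrite divr_ge0 ?(ltW N_gt0)// mulr_ge0// mulr_ge0 ?powR_ge0// ltW.
apply: (@le_trans _ _ (e `^ p * (`|kappa| `^ p * b `^ p + E0 / N) * d x `^ (- (p * theta)))).
  by rewrite ler_wpM2r ?powR_ge0// ler_wpM2l ?powR_ge0.
rewrite mulrDr mulrDl; apply: lerD.
  by rewrite le_eqVlt; apply/orP; left; apply/eqP; ring.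
apply: (@le_trans _ _ (e `^ p * (E0 / N) * a2)).
  by apply: ler_wpM2l => //; exact: mulr_ge0 (powR_ge0 _ _) E00.
rewrite [leLHS](_ : _ = a2 * E0 / c / N * (e `^ p * c)); last by field; rewrite !gt_eqF.
by rewrite ler_wpM2l ?cE_ge0.
Qed.

Lemma G_ge x : x.1 != 0 -> a1 * `|u x| `^ p <= G x.
Proof.
move=> x0; have s0 := dotr_gt0 x0; rewrite G_E// abs_cutoffE// -/(tau x) -/(sig x).
have [tx|tx] := ltP `|tau x| 1; last first.
  by have [-> _] := bump_out tx; rewrite mul0r powR0 ?gt_eqF// !mulr0 mul0r.
have [sx|sx] := ltP `|sig x| 1; last first.
  by have [-> _] := bump_out sx; rewrite mulr0 powR0 ?gt_eqF// !mulr0 mul0r.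
have [h1 _ _] := cutoff_inside x0 tx sx.
by rewrite mulrC ler_wpM2l// mulr_ge0 ?powR_ge0.
Qed.

Lemma near_extremal_smooth : smooth_on (@setT pt) u.
Proof. exact: cutoff_smooth. Qed.

Lemma near_extremal_notbox x : ~ box x -> u x = 0.
Proof. by apply: cutoff_notbox => //; rewrite normr0. Qed.

Lemma ord3_le1 (i : 'I_3) : `|i%:R - 1 : R| <= 1.
Proof.
rewrite ler_norml; have : (i <= 2)%N by rewrite -ltnS.
by rewrite -(ler_nat R) => h; have : 0 <= i%:R :> R by []; move=> h'; apply/andP; split; lra.
Qed.

Lemma sharp_estimate (C : R) : 0 < a1 ->
  9 * (a2 * E0 / c / N) < (C - `|kappa| `^ p) * a1 ->
  (lhs_int B p theta d u < C%:E * rhs_int p theta d u)%E.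
Proof.
move=> a1_gt0 hN; have [M M0 KM] := compact_norm_bound (@compact_box R m).
have b0 := @box_not0 R m; have cb := @compact_box R m.
rewrite (lhs_Gr theta m_gt0 p2 reg near_extremal_smooth cb b0 near_extremal_notbox M0 KM).
rewrite (rhs_Gr theta m_gt0 p2 reg near_extremal_smooth cb b0 near_extremal_notbox M0 KM) -EFinM lte_fin.
have [L1 L10 gF] := F_ggood theta p2 reg near_extremal_smooth cb b0 near_extremal_notbox KM.
have [L2 L20 gG] := G_ggood theta p2 reg near_extremal_smooth cb b0 near_extremal_notbox KM.
pose J := Gr (fun x => `|u x| `^ p).
have J0 : 0 < J by exact: (Gr_cutoff_gt0 m_gt0 p_gt0 r_gt0 r_le N_gt0 M0 KM).
have z1 : `|0 : R| <= 1 by rewrite normr0.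
have good b c' : `|b| <= 1 -> `|c'| <= 1 ->
    exists2 L, 0 <= L & ggood M L (fun x => `|cutoff p r N b c' x| `^ p).
  move=> b1 c1.
  have [L L0 gL] := @cutoff_gfgood R m p r N p_gt0 r_gt0 r_le N_gt0 M KM b c' b1 c1.
  by exists L => //; exact: (@gfgood_ggood _ _ _ _ _ gL).
have [L3 L30 gu] := good 0 0 z1 z1.
(* Each translate has the integral of [|u|^p], so the sum of the nine differences has integral zero,
   and [S] may be replaced by [9 |u|^p] under the integral. *)
have [L4 L40 [gS S0]] : nullint M (fun x => \sum_(i < 3) \sum_(j < 3)
    (`|cutoff p r N (i%:R - 1) (j%:R - 1) x| `^ p + (-1) * `|u x| `^ p)).
  apply: (nullint_sum m_gt0 M0) => i; apply: (nullint_sum m_gt0 M0) => j.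
  have [L L0 gL] := good _ _ (ord3_le1 i) (ord3_le1 j).
  have gu' := ggoodZ (-1) gu.
  exists (L + `|-1| * L3); first by rewrite addr_ge0 ?mulr_ge0.
  split; first exact: (ggoodD gL gu').
  have L3' : 0 <= `|-1| * L3 by rewrite mulr_ge0.
  apply: etrans (GrD m_gt0 M0 L0 L3' gL gu') _.
  apply: etrans (congr1 _ (GrZ m_gt0 (-1) M0 L30 gu)) _.
  apply: etrans (congr1 (fun s => s + _) (Gr_cutoff m_gt0 p_gt0 r_gt0 r_le N_gt0 M0 KM
    (ord3_le1 i) (ord3_le1 j))) _.
  by rewrite mulN1r subrr.
set eps := a2 * E0 / c / N in hN.
have g1 := ggoodZ (`|kappa| `^ p) gG.
have g2 := ggoodZ eps gS.
have g3 := ggoodZ (9 * eps) gu.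
have n1 : 0 <= `|(`|kappa| `^ p)| * L2 by exact: mulr_ge0.
have n2 : 0 <= `|eps| * L4 by exact: mulr_ge0.
have n3 : 0 <= `|9 * eps| * L3 by exact: mulr_ge0.
have g23 := ggoodD g2 g3; have g123 := ggoodD g1 g23.
have n23 := addr_ge0 n2 n3; have n123 := addr_ge0 n1 n23.
have GG : a1 * J <= Gr G.
  apply: le_trans (_ : Gr (fun x => a1 * `|u x| `^ p) <= _).
    by rewrite (GrZ m_gt0 _ M0 L30 gu).
  apply: (Gr_le m_gt0 M0 _ L20 (ggoodZ a1 gu) gG); first exact: mulr_ge0.
  exact: G_ge.
have FF : Gr F <= `|kappa| `^ p * Gr G + 9 * eps * J.
  have H := Gr_le m_gt0 M0 L10 n123 gF g123.
  have HE := GrD m_gt0 M0 n1 n23 g1 g23.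
  have HE2 := GrD m_gt0 M0 n2 n3 g2 g3.
  have HZ1 := GrZ m_gt0 (`|kappa| `^ p) M0 L20 gG.
  have HZ2 := GrZ m_gt0 eps M0 L40 gS.
  have HZ3 := GrZ m_gt0 (9 * eps) M0 L30 gu.
  have HE' := etrans HE (congr2 +%R HZ1 (etrans HE2 (congr2 +%R (etrans HZ2 (congr1 _ S0)) HZ3))).
  rewrite mulr0 add0r in HE'; rewrite -/J in HE'.
  apply: le_trans (_ : _ <= _); last by rewrite le_eqVlt; apply/orP; left; apply/eqP; exact: HE'.
  apply: H => x x0; apply: le_trans (F_le x0) _; rewrite lerD2l -/eps sum9D -/(S x).
  by rewrite le_eqVlt; apply/orP; left; apply/eqP; ring.
apply: le_lt_trans FF _.
have eps0 : 0 <= eps by exact: cE_ge0.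
have Ck : 0 < C - `|kappa| `^ p.
  by rewrite -(pmulr_lgt0 _ a1_gt0); apply: le_lt_trans hN; exact: mulr_ge0.
have h1 : 9 * eps * J < (C - `|kappa| `^ p) * a1 * J by rewrite ltr_pM2r.
have h2 : (C - `|kappa| `^ p) * (a1 * J) <= (C - `|kappa| `^ p) * Gr G.
  by rewrite ler_pM2l.
rewrite -ltrBrDl -mulrBl; apply: lt_le_trans h2; by rewrite mulrA.
Qed.

End Estimate.

Lemma sharpness (C : R) : `|kappa| `^ p < C ->
  exists u : pt -> R, Cc_inf_punct u /\
    (lhs_int B p theta d u < C%:E * rhs_int p theta d u)%E.
Proof.
move=> hC; have [rho [a1 [a2 [k [rho0 a10 a20 k0 bounds]]]]] := local_bounds.
(* [r] is fixed before [N], because the constant [D] grows with [1 / r]. *)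
pose r := Num.min (rho / 2) 4^-1.
have r0 : 0 < r by rewrite lt_min; apply/andP; split; [rewrite divr_gt0|rewrite invr_gt0].
have r4 : r <= 4^-1 by rewrite ge_min lexx orbT.
have rr : r < rho.
  apply: le_lt_trans (_ : rho / 2 < _); first by rewrite ge_min lexx.
  by lra.
pose D := 8 * `|2 * p * kappa / m%:R| + `|2 * p * theta / m%:R| * (2 * k) * (al + 8 + 16 * r^-1).
pose c : R := (expR (-4) * expR (-4)) `^ p.
pose E0 := p * (2 * (`|kappa| + D)) `^ (p - 1) * D.
have Ck : 0 < C - `|kappa| `^ p by rewrite subr_gt0.
pose q := 9 * `|a2 * E0 / c| / ((C - `|kappa| `^ p) * a1).
have Ca : 0 < (C - `|kappa| `^ p) * a1 by exact: mulr_gt0.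
have q0 : 0 <= q by apply: divr_ge0; [exact: mulr_ge0|exact: ltW].
(* The three terms ensure [N >= 1], [2 / N < rho] and [N > q]; the last makes the total error
   smaller than the gap between [C] and the constant. *)
pose N := 1 + 2 / rho + q.
have rho2 : 0 < 2 / rho by rewrite divr_gt0.
have N1 : 1 <= N by rewrite /N; lra.
have N0 : 0 < N by lra.
have Nr : 2 / N < rho by rewrite ltr_pdivrMr// mulrC -ltr_pdivrMr// /N; lra.
exists (cutoff p r N 0 0); split.
  split; first exact: near_extremal_smooth.
  by exists (@box R m); split; [exact: compact_box|exact: box_not0|exact: near_extremal_notbox].
apply: (sharp_estimate (rho := rho) (a1 := a1) (a2 := a2) (k := k)) => //.
rewrite -/D -/E0 -/c mulrA ltr_pdivrMr//.
apply: (@le_lt_trans _ _ (9 * `|a2 * E0 / c|)); first by rewrite ler_wpM2l// ler_norm.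
rewrite -ltr_pdivrMl// [X in X < _](_ : _ = q); last by rewrite mulrC.
by rewrite /N; lra.
Qed.

End Sharpness.

Unset Implicit Arguments. Set Strict Implicit. Set Printing Implicit Defensive.

Theorem theorem1p3 (R : realType) (m : nat) (B : 'M[R]_m)
  (p theta : R) (d : pt R m -> R) :
  (0 < m)%N ->
  B^T = - B ->
  (forall v : 'cV[R]_m, B *m v = 0 -> v = 0) ->
  2 <= p ->
  regular_hom B d ->
  (forall u : pt R m -> R, Cc_inf_punct u ->
     (lhs_int B p theta d u >=
      (`|(m%:R + 2 - p * theta) / p| `^ p)%:E * rhs_int p theta d u)%E)
  /\
  ((forall x : pt R m, x != 0 ->
      dotr x.1 (Binv B (gradz d x)) = 0) ->
   (forall C : R, `|(m%:R + 2 - p * theta) / p| `^ p < C ->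
      exists u : pt R m -> R, Cc_inf_punct u /\
        (lhs_int B p theta d u < C%:E * rhs_int p theta d u)%E)
   /\
   (let u0 := fun x : pt R m => (`|x.2| / (dotr x.1 x.1)) `^ (m%:R / (2 * p)) in
    (lhs_int B p theta d u0 =
      (`|(m%:R + 2 - p * theta) / p| `^ p)%:E * rhs_int p theta d u0)%E)).
Proof.
move=> m_gt0 Bskew Binj p2 reg; split.
  move=> u [su [K [cK K0 uK]]].
  have [M M0 KM] := compact_norm_bound cK.
  exact: (hardy_inequality theta m_gt0 Bskew Binj p2 reg su cK K0 uK M0 KM).
move=> orth; split.
  by move=> C hC; exact: (sharpness m_gt0 Bskew Binj p2 reg orth hC).
have p_gt0 : 0 < p by apply: lt_le_trans p2.
exact: (extremal_equality theta m_gt0 Bskew Binj reg orth p_gt0).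
Qed.
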